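(* Let $u$ be the global Oleinik's solution of the steady Prandtl system with $U\equiv1$, with initial datum satisfying $|u_0(y)-1|\le C_4e^{-C_5y^2}$ and $-C_6e^{-C_7y^2}\le\partial_y^2u_0(y)\le0$ for all $y\ge0$, where $C_4,C_5,C_6,C_7>0$ and $C_5,C_7>C_1$. Let $\phi=w-\bar w$ in Von Mises variables. Then there exist positive constants $C$ and $c$ such that for all $(x,\psi)\in\mathbb{R}_+\times\mathbb{R}_+$: $$|\phi|\le\frac{C}{\sqrt{x+1}}e^{-c\frac{\psi^2}{x+1}},\quad |\partial_\psi^2\phi|\le\frac{C}{x+1}e^{-c\frac{\psi^2}{x+1}},\quad |\partial_x\phi|\le\frac{C}{x+1}e^{-c\frac{\psi^2}{x+1}},\quad |\partial_\psi\phi|\le\frac{C}{(x+1)^{3/4}}e^{-c\frac{\psi^2}{x+1}}.$$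
   Context: Steady Prandtl system with $U\equiv1$: $u\partial_xu+v\partial_yu-\partial_y^2u=0$, $\partial_xu+\partial_yv=0$ on $\mathbb{R}_+^2$, $u(0,y)=u_0(y)$, $u(x,0)=v(x,0)=0$, $u\to1$ as $y\to\infty$. The datum satisfies Oleinik's conditions: $u_0\in C_b^{2,\alpha}([0,\infty))$, $u_0(0)=0$, $u_0'(0)>0$, $u_0>0$ on $(0,\infty)$, $u_0''(y)=O(y^2)$ as $y\to0$, $u_0\to1$ at infinity. An Oleinik's solution is the unique global $C^1$ solution with: for every $X>0$, $u$ bounded continuous on $[0,X]\times\mathbb{R}_+$, $u>0$ for $y>0$, $u_y,u_{yy}$ bounded continuous, $v,v_y,u_x$ locally bounded continuous. Blasius profile $f$: $\frac12ff''+f'''=0$, $f(0)=f'(0)=0$, $f'(\infty)=1$; $f'\in[0,1]$, $f''\ge0$, $f''(0)>0$, $f$ strictly increasing; there are $C_1,C_2>0$ with $1-f'(\zeta)\sim\zeta^{-1}e^{-C_1\zeta^2-C_2\zeta}$, $f''(\zeta)\sim e^{-C_1\zeta^2-C_2\zeta}$ as $\zeta\to\infty$. Blasius solution $\bar u(x,y)=f'(y/\sqrt{x+1})$. Von Mises variables: $\psi=\int_0^yu(x,y')dy'$, $w(x,\psi)=u(x,y)^2$ (so $\partial_xw=\sqrt w\,\partial_\psi^2w$; $\partial_x$ is taken at fixed $\psi$). For the Blasius solution, $\bar w(x,\psi)=f'(\zeta)^2$ with $\zeta$ the unique solution of $f(\zeta)=\psi/\sqrt{x+1}$. *)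

(* Defs.v *)
From Stdlib Require Import Reals.
From Coquelicot Require Import Coquelicot.
Open Scope R_scope.

Definition cont_on_quad (g : R -> R -> R) : Prop :=
  forall x y, 0 <= x -> 0 <= y -> forall eps, 0 < eps ->
    exists delta, 0 < delta /\
      forall x' y', 0 <= x' -> 0 <= y' -> Rabs (x' - x) < delta ->
        Rabs (y' - y) < delta -> Rabs (g x' y' - g x y) < eps.

Definition bdd_strip (g : R -> R -> R) (X : R) : Prop :=
  exists M, forall x y, 0 <= x <= X -> 0 <= y -> Rabs (g x y) <= M.

Definition cont_on_halfline (h : R -> R) : Prop :=
  forall y, 0 <= y -> forall eps, 0 < eps ->
    exists delta, 0 < delta /\
      forall y', 0 <= y' -> Rabs (y' - y) < delta -> Rabs (h y' - h y) < eps.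

Definition bdd_halfline (h : R -> R) : Prop :=
  exists M, forall y, 0 <= y -> Rabs (h y) <= M.

(* Oleinik's conditions on the datum u0, with d1 = u0', d2 = u0'' on [0,oo)
   (derivatives in (0,oo), continuity up to 0, so d1 0, d2 0 are the
   one-sided derivatives). *)
Definition oleinik_datum (u0 d1 d2 : R -> R) : Prop :=
  (forall y, 0 < y -> is_derive u0 y (d1 y) /\ is_derive d1 y (d2 y)) /\
  cont_on_halfline u0 /\ cont_on_halfline d1 /\ cont_on_halfline d2 /\
  bdd_halfline u0 /\ bdd_halfline d1 /\ bdd_halfline d2 /\
  (exists alpha H, 0 < alpha < 1 /\
     forall y1 y2, 0 <= y1 -> 0 <= y2 -> y1 <> y2 ->
       Rabs (d2 y1 - d2 y2) <= H * Rpower (Rabs (y1 - y2)) alpha) /\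
  u0 0 = 0 /\ 0 < d1 0 /\
  (forall y, 0 < y -> 0 < u0 y) /\
  (exists K delta, 0 < delta /\
     forall y, 0 < y < delta -> Rabs (d2 y) <= K * y ^ 2) /\
  is_lim u0 p_infty 1.

Definition oleinik_solution (u0 : R -> R) (u v : R -> R -> R) : Prop :=
  exists ux uy uyy vy : R -> R -> R,
    (forall x y, 0 < x -> 0 < y ->
       is_derive (fun s => u s y) x (ux x y) /\
       is_derive (fun t => u x t) y (uy x y) /\
       is_derive (fun t => uy x t) y (uyy x y) /\
       is_derive (fun t => v x t) y (vy x y)) /\
    (forall x y, 0 < x -> 0 < y ->
       u x y * ux x y + v x y * uy x y - uyy x y = 0 /\
       ux x y + vy x y = 0) /\
    (forall y, 0 <= y -> u 0 y = u0 y) /\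
    (forall x, 0 <= x -> u x 0 = 0 /\ v x 0 = 0) /\
    (forall x, 0 <= x -> is_lim (fun t => u x t) p_infty 1) /\
    (forall x y, 0 <= x -> 0 < y -> 0 < u x y) /\
    cont_on_quad u /\ cont_on_quad ux /\ cont_on_quad uy /\
    cont_on_quad uyy /\ cont_on_quad v /\ cont_on_quad vy /\
    (* boundedness on every strip [0,X] x R_+ (local boundedness of
       v, vy, ux follows from their continuity on the closed quadrant) *)
    (forall X, 0 < X -> bdd_strip u X /\ bdd_strip uy X /\ bdd_strip uyy X).

Definition blasius (f f1 f2 : R -> R) : Prop :=
  (forall z, 0 < z ->
     is_derive f z (f1 z) /\ is_derive f1 z (f2 z) /\
     is_derive f2 z (- (1/2) * f z * f2 z)) /\
  cont_on_halfline f /\ cont_on_halfline f1 /\ cont_on_halfline f2 /\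
  f 0 = 0 /\ f1 0 = 0 /\ is_lim f1 p_infty 1.

Definition blasius_rate (f2 : R -> R) (C1 : R) : Prop :=
  exists C2 K1 K2 Z, 0 < K1 /\ 0 < K2 /\
    forall z, Z <= z ->
      K1 * exp (- C1 * z ^ 2 - C2 * z) <= f2 z /\
      f2 z <= K2 * exp (- C1 * z ^ 2 - C2 * z).

Definition vm_psi (u : R -> R -> R) (x y : R) : R :=
  RInt (fun t => u x t) 0 y.

Definition von_mises (u w : R -> R -> R) : Prop :=
  forall x y, 0 <= x -> 0 <= y -> w x (vm_psi u x y) = (u x y) ^ 2.

Definition blasius_vm (f f1 : R -> R) (wb : R -> R -> R) : Prop :=
  forall x psi z, 0 <= x -> 0 <= psi -> 0 <= z ->
    f z = psi / sqrt (x + 1) -> wb x psi = (f1 z) ^ 2.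

(* Main.v *)
Require Import Defs.
From Stdlib Require Import Reals Lra Lia Classical ClassicalEpsilon.
From Coquelicot Require Import Coquelicot.
Open Scope R_scope.

(** Everything follows from comparison for [w_x = sqrt w * w_pp] and the symmetries
    of this equation.  Write the Blasius solution as [F (p / sqrt (x + 1))].

    Comparison with shifted similarity solutions gives
    [F (p / sqrt (x + s)) <= w x p <= F (p / sqrt x)] for some [s >= 1]; since [F] is
    concave with Gaussian tails, this yields the bound on [phi] and a Gaussian bound
    on [1 - w].  The concave datum is a stationary supersolution, so [w] decreases
    in [x] and stays concave in [p].  Comparing [w x p] with [w (m^2 x) (m p)] gives
    [2 x w_x >= - p w_p], where [p w_p <= 2 (1 - w x (p / 2))] by concavity; this is
    the decay in [x] of [w_x], up to a barrier for [x <= 1].  Comparing [w (x + h) p]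
    with [exp (- k h) * w (exp (- k h / 2) x) p] gives
    [- w_x <= k w / (1 + k x / 2)].  The product of the two bounds on [w_x] controls
    [w w_pp^2], and [phi_p] follows by interpolation between [phi] and [phi_pp]. *)

(** * Calculus on the half line and on the closed quadrant *)

(** Two obstacles shape the argument. The solution is only once differentiable in [x] and twice in
    [p], so the equation cannot be differentiated. Every derivative bound comes instead from
    comparing [w] with a one-parameter family that touches it at the trivial parameter, and
    differentiating in that parameter alone. The families come from translation in [x] and from the
    scalings [mu * w (sqrt mu * nu^2 * x) (nu * p)], which preserve the equation. Moreover, the
    difference of two solutions [A] and [Z] carries the term [(sqrt A - sqrt Z)] times a second
    derivative. Where [A > Z] it has the right sign if one of the two is concave in [p]. The datum
    and the similarity solutions are concave from the start; [w] is known to be so only after its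
    monotonicity in [x]. That monotonicity is thus the one comparison made without concavity. It
    meets a zeroth order term of size [1 / sqrt p] at the wall, where the diffusion [sqrt w] also
    degenerates, and this is why the weight of the maximum principle contains [sqrt p]. The bound
    drawn from dilations is empty as [x] tends to 0, hence the separate barrier there. *)

Lemma Rabs_lt_iff (a e : R) : Rabs a < e <-> - e < a < e.
Proof.
  split.
  - intros H. apply Rabs_def2 in H. lra.
  - intros H. apply Rabs_def1; lra.
Qed.

Lemma Rmax0_id (x : R) : 0 <= x -> Rmax 0 x = x.
Proof. intros H. now apply Rmax_right. Qed.

Lemma Rmax0_dist (x y : R) : Rabs (Rmax 0 x - Rmax 0 y) <= Rabs (x - y).
Proof. unfold Rmax; repeat destruct (Rle_dec _ _); split_Rabs; lra. Qed.

(** Freezing the function at its value in 0 makes it continuous on the whole line, so two-sided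
    theorems apply up to the boundary. *)
Lemma cont_on_halfline_ext_pt (h : R -> R) :
  cont_on_halfline h -> forall t, continuity_pt (fun t => h (Rmax 0 t)) t.
Proof.
  intros Hh t. apply continuity_pt_locally. intros eps.
  destruct (Hh (Rmax 0 t) (Rmax_l _ _) eps (cond_pos eps)) as [d [Hd H]].
  exists (mkposreal d Hd). intros s Hs. apply H. apply Rmax_l.
  eapply Rle_lt_trans. apply Rmax0_dist. exact Hs.
Qed.

Lemma locally_pos (x : R) : 0 < x -> locally x (fun t => 0 < t).
Proof.
  intros Hx. exists (mkposreal x Hx). intros t Ht. apply Rabs_def2 in Ht.
  unfold minus, plus, opp in Ht; simpl in Ht. lra.
Qed.

Lemma is_derive_ext_pos (f g : R -> R) (x l : R) :
  0 < x -> (forall t, 0 < t -> f t = g t) -> is_derive f x l -> is_derive g x l.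
Proof.
  intros Hx He. apply is_derive_ext_loc.
  generalize (locally_pos x Hx). apply filter_imp. auto.
Qed.

Lemma is_derive_eps (f : R -> R) (x l : R) :
  is_derive f x l -> forall eps, 0 < eps -> exists d, 0 < d /\
  forall t, Rabs (t - x) < d -> Rabs (f t - f x - l * (t - x)) <= eps * Rabs (t - x).
Proof.
  intros Hf eps He. apply is_derive_Reals in Hf. destruct (Hf eps He) as [d Hd].
  exists d. split. apply cond_pos. intros t Ht.
  destruct (Req_dec t x) as [->|Hn].
  - rewrite !Rminus_diag, Rmult_0_r, Rminus_0_r, Rabs_R0. lra.
  - assert (Hh : t - x <> 0) by lra.
    specialize (Hd (t - x) Hh Ht). replace (x + (t - x)) with t in Hd by ring.
    replace (f t - f x - l * (t - x)) with (((f t - f x) / (t - x) - l) * (t - x)) by (field; lra).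
    rewrite Rabs_mult. apply Rmult_le_compat_r. apply Rabs_pos. lra.
Qed.

Lemma is_derive_continuity_pt (f : R -> R) (x l : R) :
  is_derive f x l -> continuity_pt f x.
Proof.
  intros H. apply derivable_continuous_pt. exists l. now apply is_derive_Reals.
Qed.

(** The endpoint [a = 0] is allowed although no derivative is given there: Cauchy's form of the
    theorem, against the identity, asks for derivatives only inside the interval and for continuity
    at its ends. *)
Lemma cont_halfline_mvt (h h' : R -> R) (a b : R) :
  cont_on_halfline h -> (forall t, 0 < t -> is_derive h t (h' t)) ->
  0 <= a < b -> exists c, a < c < b /\ h b - h a = h' c * (b - a).
Proof.
  intros Hc Hd Hab. set (k := fun t => h (Rmax 0 t)).
  assert (Hk : forall t, 0 < t -> is_derive k t (h' t)).
  { intros t Ht. apply (is_derive_ext_pos h); auto.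
    intros s Hs. unfold k. now rewrite Rmax0_id by lra. }
  assert (pr1 : forall c, a < c < b -> derivable_pt k c).
  { intros c Hcab. exists (h' c). apply is_derive_Reals, Hk. lra. }
  assert (pr2 : forall c, a < c < b -> derivable_pt id c).
  { intros c _. apply derivable_pt_id. }
  destruct (MVT k id a b pr1 pr2) as [c [P E]].
  - lra.
  - intros c _. apply cont_on_halfline_ext_pt, Hc.
  - intros c _. apply derivable_continuous_pt, derivable_pt_id.
  - exists c. split; [exact P|].
    assert (E1 : derive_pt k c (pr1 c P) = h' c).
    { apply derive_pt_eq. apply is_derive_Reals, Hk. lra. }
    assert (E2 : derive_pt id c (pr2 c P) = 1).
    { apply derive_pt_eq. apply derivable_pt_lim_id. }
    rewrite E1, E2 in E. unfold id, k in E. rewrite !Rmax0_id in E by lra. lra.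
Qed.

Lemma halfline_nondecreasing (h h' : R -> R) (a b : R) :
  cont_on_halfline h -> (forall t, 0 < t -> is_derive h t (h' t)) ->
  0 <= a <= b -> (forall t, a < t < b -> 0 <= h' t) -> h a <= h b.
Proof.
  intros Hc Hd [Ha Hab] Hs. destruct (Req_dec a b) as [->|Hn]; [lra|].
  destruct (cont_halfline_mvt h h' a b) as [c [Pc E]]; auto; [lra|].
  specialize (Hs c Pc). nra.
Qed.

Lemma halfline_increasing (h h' : R -> R) (a b : R) :
  cont_on_halfline h -> (forall t, 0 < t -> is_derive h t (h' t)) ->
  0 <= a < b -> (forall t, a < t < b -> 0 < h' t) -> h a < h b.
Proof.
  intros Hc Hd Hab Hs.
  destruct (cont_halfline_mvt h h' a b) as [c [Pc E]]; auto.
  specialize (Hs c Pc). nra.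
Qed.

Lemma cont_halfline_lin (h k : R -> R) (a b : R) :
  cont_on_halfline h -> cont_on_halfline k ->
  cont_on_halfline (fun t => a * h t + b * k t).
Proof.
  intros Hh Hk y Hy eps He.
  set (A := Rabs a + Rabs b + 1).
  assert (HA : 0 < A) by (unfold A; generalize (Rabs_pos a) (Rabs_pos b); lra).
  destruct (Hh y Hy (eps / A)) as [d1 [Hd1 H1]]; [now apply Rdiv_lt_0_compat|].
  destruct (Hk y Hy (eps / A)) as [d2 [Hd2 H2]]; [now apply Rdiv_lt_0_compat|].
  exists (Rmin d1 d2). split; [now apply Rmin_glb_lt|].
  intros t Ht Hd.
  specialize (H1 t Ht (Rlt_le_trans _ _ _ Hd (Rmin_l _ _))).
  specialize (H2 t Ht (Rlt_le_trans _ _ _ Hd (Rmin_r _ _))).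
  replace (a * h t + b * k t - (a * h y + b * k y))
    with (a * (h t - h y) + b * (k t - k y)) by ring.
  eapply Rle_lt_trans; [apply Rabs_triang|]. rewrite !Rabs_mult.
  assert (E : eps = (Rabs a + Rabs b + 1) * (eps / A)) by (unfold A; field; unfold A in HA; lra).
  assert (He' : 0 < eps / A) by now apply Rdiv_lt_0_compat.
  generalize (Rabs_pos a) (Rabs_pos b). intros Pa Pb. rewrite E at 1.
  assert (Rabs a * Rabs (h t - h y) <= Rabs a * (eps / A)) by (apply Rmult_le_compat_l; lra).
  assert (Rabs b * Rabs (k t - k y) <= Rabs b * (eps / A)) by (apply Rmult_le_compat_l; lra).
  lra.
Qed.

Lemma cont_halfline_of_cont (h : R -> R) :
  (forall t, 0 <= t -> continuity_pt h t) -> cont_on_halfline h.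
Proof.
  intros H y Hy eps He. specialize (H y Hy).
  destruct (proj1 (continuity_pt_locally h y) H (mkposreal eps He)) as [d Hd].
  exists d. split; [apply cond_pos|]. intros t _ Ht. apply Hd. exact Ht.
Qed.

Lemma cont_halfline_sq (h : R -> R) :
  cont_on_halfline h -> cont_on_halfline (fun t => h t ^ 2).
Proof.
  intros H y Hy eps He.
  assert (Hc := cont_on_halfline_ext_pt h H y).
  assert (Hc2 : continuity_pt (fun t => h (Rmax 0 t) * h (Rmax 0 t)) y)
    by (apply continuity_pt_mult; exact Hc).
  destruct (proj1 (continuity_pt_locally _ y) Hc2 (mkposreal eps He)) as [d Hd].
  exists d. split; [apply cond_pos|]. intros t Ht Hty.
  specialize (Hd t Hty). simpl in Hd. rewrite !Rmax0_id in Hd by lra.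
  now rewrite <- !Rsqr_pow2.
Qed.

(** * Joint continuity on the closed quadrant and maxima over rectangles *)

Definition quad_ext (g : R -> R -> R) (x y : R) : R := g (Rmax 0 x) (Rmax 0 y).

Lemma quad_ext_id (g : R -> R -> R) (x y : R) : 0 <= x -> 0 <= y -> quad_ext g x y = g x y.
Proof. intros Hx Hy. unfold quad_ext. now rewrite !Rmax0_id. Qed.

Lemma cont_on_quad_ext (g : R -> R -> R) :
  cont_on_quad g <-> forall x y, continuity_2d_pt (quad_ext g) x y.
Proof.
  split.
  - intros H x y eps.
    destruct (H (Rmax 0 x) (Rmax 0 y) (Rmax_l _ _) (Rmax_l _ _) eps (cond_pos eps))
      as [d [Hd H1]].
    exists (mkposreal d Hd). intros s t Hs Ht. unfold quad_ext. apply H1; try apply Rmax_l.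
    + eapply Rle_lt_trans. apply Rmax0_dist. exact Hs.
    + eapply Rle_lt_trans. apply Rmax0_dist. exact Ht.
  - intros H x y Hx Hy eps He. destruct (H x y (mkposreal eps He)) as [d Hd].
    exists d. split; [apply cond_pos|]. intros s t Hs Ht Hsx Hty.
    specialize (Hd s t Hsx Hty). now rewrite !quad_ext_id in Hd by lra.
Qed.

Lemma cont_quad_plus (g k : R -> R -> R) :
  cont_on_quad g -> cont_on_quad k -> cont_on_quad (fun x y => g x y + k x y).
Proof.
  rewrite !cont_on_quad_ext. intros Hg Hk x y. unfold quad_ext.
  apply (continuity_2d_pt_plus (quad_ext g) (quad_ext k)); auto.
Qed.

Lemma cont_quad_minus (g k : R -> R -> R) :
  cont_on_quad g -> cont_on_quad k -> cont_on_quad (fun x y => g x y - k x y).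
Proof.
  rewrite !cont_on_quad_ext. intros Hg Hk x y. unfold quad_ext.
  apply (continuity_2d_pt_minus (quad_ext g) (quad_ext k)); auto.
Qed.

Lemma cont_quad_mult (g k : R -> R -> R) :
  cont_on_quad g -> cont_on_quad k -> cont_on_quad (fun x y => g x y * k x y).
Proof.
  rewrite !cont_on_quad_ext. intros Hg Hk x y. unfold quad_ext.
  apply (continuity_2d_pt_mult (quad_ext g) (quad_ext k)); auto.
Qed.

Lemma cont_quad_of_2d (g : R -> R -> R) :
  (forall x y, 0 <= x -> 0 <= y -> continuity_2d_pt g x y) -> cont_on_quad g.
Proof.
  intros H x y Hx Hy eps He. destruct (H x y Hx Hy (mkposreal eps He)) as [d Hd].
  exists d. split; [apply cond_pos|]. intros s t _ _. apply Hd.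
Qed.

Lemma cont_quad_const (c : R) : cont_on_quad (fun _ _ => c).
Proof. apply cont_quad_of_2d. intros. apply continuity_2d_pt_const. Qed.

Lemma cont_quad_fst : cont_on_quad (fun x _ => x).
Proof. apply cont_quad_of_2d. intros. apply continuity_2d_pt_id1. Qed.

Lemma cont_quad_snd : cont_on_quad (fun _ y => y).
Proof. apply cont_quad_of_2d. intros. apply continuity_2d_pt_id2. Qed.

Lemma cont_quad_comp (g a b : R -> R -> R) :
  cont_on_quad g -> cont_on_quad a -> cont_on_quad b ->
  (forall x y, 0 <= x -> 0 <= y -> 0 <= a x y /\ 0 <= b x y) ->
  cont_on_quad (fun x y => g (a x y) (b x y)).
Proof.
  intros Hg Ha Hb Hab x y Hx Hy eps He.
  destruct (Hab x y Hx Hy) as [Pa Pb].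
  destruct (Hg _ _ Pa Pb eps He) as [d [Hd H]].
  destruct (Ha x y Hx Hy d Hd) as [d1 [Hd1 H1]].
  destruct (Hb x y Hx Hy d Hd) as [d2 [Hd2 H2]].
  exists (Rmin d1 d2). split; [now apply Rmin_glb_lt|].
  intros s t Hs Ht Hsx Hty. destruct (Hab s t Hs Ht).
  apply H; auto.
  - apply H1; auto; eapply Rlt_le_trans; eauto; apply Rmin_l.
  - apply H2; auto; eapply Rlt_le_trans; eauto; apply Rmin_r.
Qed.

Lemma cont_quad_comp_halfline (h : R -> R) (a : R -> R -> R) :
  cont_on_halfline h -> cont_on_quad a ->
  (forall x y, 0 <= x -> 0 <= y -> 0 <= a x y) ->
  cont_on_quad (fun x y => h (a x y)).
Proof.
  intros Hh Ha Pa. apply (cont_quad_comp (fun _ t => h t) a a); auto.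
  intros x y Hx Hy eps He. destruct (Hh y Hy eps He) as [d [Hd H]].
  exists d. split; auto.
Qed.

Lemma cont_quad_comp_1d (h : R -> R) (a : R -> R -> R) :
  (forall x y, 0 <= x -> 0 <= y -> continuity_pt h (a x y)) -> cont_on_quad a ->
  cont_on_quad (fun x y => h (a x y)).
Proof.
  intros Hh Ha x y Hx Hy eps He.
  destruct (proj1 (continuity_pt_locally h (a x y)) (Hh x y Hx Hy) (mkposreal eps He)) as [d Hd].
  destruct (Ha x y Hx Hy d (cond_pos d)) as [d1 [Hd1 H1]].
  exists d1. split; auto. intros s t Hs Ht Hsx Hty. apply Hd. apply H1; auto.
Qed.

Lemma cont_quad_ext_eq (g k : R -> R -> R) :
  (forall x y, 0 <= x -> 0 <= y -> g x y = k x y) -> cont_on_quad g -> cont_on_quad k.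
Proof.
  intros E H x y Hx Hy eps He. destruct (H x y Hx Hy eps He) as [d [Hd H1]].
  exists d. split; auto. intros s t Hs Ht Hsx Hty. rewrite <- !E; auto.
Qed.

Lemma cont_quad_row (g : R -> R -> R) (x : R) :
  0 <= x -> cont_on_quad g -> cont_on_halfline (g x).
Proof.
  intros Hx H y Hy eps He. destruct (H x y Hx Hy eps He) as [d [Hd H1]].
  exists d. split; auto. intros t Ht Hty. apply H1; auto.
  rewrite Rminus_diag, Rabs_R0. exact Hd.
Qed.

Lemma cont_quad_max (g : R -> R -> R) (X Y : R) :
  0 <= X -> 0 <= Y -> cont_on_quad g ->
  exists xm ym, 0 <= xm <= X /\ 0 <= ym <= Y /\
    forall x y, 0 <= x <= X -> 0 <= y <= Y -> g x y <= g xm ym.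
Proof.
  intros HX HY Hg.
  assert (Hb : exists M, forall x y, 0 <= x <= X -> 0 <= y <= Y -> g x y <= M).
  (* The radius [d] of the gauge also encodes the local bound [/ d], so a uniform lower bound on the
     radii is a global bound on [g]. *)
  { assert (HC : forall x y, exists d : posreal, 0 <= x -> 0 <= y ->
      (forall s t, 0 <= s -> 0 <= t -> Rabs (s - x) < d -> Rabs (t - y) < d ->
         g s t <= / d)).
    { intros x y. destruct (Rle_dec 0 x) as [Hx|Hx]; [|exists (mkposreal 1 Rlt_0_1); intros; lra].
      destruct (Rle_dec 0 y) as [Hy|Hy]; [|exists (mkposreal 1 Rlt_0_1); intros; lra].
      destruct (Hg x y Hx Hy 1 Rlt_0_1) as [d [Hd H]].
      assert (HN : 0 < / (Rabs (g x y) + 1)) by (apply Rinv_0_lt_compat; generalize (Rabs_pos (g x y)); lra).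
      assert (Hm : 0 < Rmin d (/ (Rabs (g x y) + 1))) by now apply Rmin_glb_lt.
      exists (mkposreal _ Hm). intros _ _ s t Hs Ht Hsx Hty. simpl in *.
      assert (H1 : Rabs (g s t - g x y) < 1).
      { apply H; auto; eapply Rlt_le_trans; eauto; apply Rmin_l. }
      apply Rle_trans with (Rabs (g x y) + 1).
      - generalize (Rle_abs (g x y)). apply Rabs_def2 in H1. lra.
      - apply Rle_trans with (/ / (Rabs (g x y) + 1)); [rewrite Rinv_inv; lra|].
        apply Rinv_le_contravar; [exact Hm|apply Rmin_r]. }
    set (dl := fun x y => proj1_sig (constructive_indefinite_description _ (HC x y))).
    destruct (compactness_value_2d 0 X 0 Y dl) as [d Hd].
    exists (/ d). intros x y Hx Hy. apply NNPP. intros Hn.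
    apply (Hd x y Hx Hy). intros [a [b [Ha [Hb [H1 [H2 H3]]]]]]. apply Hn.
    unfold dl in *. destruct (constructive_indefinite_description _ (HC a b)) as [e He]. simpl in *.
    apply Rle_trans with (/ e). apply He; lra.
    apply Rinv_le_contravar; auto. apply cond_pos. }
  destruct Hb as [M HM].
  set (S := fun z => exists x y, 0 <= x <= X /\ 0 <= y <= Y /\ z = g x y).
  destruct (completeness S) as [m [Hm1 Hm2]].
  { exists M. intros z [x [y [Hx [Hy ->]]]]. auto. }
  { exists (g 0 0), 0, 0. repeat split; lra. }
  apply NNPP. intros Hn.
  assert (Hlt : forall x y, 0 <= x <= X -> 0 <= y <= Y -> g x y < m).
  { intros x y Hx Hy. destruct (Rlt_le_dec (g x y) m) as [|Hle]; auto. exfalso. apply Hn.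
    exists x, y. repeat split; try lra. intros x' y' Hx' Hy'.
    apply Rle_trans with m; auto. apply Hm1. exists x', y'. auto. }
  (* If the supremum [m] is not attained, the radius can record a local gap below [m]; compactness
     makes the gap uniform, which contradicts that [m] is the least upper bound. *)
  assert (HC : forall x y, exists d : posreal, 0 <= x <= X -> 0 <= y <= Y ->
    (forall s t, 0 <= s -> 0 <= t -> Rabs (s - x) < d -> Rabs (t - y) < d ->
       g s t <= m - d)).
  { intros x y.
    destruct (classic (0 <= x <= X /\ 0 <= y <= Y)) as [[Hx Hy]|Hxy];
      [|exists (mkposreal 1 Rlt_0_1); tauto].
    assert (Hp : 0 < (m - g x y) / 2) by (specialize (Hlt x y Hx Hy); lra).
    destruct (Hg x y (proj1 Hx) (proj1 Hy) _ Hp) as [d [Hd H]].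
    assert (Hmn : 0 < Rmin d ((m - g x y) / 2)) by now apply Rmin_glb_lt.
    exists (mkposreal _ Hmn). intros _ _ s t Hs Ht Hsx Hty. simpl in *.
    assert (H1 : Rabs (g s t - g x y) < (m - g x y) / 2).
    { apply H; auto; eapply Rlt_le_trans; eauto; apply Rmin_l. }
    apply Rabs_def2 in H1. generalize (Rmin_r d ((m - g x y) / 2)). lra. }
  set (dl := fun x y => proj1_sig (constructive_indefinite_description _ (HC x y))).
  destruct (compactness_value_2d 0 X 0 Y dl) as [d Hd].
  assert (Hle : m <= m - d).
  { apply Hm2. intros z [x [y [Hx [Hy ->]]]]. apply NNPP. intros Hnn.
    apply (Hd x y Hx Hy). intros [a [b [Ha [Hb [H1 [H2 H3]]]]]]. apply Hnn.
    unfold dl in *. destruct (constructive_indefinite_description _ (HC a b)) as [e He]. simpl in *.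
    apply Rle_trans with (m - e); [|lra]. apply He; lra. }
  generalize (cond_pos d). lra.
Qed.

Lemma cont_quad_bounded (g : R -> R -> R) (X Y : R) :
  0 <= X -> 0 <= Y -> cont_on_quad g ->
  exists M, 0 < M /\ forall x y, 0 <= x <= X -> 0 <= y <= Y -> Rabs (g x y) <= M.
Proof.
  intros HX HY Hg.
  destruct (cont_quad_max (fun x y => Rabs (g x y)) X Y HX HY) as [a [b [Ha [Hb H]]]].
  { apply (cont_quad_comp_1d Rabs); auto. intros. apply Rcontinuity_abs. }
  exists (Rabs (g a b) + 1). split; [generalize (Rabs_pos (g a b)); lra|].
  intros x y Hx Hy. specialize (H x y Hx Hy). simpl in H. lra.
Qed.

(** One continuous partial derivative suffices: the increment in [x] is taken at the displaced
    ordinate by the mean value theorem, and the increment in [y] only on the line through the base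
    point. *)
Lemma differentiable_of_partials (g gx : R -> R -> R) (x y gy : R) :
  0 < x -> 0 < y ->
  (forall s t, 0 < s -> 0 < t -> is_derive (fun s => g s t) s (gx s t)) ->
  continuity_2d_pt gx x y -> is_derive (g x) y gy ->
  differentiable_pt_lim g x y (gx x y) gy.
Proof.
  intros Hx Hy Hgx Hc Hgy eps.
  assert (He : 0 < eps / 2) by (generalize (cond_pos eps); lra).
  destruct (Hc (mkposreal _ He)) as [d1 H1].
  destruct (is_derive_eps _ _ _ Hgy _ He) as [d2 [Hd2 H2]].
  assert (Hd : 0 < Rmin (Rmin d1 d2) (Rmin x y)).
  { repeat apply Rmin_glb_lt; auto. apply cond_pos. }
  exists (mkposreal _ Hd). simpl. intros a b Ha Hb.
  assert (Hdd := Rmin_l (Rmin d1 d2) (Rmin x y)). assert (Hdx := Rmin_r (Rmin d1 d2) (Rmin x y)).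
  assert (Hd1' := Rmin_l d1 d2). assert (Hd2' := Rmin_r d1 d2).
  assert (Hx' := Rmin_l x y). assert (Hy' := Rmin_r x y).
  set (D := Rmin (Rmin d1 d2) (Rmin x y)) in *.
  assert (Ha' := proj1 (Rabs_lt_iff _ _) Ha). assert (Hb' := proj1 (Rabs_lt_iff _ _) Hb).
  specialize (H2 b ltac:(lra)).
  destruct (MVT_gen (fun s => g s b) x a (fun s => gx s b)) as [c [Pc E]].
  { intros s Hs. apply Hgx; [|lra]. unfold Rmin, Rmax in Hs. destruct (Rle_dec x a); lra. }
  { intros s Hs. eapply is_derive_continuity_pt. apply Hgx; [|lra].
    unfold Rmin, Rmax in Hs. destruct (Rle_dec x a); lra. }
  assert (Hcx : Rabs (c - x) < d1).
  { apply Rabs_lt_iff. unfold Rmin, Rmax in Pc. destruct (Rle_dec x a); lra. }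
  specialize (H1 c b Hcx ltac:(lra)). simpl in H1.
  replace (g a b - g x y - (gx x y * (a - x) + gy * (b - y)))
    with ((gx c b - gx x y) * (a - x) + (g x b - g x y - gy * (b - y))) by lra.
  eapply Rle_trans; [apply Rabs_triang|]. rewrite Rabs_mult.
  assert (M1 := Rmax_l (Rabs (a - x)) (Rabs (b - y))).
  assert (M2 := Rmax_r (Rabs (a - x)) (Rabs (b - y))).
  set (Mx := Rmax (Rabs (a - x)) (Rabs (b - y))) in *.
  assert (Rabs (gx c b - gx x y) * Rabs (a - x) <= eps / 2 * Mx).
  { apply Rmult_le_compat; try apply Rabs_pos; lra. }
  assert (eps / 2 * Rabs (b - y) <= eps / 2 * Mx) by (apply Rmult_le_compat_l; lra).
  lra.
Qed.

(** Differentiability of [Q] at a single point is enough because [Y] is already known to be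
    continuous. The expansion of [Q] is used twice: to show that the increment of [Y] is of the
    order of [h], and then to identify the quotient. *)
Lemma is_derive_implicit (Q : R -> R -> R) (Y : R -> R) (s l1 l2 : R) :
  differentiable_pt_lim Q s (Y s) l1 l2 -> l2 <> 0 ->
  continuity_pt Y s -> locally s (fun t => Q t (Y t) = Q s (Y s)) ->
  is_derive Y s (- l1 / l2).
Proof.
  intros HQ Hl HY HE. apply is_derive_Reals. intros eps He.
  assert (Hl' : 0 < Rabs l2) by now apply Rabs_pos_lt.
  set (K := 1 + Rabs (l1 / l2)).
  assert (HK : 1 <= K) by (unfold K; generalize (Rabs_pos (l1 / l2)); lra).
  (* The bound [1/2] lets the increment [k] be absorbed on the left; [eps / (4 * K)] leaves room for
     [|k| <= 2 * K * |h|] in the final error. *)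
  set (e := Rmin (1/2) (eps / (4 * K))).
  assert (Hek : 0 < eps / (4 * K)) by (apply Rdiv_lt_0_compat; lra).
  assert (He0 : 0 < e) by (apply Rmin_glb_lt; lra).
  assert (He1 : e <= 1/2) by apply Rmin_l.
  assert (He2 : 4 * K * e <= eps).
  { assert (H : e <= eps / (4 * K)) by apply Rmin_r.
    apply Rmult_le_compat_l with (r := 4 * K) in H; [|lra].
    replace (4 * K * (eps / (4 * K))) with eps in H by (field; lra). exact H. }
  assert (Hel : 0 < e * Rabs l2) by nra.
  destruct (HQ (mkposreal _ Hel)) as [d1 H1].
  destruct (proj1 (continuity_pt_locally Y s) HY d1) as [d2 H2].
  destruct HE as [d3 H3].
  assert (Hd : 0 < Rmin d1 (Rmin d2 d3)) by (repeat apply Rmin_glb_lt; apply cond_pos).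
  exists (mkposreal _ Hd). simpl. intros h Hh Hhd.
  assert (D1 : Rabs h < d1) by (eapply Rlt_le_trans; [exact Hhd|apply Rmin_l]).
  assert (D2 : Rabs h < d2) by (eapply Rlt_le_trans; [exact Hhd|eapply Rle_trans; [apply Rmin_r|apply Rmin_l]]).
  assert (D3 : Rabs h < d3) by (eapply Rlt_le_trans; [exact Hhd|eapply Rle_trans; [apply Rmin_r|apply Rmin_r]]).
  assert (E : s + h - s = h) by ring.
  assert (B2 : Rabs (Y (s + h) - Y s) < d1).
  { apply H2. change (Rabs (s + h - s) < d2). now rewrite E. }
  assert (B3 : Q (s + h) (Y (s + h)) = Q s (Y s)).
  { apply H3. change (Rabs (s + h - s) < d3). now rewrite E. }
  specialize (H1 (s + h) (Y (s + h))). rewrite E, B3 in H1. specialize (H1 D1 B2). simpl in H1.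
  set (k := Y (s + h) - Y s) in *.
  replace (Q s (Y s) - Q s (Y s) - (l1 * h + l2 * k)) with (- (l2 * (k + l1 / l2 * h))) in H1
    by (field; auto).
  rewrite Rabs_Ropp, Rabs_mult in H1.
  assert (H4 : Rabs (k + l1 / l2 * h) <= e * Rmax (Rabs h) (Rabs k)).
  { apply Rmult_le_reg_l with (Rabs l2); auto.
    replace (Rabs l2 * (e * Rmax (Rabs h) (Rabs k))) with (e * Rabs l2 * Rmax (Rabs h) (Rabs k)) by ring.
    exact H1. }
  assert (Hk : Rabs k <= 2 * K * Rabs h).
  { assert (T : Rabs k <= Rabs (k + l1 / l2 * h) + Rabs (l1 / l2) * Rabs h).
    { replace k with ((k + l1 / l2 * h) + - (l1 / l2 * h)) at 1 by ring.
      eapply Rle_trans; [apply Rabs_triang|]. rewrite Rabs_Ropp, Rabs_mult. lra. }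
    assert (T2 : Rmax (Rabs h) (Rabs k) <= Rabs h + Rabs k).
    { apply Rmax_lub; generalize (Rabs_pos h) (Rabs_pos k); lra. }
    assert (T3 : e * Rmax (Rabs h) (Rabs k) <= 1/2 * (Rabs h + Rabs k)).
    { apply Rmult_le_compat; try lra. eapply Rle_trans; [apply Rabs_pos|apply Rmax_l]. }
    unfold K. generalize (Rabs_pos h) (Rabs_pos (l1/l2)). nra. }
  assert (Hm : Rmax (Rabs h) (Rabs k) <= 2 * K * Rabs h).
  { apply Rmax_lub; auto. generalize (Rabs_pos h). nra. }
  assert (Hh' : 0 < Rabs h) by now apply Rabs_pos_lt.
  replace (k / h - - l1 / l2) with ((k + l1 / l2 * h) / h) by (field; auto).
  unfold Rdiv at 1. rewrite Rabs_mult, Rabs_inv.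
  apply Rmult_lt_reg_r with (Rabs h); auto. rewrite Rmult_assoc, Rinv_l, Rmult_1_r by lra.
  eapply Rle_lt_trans; [exact H4|].
  apply Rle_lt_trans with (e * (2 * K * Rabs h)); [apply Rmult_le_compat_l; lra|]. nra.
Qed.

Lemma is_derive_Rplus (f g : R -> R) (x a b : R) :
  is_derive f x a -> is_derive g x b -> is_derive (fun t => f t + g t) x (a + b).
Proof. intros Hf Hg. exact (is_derive_plus f g x a b Hf Hg). Qed.

Lemma is_derive_Rminus (f g : R -> R) (x a b : R) :
  is_derive f x a -> is_derive g x b -> is_derive (fun t => f t - g t) x (a - b).
Proof. intros Hf Hg. exact (is_derive_minus f g x a b Hf Hg). Qed.

Lemma is_derive_Rmult (f g : R -> R) (x a b : R) :
  is_derive f x a -> is_derive g x b ->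
  is_derive (fun t => f t * g t) x (a * g x + f x * b).
Proof. intros Hf Hg. exact (is_derive_mult f g x a b Hf Hg Rmult_comm). Qed.

Lemma is_derive_Rcomp (f g : R -> R) (x a b : R) :
  is_derive f (g x) a -> is_derive g x b -> is_derive (fun t => f (g t)) x (a * b).
Proof. intros Hf Hg. rewrite Rmult_comm. exact (is_derive_comp f g x a b Hf Hg). Qed.

Lemma is_derive_eq (f : R -> R) (x a b : R) : is_derive f x a -> a = b -> is_derive f x b.
Proof. now intros H <-. Qed.

(** * Maximum and comparison principles *)

Lemma second_derivative_at_max (g g1 : R -> R) (p g2 d : R) :
  0 < d -> (forall t, Rabs (t - p) < d -> is_derive g t (g1 t)) ->
  (forall t, Rabs (t - p) < d -> g t <= g p) -> is_derive g1 p g2 -> g2 <= 0.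
Proof.
  intros Hd Hg Hmax H2. apply Rnot_lt_le. intros Hpos.
  destruct (is_derive_eps _ _ _ H2 (g2 / 2) ltac:(lra)) as [e [He H]].
  set (k := Rmin d e / 2).
  assert (Hm : 0 < Rmin d e) by now apply Rmin_glb_lt.
  assert (Hm1 := Rmin_l d e). assert (Hm2 := Rmin_r d e).
  assert (Hk : 0 < k < Rmin d e) by (unfold k; lra).
  (* If [g2] were positive, [g] would exceed [g p] on the right when [g1 p >= 0] and on the left
     otherwise; this avoids proving [g1 p = 0]. *)
  destruct (Rle_dec 0 (g1 p)) as [Hs|Hs].
  - destruct (MVT_cor2 g g1 p (p + k)) as [c [E Pc]]; [lra| |].
    { intros c Hc. apply is_derive_Reals, Hg. apply Rabs_lt_iff. lra. }
    specialize (H c ltac:(apply Rabs_lt_iff; lra)).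
    rewrite (Rabs_right (c - p)) in H by lra. apply Rabs_le_between in H.
    specialize (Hmax (p + k) ltac:(apply Rabs_lt_iff; lra)).
    assert (0 < g2 * (c - p)) by (apply Rmult_lt_0_compat; lra).
    assert (0 < g1 c) by lra. nra.
  - destruct (MVT_cor2 g g1 (p - k) p) as [c [E Pc]]; [lra| |].
    { intros c Hc. apply is_derive_Reals, Hg. apply Rabs_lt_iff. lra. }
    specialize (H c ltac:(apply Rabs_lt_iff; lra)).
    rewrite (Rabs_left (c - p)) in H by lra. apply Rabs_le_between in H.
    specialize (Hmax (p - k) ltac:(apply Rabs_lt_iff; lra)).
    assert (0 < g2 * (p - c)) by (apply Rmult_lt_0_compat; lra).
    assert (g1 c < 0) by lra. nra.
Qed.

(** Only earlier points are compared, since a maximum over a strip may lie on its final edge. *)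
Lemma derivative_at_left_max (g : R -> R) (x l d : R) :
  0 < d -> is_derive g x l -> (forall t, x - d < t < x -> g t <= g x) -> 0 <= l.
Proof.
  intros Hd Hg Hmax. apply Rnot_lt_le. intros Hneg.
  destruct (is_derive_eps _ _ _ Hg (- l / 2) ltac:(lra)) as [e [He H]].
  assert (Hm : 0 < Rmin d e) by now apply Rmin_glb_lt.
  assert (Hm1 := Rmin_l d e). assert (Hm2 := Rmin_r d e).
  set (t := x - Rmin d e / 2).
  specialize (H t ltac:(unfold t; apply Rabs_lt_iff; lra)).
  rewrite (Rabs_left (t - x)) in H by (unfold t; lra).
  apply Rabs_le_between in H.
  specialize (Hmax t ltac:(unfold t; lra)).
  assert (0 < - l * (x - t)) by (apply Rmult_lt_0_compat; unfold t; lra). lra.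
Qed.

(** This turns a family of comparisons, with equality at the trivial parameter, into an inequality
    between derivatives. *)
Lemma derivative_le_of_right (g k : R -> R) (x l m : R) :
  is_derive g x l -> is_derive k x m -> g x = k x ->
  (exists d, 0 < d /\ forall t, x < t < x + d -> g t <= k t) -> l <= m.
Proof.
  intros Hg Hk E [d [Hd H]]. apply Rnot_lt_le. intros Hlt.
  destruct (is_derive_eps _ _ _ Hg ((l - m) / 4) ltac:(lra)) as [e1 [He1 H1]].
  destruct (is_derive_eps _ _ _ Hk ((l - m) / 4) ltac:(lra)) as [e2 [He2 H2]].
  set (e := Rmin d (Rmin e1 e2)).
  assert (He : 0 < e) by (repeat apply Rmin_glb_lt; auto).
  assert (e <= d) by apply Rmin_l.
  assert (e <= e1) by (eapply Rle_trans; [apply Rmin_r|apply Rmin_l]).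
  assert (e <= e2) by (eapply Rle_trans; [apply Rmin_r|apply Rmin_r]).
  specialize (H (x + e / 2) ltac:(lra)).
  specialize (H1 (x + e / 2) ltac:(apply Rabs_lt_iff; lra)).
  specialize (H2 (x + e / 2) ltac:(apply Rabs_lt_iff; lra)).
  replace (x + e / 2 - x) with (e / 2) in * by ring.
  rewrite (Rabs_right (e / 2)) in * by lra.
  apply Rabs_le_between in H1. apply Rabs_le_between in H2. nra.
Qed.

Definition smooth_xpp (A Ax Ap App : R -> R -> R) : Prop :=
  forall x p, 0 < x -> 0 < p ->
    is_derive (fun s => A s p) x (Ax x p) /\
    is_derive (A x) p (Ap x p) /\ is_derive (Ap x) p (App x p).

Lemma smooth_xpp_minus (A Ax Ap App Z Zx Zp Zpp : R -> R -> R) :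
  smooth_xpp A Ax Ap App -> smooth_xpp Z Zx Zp Zpp ->
  smooth_xpp (fun x p => A x p - Z x p) (fun x p => Ax x p - Zx x p)
    (fun x p => Ap x p - Zp x p) (fun x p => App x p - Zpp x p).
Proof.
  intros HA HZ x p Hx Hp. destruct (HA x p Hx Hp) as [A1 [A2 A3]].
  destruct (HZ x p Hx Hp) as [Z1 [Z2 Z3]].
  split; [|split]; apply is_derive_Rminus; assumption.
Qed.

(** The term [p ^ 2] dominates bounded functions at infinity. The term [sqrt p] has second
    derivative [- / (4 * (p * sqrt p))], whose divergence at the wall compensates a singular zeroth
    order coefficient. *)
Definition weight (p : R) : R := 1 + sqrt p + p ^ 2.

Lemma weight_ge (p : R) : 1 + p ^ 2 <= weight p.
Proof. unfold weight. generalize (sqrt_pos p). lra. Qed.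

Lemma is_derive_weight (p : R) :
  0 < p -> is_derive weight p (/ (2 * sqrt p) + 2 * p).
Proof.
  intros Hp. unfold weight. assert (Hs := sqrt_lt_R0 _ Hp). auto_derive; [lra|]. field. lra.
Qed.

Lemma is_derive_weight' (p : R) :
  0 < p -> is_derive (fun p => / (2 * sqrt p) + 2 * p) p (2 - / (4 * (p * sqrt p))).
Proof.
  intros Hp. assert (Hs := sqrt_lt_R0 _ Hp). auto_derive; [lra|].
  assert (E : p = sqrt p * sqrt p) by (symmetry; apply sqrt_sqrt; lra).
  set (r := sqrt p) in *. rewrite E. field. lra.
Qed.

(* The quotient of [q] by the growing weight [exp (L x) * weight p] attains its
   maximum [m]; where [m > 0] the weighted barrier touches [q] from above. *)
Lemma max_principle (q qx qp qpp : R -> R -> R) (X L M : R) :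
  0 < X -> 0 <= L -> cont_on_quad q -> smooth_xpp q qx qp qpp ->
  (forall x p, 0 <= x <= X -> 0 <= p -> q x p <= M) ->
  (forall p, 0 <= p -> q 0 p <= 0) ->
  (forall x, 0 <= x <= X -> q x 0 <= 0) ->
  (forall x p, 0 < x <= X -> 0 < p -> 0 < q x p ->
     exists a b, 0 <= a /\ qx x p <= a * qpp x p + b * q x p /\
       a * (2 - / (4 * (p * sqrt p))) + b * weight p < L * weight p) ->
  forall x p, 0 <= x <= X -> 0 <= p -> q x p <= 0.
Proof.
  intros HX HL Hc Hs HM H0 Hb Hop x0 p0 Hx0 Hp0. apply Rnot_lt_le. intros Hpos.
  set (E := fun x p => exp (L * x) * weight p).
  assert (HE1 : forall x p, 0 <= x -> 1 + p ^ 2 <= E x p).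
  { intros x p Hx. unfold E. assert (1 <= exp (L * x)).
    { rewrite <- exp_0. destruct (Req_dec (L * x) 0) as [->|]; [lra|].
      left. apply exp_increasing. nra. }
    assert (W := weight_ge p). nra. }
  assert (HEpos : forall x p, 0 < E x p).
  { intros x p. unfold E. apply Rmult_lt_0_compat; [apply exp_pos|].
    generalize (weight_ge p). nra. }
  set (r := fun x p => q x p * / E x p).
  assert (Hqr : forall x p, q x p = r x p * E x p).
  { intros x p. unfold r. field. generalize (HEpos x p). lra. }
  assert (Hr : cont_on_quad r).
  { apply cont_quad_mult; auto. apply cont_quad_of_2d. intros x y Hx Hy.
    apply continuity_2d_pt_inv; [|generalize (HEpos x y); lra].
    unfold E. apply continuity_2d_pt_mult.
    - apply (continuity_1d_2d_pt_comp exp); [apply derivable_continuous_pt, derivable_pt_exp|].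
      apply continuity_2d_pt_mult; [apply continuity_2d_pt_const|apply continuity_2d_pt_id1].
    - unfold weight. apply continuity_2d_pt_plus.
      + apply continuity_2d_pt_plus; [apply continuity_2d_pt_const|].
        apply (continuity_1d_2d_pt_comp sqrt); [apply continuity_pt_sqrt; lra|apply continuity_2d_pt_id2].
      + apply (continuity_1d_2d_pt_comp (fun t => t ^ 2)); [|apply continuity_2d_pt_id2].
        apply derivable_continuous_pt, derivable_pt_pow. }
  assert (Hr0 : 0 < r x0 p0).
  { unfold r. apply Rmult_lt_0_compat; auto. now apply Rinv_0_lt_compat. }
  assert (HM0 : 0 < M) by (generalize (HM x0 p0 Hx0 Hp0); lra).
  (* Beyond [Y] the weight exceeds [M / r x0 p0], so the quotient stays below its value at the
     starting point and the maximum over the rectangle is a maximum over the whole strip. *)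
  set (Y := p0 + M / r x0 p0 + 1).
  assert (HMr : 0 < M / r x0 p0) by now apply Rdiv_lt_0_compat.
  destruct (cont_quad_max r X Y) as [xm [pm [Hxm [Hpm Hmax]]]]; auto; [lra|unfold Y; lra|].
  set (m := r xm pm) in *.
  assert (Hm0 : r x0 p0 <= m) by (apply Hmax; unfold Y; lra).
  assert (Hmm : forall x p, 0 <= x <= X -> 0 <= p -> r x p <= m).
  { intros x p Hx Hp. destruct (Rle_dec p Y) as [HpY|HpY]; [apply Hmax; lra|].
    apply Rle_trans with (r x0 p0); auto. unfold r at 1.
    apply Rmult_le_reg_r with (E x p); auto. rewrite Rmult_assoc, Rinv_l by (generalize (HEpos x p); lra).
    rewrite Rmult_1_r. apply Rle_trans with M; [apply HM; auto|].
    assert (M = r x0 p0 * (M / r x0 p0)) by (field; lra).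
    assert (HE2 := HE1 x p (proj1 Hx)). assert (p <= E x p) by nra.
    assert (M / r x0 p0 <= E x p) by (unfold Y in HpY; lra). nra. }
  assert (Hqm : 0 < q xm pm) by (rewrite Hqr; apply Rmult_lt_0_compat; auto; fold m; lra).
  assert (Hxm0 : 0 < xm).
  { destruct (Req_dec xm 0) as [E0|]; [|lra]. rewrite E0 in Hqm. specialize (H0 pm (proj1 Hpm)). lra. }
  assert (Hpm0 : 0 < pm).
  { destruct (Req_dec pm 0) as [E0|]; [|lra]. rewrite E0 in Hqm. specialize (Hb xm Hxm). lra. }
  assert (HQ : forall x p, 0 <= x <= X -> 0 <= p -> q x p - m * E x p <= 0).
  { intros x p Hx Hp. rewrite Hqr. specialize (Hmm x p Hx Hp). generalize (HEpos x p). nra. }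
  assert (HQm : q xm pm - m * E xm pm = 0) by (rewrite Hqr; fold m; ring).
  destruct (Hs xm pm Hxm0 Hpm0) as [S1 [S2 S3]].
  assert (D1 : 0 <= qx xm pm - m * (L * E xm pm)).
  { apply (derivative_at_left_max (fun s => q s pm - m * E s pm) xm _ xm Hxm0).
    - apply is_derive_Rminus; auto. apply is_derive_scal.
      unfold E. auto_derive; auto. ring.
    - intros t Ht. rewrite HQm. apply HQ; lra. }
  assert (D2 : qpp xm pm - m * (exp (L * xm) * (2 - / (4 * (pm * sqrt pm)))) <= 0).
  { apply (second_derivative_at_max (fun p => q xm p - m * E xm p)
       (fun p => qp xm p - m * (exp (L * xm) * (/ (2 * sqrt p) + 2 * p))) pm _ pm Hpm0).
    - intros t Ht. apply Rabs_lt_iff in Ht.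
      apply is_derive_Rminus; [apply Hs; lra|].
      apply is_derive_scal. unfold E. apply is_derive_scal. apply is_derive_weight. lra.
    - intros t Ht. apply Rabs_lt_iff in Ht. rewrite HQm. apply HQ; lra.
    - apply is_derive_Rminus; auto. apply is_derive_scal. apply is_derive_scal.
      now apply is_derive_weight'. }
  destruct (Hop xm pm) as [a [b [Ha [Hab HL']]]]; try lra.
  assert (Hqe : q xm pm = m * E xm pm) by lra. rewrite Hqe in Hab.
  set (T := 2 - / (4 * (pm * sqrt pm))) in *.
  assert (He := exp_pos (L * xm)).
  (* At the touching point the differential inequality for [q] passes to the barrier, which gives
     [L * weight <= a * T + b * weight], the opposite of the strict inequality just obtained. *)
  assert (F1 : m * exp (L * xm) * (L * weight pm) <= m * exp (L * xm) * (a * T + b * weight pm)).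
  { unfold E in D1, Hab. assert (a * qpp xm pm <= a * (m * (exp (L * xm) * T))) by (apply Rmult_le_compat_l; lra).
    nra. }
  assert (0 < m * exp (L * xm)) by (apply Rmult_lt_0_compat; lra).
  apply Rmult_le_reg_l in F1; auto. lra.
Qed.

(** Write [sqrt A * App - sqrt Z * Zpp] as [sqrt Z * (App - Zpp) + (sqrt A - sqrt Z) * App], or with
    the roles exchanged as [sqrt A * (App - Zpp) + (sqrt A - sqrt Z) * Zpp]. Where [Z < A] the last
    term is nonpositive as soon as the second derivative in it is, so concavity of one function
    leaves no zeroth order term. The rate [2 * M + 1] covers a diffusion coefficient at most [M]. *)
Lemma comparison_principle (A Ax Ap App Z Zx Zp Zpp : R -> R -> R) (X M : R) :
  0 < X -> 0 <= M -> cont_on_quad A -> cont_on_quad Z ->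
  smooth_xpp A Ax Ap App -> smooth_xpp Z Zx Zp Zpp ->
  (forall x p, 0 <= x <= X -> 0 <= p -> A x p <= M ^ 2 /\ 0 <= Z x p) ->
  (forall x p, 0 < x <= X -> 0 < p -> Z x p < A x p ->
     Ax x p <= sqrt (A x p) * App x p /\ sqrt (Z x p) * Zpp x p <= Zx x p /\
     (App x p <= 0 \/ Zpp x p <= 0)) ->
  (forall p, 0 <= p -> A 0 p <= Z 0 p) ->
  (forall x, 0 <= x <= X -> A x 0 <= Z x 0) ->
  forall x p, 0 <= x <= X -> 0 <= p -> A x p <= Z x p.
Proof.
  intros HX HM HcA HcZ HsA HsZ Hbd Hop H0 Hb x p Hx Hp.
  apply Rminus_le.
  apply (max_principle _ _ _ _ X (2 * M + 1) (M ^ 2) HX ltac:(lra)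
           (cont_quad_minus _ _ HcA HcZ) (smooth_xpp_minus _ _ _ _ _ _ _ _ HsA HsZ)); auto.
  - intros s t Hs Ht. destruct (Hbd s t Hs Ht). lra.
  - intros t Ht. specialize (H0 t Ht). lra.
  - intros s Hs. specialize (Hb s Hs). lra.
  - intros s t Hs Ht Hq. destruct (Hbd s t ltac:(lra) ltac:(lra)) as [B1 B2].
    destruct (Hop s t Hs Ht ltac:(lra)) as [I1 [I2 I3]].
    assert (SA : sqrt (A s t) <= M).
    { rewrite <- (sqrt_pow2 M HM). now apply sqrt_le_1_alt. }
    assert (SAZ : sqrt (Z s t) <= sqrt (A s t)) by (apply sqrt_le_1_alt; lra).
    assert (SZ := sqrt_pos (Z s t)).
    assert (Hinv : 0 < / (4 * (t * sqrt t))).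
    { apply Rinv_0_lt_compat. generalize (sqrt_lt_R0 t Ht). nra. }
    assert (W := weight_ge t).
    assert (HL : forall a, 0 <= a <= M ->
      a * (2 - / (4 * (t * sqrt t))) + 0 * weight t < (2 * M + 1) * weight t).
    { intros a Ha. assert (1 <= weight t) by nra. nra. }
    destruct I3 as [I3|I3].
    + exists (sqrt (Z s t)), 0. repeat split; auto; [|apply HL; lra]. nra.
    + exists (sqrt (A s t)), 0. repeat split; auto; [lra| |apply HL; lra]. nra.
Qed.

(** * The von Mises change of variables *)

Lemma RInt_halfline (h : R -> R) :
  cont_on_halfline h ->
  (forall y, 0 < y -> is_derive (fun y => RInt h 0 y) y (h y)) /\
  cont_on_halfline (fun y => RInt h 0 y).
Proof.
  intros Hh. set (k := fun t => h (Rmax 0 t)).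
  assert (Hk : forall t, continuous k t).
  { intros t. apply continuity_pt_filterlim. now apply cont_on_halfline_ext_pt. }
  assert (Hd : forall y, is_derive (fun y => RInt k 0 y) y (k y)).
  { intros y. apply (is_derive_RInt k _ 0); auto.
    exists (mkposreal 1 Rlt_0_1). intros z _. apply (RInt_correct (V := R_CompleteNormedModule) k).
    apply (ex_RInt_continuous (V := R_CompleteNormedModule) k). auto. }
  assert (He : forall y, 0 <= y -> RInt k 0 y = RInt h 0 y).
  { intros y Hy. apply RInt_ext. intros t Ht. rewrite Rmin_left in Ht by lra.
    unfold k. now rewrite Rmax0_id by lra. }
  split.
  - intros y Hy. replace (h y) with (k y) by (unfold k; now rewrite Rmax0_id by lra).
    apply (is_derive_ext_pos (fun y => RInt k 0 y)); auto. intros t Ht. apply He. lra.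
  - intros y Hy eps Heps.
    assert (Hc := is_derive_continuity_pt _ _ _ (Hd y)).
    destruct (proj1 (continuity_pt_locally _ y) Hc (mkposreal eps Heps)) as [d H].
    exists d. split; [apply cond_pos|]. intros t Ht Hty. rewrite <- !He by lra. now apply H.
Qed.

Lemma antiderivative_unbounded (g G : R -> R) :
  cont_on_halfline G -> (forall y, 0 < y -> is_derive G y (g y)) ->
  is_lim g p_infty 1 -> forall K, exists y, 0 <= y /\ K <= G y.
Proof.
  intros Hc Hd Hl K. apply is_lim_spec in Hl.
  destruct (Hl (mkposreal (1/2) ltac:(lra))) as [N HN]. simpl in HN.
  set (a := Rmax 0 N + 1). assert (Ha := Rmax_l 0 N). assert (Ha' := Rmax_r 0 N).
  set (b := a + 1 + 2 * Rabs (K - G a)). exists b.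
  assert (Hab : 0 <= a < b) by (unfold b, a; generalize (Rabs_pos (K - G (Rmax 0 N + 1))); lra).
  split; [lra|].
  destruct (cont_halfline_mvt G g a b) as [c [Pc E]]; auto.
  assert (Hg := HN c ltac:(unfold a in Pc; lra)). apply Rabs_def2 in Hg.
  assert (Rabs (K - G a) <= G b - G a).
  { rewrite E. unfold b. generalize (Rabs_pos (K - G a)). unfold b. nra. }
  generalize (Rle_abs (K - G a)). lra.
Qed.

(** * Inverse of an increasing bijection of the half line, and its dependence on a parameter *)

Definition vm_inv (G : R -> R) (p : R) : R :=
  epsilon (inhabits 0) (fun y => 0 <= y /\ G y = p).

Definition halfline_bij (G : R -> R) : Prop :=
  cont_on_halfline G /\ G 0 = 0 /\ (forall a b, 0 <= a < b -> G a < G b) /\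
  (forall K, exists y, 0 <= y /\ K <= G y).

Lemma halfline_bij_antiderivative (g G : R -> R) :
  cont_on_halfline G -> G 0 = 0 -> (forall y, 0 < y -> is_derive G y (g y)) ->
  (forall y, 0 < y -> 0 < g y) -> is_lim g p_infty 1 -> halfline_bij G.
Proof.
  intros Hc H0 Hd Hp Hl. split; [|split; [|split]]; auto.
  - intros a b Hab. apply (halfline_increasing G g); auto. intros t Ht. apply Hp. lra.
  - now apply (antiderivative_unbounded g).
Qed.

Lemma vm_inv_spec (G : R -> R) (p : R) :
  halfline_bij G -> 0 <= p -> 0 <= vm_inv G p /\ G (vm_inv G p) = p.
Proof.
  intros [Hc [H0 [_ Hu]]] Hp. unfold vm_inv. apply epsilon_spec.
  destruct (Hu p) as [b [Hb Hpb]].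
  destruct (IVT_gen (fun t => G (Rmax 0 t)) 0 b p) as [y [Hy E]].
  - intros t. now apply cont_on_halfline_ext_pt.
  - rewrite !Rmax0_id, H0 by lra. rewrite Rmin_left, Rmax_right by lra. lra.
  - rewrite Rmin_left, Rmax_right in Hy by lra. rewrite Rmax0_id in E by lra. exists y. lra.
Qed.

Lemma halfline_bij_inj (G : R -> R) (a b : R) :
  halfline_bij G -> 0 <= a -> 0 <= b -> G a = G b -> a = b.
Proof.
  intros [_ [_ [Hi _]]] Ha Hb E. destruct (Rtotal_order a b) as [H|[H|H]]; auto;
  [specialize (Hi a b)|specialize (Hi b a)]; lra.
Qed.

Lemma halfline_bij_lt (G : R -> R) (a b : R) :
  halfline_bij G -> 0 <= a -> 0 <= b -> G a < G b -> a < b.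
Proof.
  intros [_ [_ [Hi _]]] Ha Hb E. destruct (Rtotal_order a b) as [H|[->|H]]; auto; [lra|].
  specialize (Hi b a). lra.
Qed.

Lemma vm_inv_left (G : R -> R) (y : R) : halfline_bij G -> 0 <= y -> vm_inv G (G y) = y.
Proof.
  intros HG Hy. assert (0 <= G y).
  { destruct HG as [_ [H0 [Hi _]]]. destruct (Req_dec y 0) as [->|]; [lra|].
    specialize (Hi 0 y). lra. }
  destruct (vm_inv_spec G (G y) HG H) as [H1 H2]. now apply (halfline_bij_inj G).
Qed.

Lemma vm_inv_0 (G : R -> R) : halfline_bij G -> vm_inv G 0 = 0.
Proof.
  intros HG. assert (H := HG). destruct H as [_ [H0 _]]. rewrite <- H0 at 1.
  apply vm_inv_left; auto. lra.
Qed.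

Lemma vm_inv_pos (G : R -> R) (p : R) : halfline_bij G -> 0 < p -> 0 < vm_inv G p.
Proof.
  intros HG Hp. destruct (vm_inv_spec G p HG ltac:(lra)) as [H1 H2].
  destruct (Req_dec (vm_inv G p) 0) as [E|]; [|lra].
  rewrite E in H2. destruct HG as [_ [H0 _]]. lra.
Qed.

(** Strict monotonicity in the second variable replaces joint continuity of [G]: the inverse is
    bracketed between two fixed ordinates, and the strict inequalities at these survive a small
    change of [x] and [p]. *)
Lemma vm_inv_cont_quad (G : R -> R -> R) :
  (forall x, 0 <= x -> halfline_bij (G x)) ->
  (forall y, 0 <= y -> cont_on_halfline (fun x => G x y)) ->
  cont_on_quad (fun x p => vm_inv (G x) p).
Proof.
  intros HG Hx x0 p0 Hx0 Hp0 eps He.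
  destruct (vm_inv_spec (G x0) p0 (HG x0 Hx0) Hp0) as [Y1 Y2].
  set (y0 := vm_inv (G x0) p0) in *.
  assert (Hi := proj1 (proj2 (proj2 (HG x0 Hx0)))).
  assert (U : exists d, 0 < d /\ forall x p, 0 <= x -> 0 <= p -> Rabs (x - x0) < d ->
    Rabs (p - p0) < d -> vm_inv (G x) p < y0 + eps).
  { set (y1 := y0 + eps / 2). specialize (Hi y0 y1 ltac:(unfold y1; lra)).
    set (e := (G x0 y1 - p0) / 2). assert (He' : 0 < e) by (unfold e; lra).
    destruct (Hx y1 ltac:(unfold y1; lra) x0 Hx0 e He') as [d [Hd H]].
    exists (Rmin d e). split; [now apply Rmin_glb_lt|].
    intros x p Px Pp Dx Dp. assert (M1 := Rmin_l d e). assert (M2 := Rmin_r d e).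
    specialize (H x Px ltac:(lra)). cbv beta in H. apply Rabs_def2 in H.
    assert (Dp' : Rabs (p - p0) < e) by lra. apply Rabs_def2 in Dp'.
    destruct (vm_inv_spec (G x) p (HG x Px) Pp) as [Z1 Z2].
    apply Rlt_trans with y1; [|unfold y1; lra].
    apply (halfline_bij_lt (G x)); auto; [unfold y1; lra|]. rewrite Z2. unfold e in *. lra. }
  assert (D : exists d, 0 < d /\ forall x p, 0 <= x -> 0 <= p -> Rabs (x - x0) < d ->
    Rabs (p - p0) < d -> y0 - eps < vm_inv (G x) p).
  (* Near the wall the lower ordinate would leave the half line; there the bound holds because the
     inverse is nonnegative. *)
  { destruct (Rlt_le_dec (y0 - eps / 2) 0) as [Hneg|Hpos].
    { exists 1. split; [lra|]. intros x p Px Pp _ _.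
      destruct (vm_inv_spec (G x) p (HG x Px) Pp). lra. }
    set (y1 := y0 - eps / 2) in *. assert (Hy1 : y1 < y0) by (unfold y1; lra).
    specialize (Hi y1 y0 ltac:(lra)).
    set (e := (p0 - G x0 y1) / 2). assert (He' : 0 < e) by (unfold e; lra).
    destruct (Hx y1 Hpos x0 Hx0 e He') as [d [Hd H]].
    exists (Rmin d e). split; [now apply Rmin_glb_lt|].
    intros x p Px Pp Dx Dp. assert (M1 := Rmin_l d e). assert (M2 := Rmin_r d e).
    specialize (H x Px ltac:(lra)). cbv beta in H. apply Rabs_def2 in H.
    assert (Dp' : Rabs (p - p0) < e) by lra. apply Rabs_def2 in Dp'.
    destruct (vm_inv_spec (G x) p (HG x Px) Pp) as [Z1 Z2].
    apply Rlt_trans with y1; [unfold y1; lra|].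
    apply (halfline_bij_lt (G x)); auto. rewrite Z2. unfold e in *. lra. }
  destruct U as [a [Ha U]]. destruct D as [b [Hb D]].
  exists (Rmin a b). split; [now apply Rmin_glb_lt|].
  intros x p Px Pp Dx Dp. assert (M1 := Rmin_l a b). assert (M2 := Rmin_r a b).
  specialize (U x p Px Pp ltac:(lra) ltac:(lra)). specialize (D x p Px Pp ltac:(lra) ltac:(lra)).
  apply Rabs_lt_iff. lra.
Qed.

Lemma vm_inv_cont (G : R -> R) : halfline_bij G -> cont_on_halfline (vm_inv G).
Proof.
  intros HG. apply (cont_quad_row (fun _ => vm_inv G) 0); [lra|].
  apply (vm_inv_cont_quad (fun _ => G)); auto.
  intros y _ x _ eps He. exists 1. split; [lra|]. intros. now rewrite Rminus_diag, Rabs_R0.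
Qed.

Lemma cont_on_halfline_pt (h : R -> R) (t : R) :
  cont_on_halfline h -> 0 < t -> continuity_pt h t.
Proof.
  intros Hh Ht. apply continuity_pt_locally. intros eps.
  destruct (Hh t ltac:(lra) eps (cond_pos eps)) as [d [Hd H]].
  assert (Hm : 0 < Rmin d t) by now apply Rmin_glb_lt.
  exists (mkposreal _ Hm). intros s Hs. change (Rabs (s - t) < Rmin d t) in Hs.
  assert (M1 := Rmin_l d t). assert (M2 := Rmin_r d t).
  apply H; [|lra]. apply Rabs_def2 in Hs. lra.
Qed.

Lemma is_derive_vm_inv (g G : R -> R) (p : R) :
  halfline_bij G -> (forall y, 0 < y -> is_derive G y (g y)) ->
  (forall y, 0 < y -> 0 < g y) -> 0 < p ->
  is_derive (vm_inv G) p (/ g (vm_inv G p)).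
Proof.
  intros HG Hd Hg Hp. assert (Hy := vm_inv_pos G p HG Hp).
  assert (Hgy := Hg _ Hy).
  apply (is_derive_eq _ _ (- (-1) / g (vm_inv G p))); [|field; lra].
  apply (is_derive_implicit (fun p y => G y - p)).
  - apply (differentiable_of_partials _ (fun _ _ => -1)); auto.
    + intros s t _ _. apply (is_derive_eq _ _ (0 - 1)); [|ring].
      apply is_derive_Rminus; [apply @is_derive_const|apply @is_derive_id].
    + apply continuity_2d_pt_const.
    + apply (is_derive_eq _ _ (g (vm_inv G p) - 0)); [|ring].
      apply is_derive_Rminus; auto. apply @is_derive_const.
  - lra.
  - apply cont_on_halfline_pt; auto. now apply vm_inv_cont.
  - generalize (locally_pos p Hp). apply filter_imp. intros t Ht.
    rewrite !(fun p H => proj2 (vm_inv_spec G p HG H)) by lra. ring.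
Qed.

(** With [dp = g dy], squaring [g] cancels the factor [1 / g] in the first derivative, but the
    second keeps it and so degenerates where [g] vanishes. The computation serves the solution, the
    datum and the Blasius profile alike. *)
Lemma vm_profile_derivatives (g g1 g2 G W : R -> R) (p : R) :
  halfline_bij G ->
  (forall y, 0 < y -> is_derive G y (g y) /\ is_derive g y (g1 y) /\ is_derive g1 y (g2 y)) ->
  (forall y, 0 < y -> 0 < g y) ->
  (forall y, 0 <= y -> W (G y) = g y ^ 2) -> 0 < p ->
  is_derive W p (2 * g1 (vm_inv G p)) /\
  is_derive (fun p => 2 * g1 (vm_inv G p)) p (2 * g2 (vm_inv G p) / g (vm_inv G p)).
Proof.
  intros HG Hd Hg HW Hp. assert (Hy := vm_inv_pos G p HG Hp).
  assert (Hi := is_derive_vm_inv g G p HG (fun y H => proj1 (Hd y H)) Hg Hp).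
  destruct (Hd _ Hy) as [_ [D1 D2]]. assert (Hgy := Hg _ Hy).
  split.
  - apply (is_derive_ext_pos (fun p => g (vm_inv G p) * g (vm_inv G p))); auto.
    + intros t Ht. destruct (vm_inv_spec G t HG ltac:(lra)) as [H1 H2].
      rewrite <- H2 at 3. rewrite HW by auto. ring.
    + assert (H := is_derive_Rcomp _ _ _ _ _ D1 Hi).
      eapply is_derive_eq; [exact (is_derive_Rmult _ _ _ _ _ H H)|]. simpl. field. lra.
  - eapply is_derive_eq; [apply is_derive_scal; exact (is_derive_Rcomp _ _ _ _ _ D2 Hi)|].
    field. lra.
Qed.

(** * Derivatives of the stream function in both variables *)

Section stream_function.

Variables (u v ux vy : R -> R -> R).
Hypotheses (cu : cont_on_quad u) (cux : cont_on_quad ux) (cv : cont_on_quad v).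
Hypothesis dux : forall x y, 0 < x -> 0 < y -> is_derive (fun s => u s y) x (ux x y).
Hypothesis dvy : forall x y, 0 < x -> 0 < y -> is_derive (v x) y (vy x y).
Hypothesis div0 : forall x y, 0 < x -> 0 < y -> ux x y + vy x y = 0.
Hypothesis v0 : forall x, 0 <= x -> v x 0 = 0.

Lemma vm_psi_y (x : R) :
  0 <= x ->
  (forall y, 0 < y -> is_derive (vm_psi u x) y (u x y)) /\ cont_on_halfline (vm_psi u x).
Proof. intros Hx. apply RInt_halfline. now apply cont_quad_row. Qed.

Lemma vm_psi_0 (x : R) : vm_psi u x 0 = 0.
Proof. apply (RInt_point 0 (u x)). Qed.

Lemma vm_psi_cont_x (y : R) : 0 <= y -> cont_on_halfline (fun x => vm_psi u x y).
Proof.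
  intros Hy x Hx eps He.
  assert (He' : 0 < eps / (y + 1)) by (apply Rdiv_lt_0_compat; lra).
  destruct (uniform_continuity_2d_1d' (quad_ext u) 0 y x
     (fun t _ => proj1 (cont_on_quad_ext u) cu x t) (mkposreal _ He')) as [d H].
  exists d. split; [apply cond_pos|]. intros s Hs Hsx.
  destruct (Req_dec y 0) as [->|Hy0]; [now rewrite !vm_psi_0, Rminus_diag, Rabs_R0|].
  destruct (vm_psi_y x Hx) as [D1 K1]. destruct (vm_psi_y s Hs) as [D2 K2].
  destruct (cont_halfline_mvt (fun t => 1 * vm_psi u s t + (-1) * vm_psi u x t)
     (fun t => 1 * u s t + (-1) * u x t) 0 y) as [c [Pc E]].
  - now apply cont_halfline_lin.
  - intros t Ht. apply is_derive_Rplus; apply is_derive_scal; auto.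
  - lra.
  - rewrite !vm_psi_0 in E.
    replace (vm_psi u s y - vm_psi u x y) with ((u s c - u x c) * y) by lra.
    assert (Hd := cond_pos d). apply Rabs_def2 in Hsx.
    specialize (H c x c s). rewrite !quad_ext_id in H by lra.
    assert (H' : Rabs (u s c - u x c) < eps / (y + 1)).
    { apply H; try lra. rewrite Rminus_diag, Rabs_R0. exact Hd. }
    rewrite Rabs_mult, (Rabs_right y) by lra.
    assert (E' : eps = eps / (y + 1) * (y + 1)) by (field; lra).
    rewrite E'. apply Rmult_le_0_lt_compat; try lra. apply Rabs_pos.
Qed.

(** Incompressibility integrated from the wall. Adding [h * v] to the increment of the stream
    function gives a function of [y] that vanishes at the wall and whose derivative is [h] times a
    difference of two values of [ux]; this replaces differentiation under the integral. *)
Lemma vm_psi_x (x y : R) :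
  0 < x -> 0 < y -> is_derive (fun s => vm_psi u s y) x (- v x y).
Proof.
  intros Hx Hy. apply is_derive_Reals. intros eps He.
  assert (He' : 0 < eps / (y + 1)) by (apply Rdiv_lt_0_compat; lra).
  destruct (uniform_continuity_2d_1d' (quad_ext ux) 0 y x
     (fun t _ => proj1 (cont_on_quad_ext ux) cux x t) (mkposreal _ He')) as [d H].
  assert (Hm : 0 < Rmin d x) by (apply Rmin_glb_lt; [apply cond_pos|auto]).
  exists (mkposreal _ Hm). simpl. intros h Hh Hhd.
  assert (M1 := Rmin_l d x). assert (M2 := Rmin_r d x).
  assert (Hhd' := proj1 (Rabs_lt_iff _ _) Hhd).
  assert (Hd := cond_pos d).
  destruct (vm_psi_y x ltac:(lra)) as [D1 K1]. destruct (vm_psi_y (x + h) ltac:(lra)) as [D2 K2].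
  destruct (cont_halfline_mvt (fun t => 1 * (1 * vm_psi u (x + h) t + (-1) * vm_psi u x t) + h * v x t)
     (fun t => 1 * (1 * u (x + h) t + (-1) * u x t) + h * vy x t) 0 y) as [c [Pc E]].
  - apply cont_halfline_lin; [now apply cont_halfline_lin|]. apply cont_quad_row; auto. lra.
  - intros t Ht. apply is_derive_Rplus; apply is_derive_scal; auto.
    apply is_derive_Rplus; apply is_derive_scal; auto.
  - lra.
  - rewrite !vm_psi_0, v0 in E by lra.
    destruct (MVT_gen (fun s => u s c) x (x + h) (fun s => ux s c)) as [k [Pk Ek]].
    { intros s Hs. apply dux; [|lra]. unfold Rmin, Rmax in Hs. destruct (Rle_dec x (x + h)); lra. }
    { intros s Hs. eapply is_derive_continuity_pt. apply dux; [|lra].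
      unfold Rmin, Rmax in Hs. destruct (Rle_dec x (x + h)); lra. }
    assert (Hk : x - d < k < x + d /\ 0 < k).
    { unfold Rmin, Rmax in Pk. destruct (Rle_dec x (x + h)); lra. }
    specialize (H c x c k). rewrite !quad_ext_id in H by lra.
    assert (H' : Rabs (ux k c - ux x c) < eps / (y + 1)).
    { apply H; try lra. rewrite Rminus_diag, Rabs_R0. exact Hd. }
    assert (Dv := div0 x c Hx ltac:(lra)).
    replace ((vm_psi u (x + h) y - vm_psi u x y) / h - - v x y)
      with ((vm_psi u (x + h) y - vm_psi u x y + h * v x y) / h) by (field; auto).
    replace (vm_psi u (x + h) y - vm_psi u x y + h * v x y)
      with ((u (x + h) c - u x c + h * vy x c) * y) by lra.
    rewrite Ek. replace (vy x c) with (- ux x c) by lra.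
    replace ((ux k c * (x + h - x) + h * - ux x c) * y / h)
      with ((ux k c - ux x c) * y) by (field; auto).
    rewrite Rabs_mult, (Rabs_right y) by lra.
    assert (E' : eps = eps / (y + 1) * (y + 1)) by (field; lra).
    rewrite E'. apply Rmult_le_0_lt_compat; try lra. apply Rabs_pos.
Qed.

End stream_function.

Definition vm_y (u : R -> R -> R) (x p : R) : R := vm_inv (vm_psi u x) p.

Lemma vm_psi_bij (u : R -> R -> R) (x : R) :
  cont_on_quad u -> 0 <= x -> (forall y, 0 < y -> 0 < u x y) ->
  is_lim (u x) p_infty 1 -> halfline_bij (vm_psi u x).
Proof.
  intros cu Hx Hp Hl. destruct (vm_psi_y u cu x Hx) as [D K].
  apply (halfline_bij_antiderivative (u x)); auto. apply vm_psi_0.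
Qed.

Lemma continuity_2d_of_quad (g : R -> R -> R) (x y : R) :
  cont_on_quad g -> 0 < x -> 0 < y -> continuity_2d_pt g x y.
Proof.
  intros Hg Hx Hy. apply (continuity_2d_pt_ext_loc (quad_ext g)).
  - assert (Hm : 0 < Rmin x y) by now apply Rmin_glb_lt.
    exists (mkposreal _ Hm). simpl. intros s t Hs Ht.
    assert (M1 := Rmin_l x y). assert (M2 := Rmin_r x y).
    apply Rabs_def2 in Hs. apply Rabs_def2 in Ht. apply quad_ext_id; lra.
  - now apply cont_on_quad_ext.
Qed.

Lemma is_derive_vm_y_x (u v ux vy : R -> R -> R) (x p : R) :
  cont_on_quad u -> cont_on_quad ux -> cont_on_quad v ->
  (forall x y, 0 < x -> 0 < y -> is_derive (fun s => u s y) x (ux x y)) ->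
  (forall x y, 0 < x -> 0 < y -> is_derive (v x) y (vy x y)) ->
  (forall x y, 0 < x -> 0 < y -> ux x y + vy x y = 0) ->
  (forall x, 0 <= x -> v x 0 = 0) ->
  (forall x y, 0 <= x -> 0 < y -> 0 < u x y) ->
  (forall x, 0 <= x -> is_lim (u x) p_infty 1) ->
  0 < x -> 0 < p ->
  is_derive (fun s => vm_y u s p) x (v x (vm_y u x p) / u x (vm_y u x p)).
Proof.
  intros cu cux cv dux dvy div0 v0 up ul Hx Hp.
  assert (HG : forall x, 0 <= x -> halfline_bij (vm_psi u x)).
  { intros s Hs. apply vm_psi_bij; auto. }
  assert (Hy : 0 < vm_y u x p) by (apply vm_inv_pos; auto; apply HG; lra).
  assert (Hu := up x _ ltac:(lra) Hy).
  apply (is_derive_eq _ _ (- (- v x (vm_y u x p)) / u x (vm_y u x p))); [|field; lra].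
  apply (is_derive_implicit (vm_psi u)).
  - apply (differentiable_of_partials _ (fun x y => - v x y)); auto.
    + intros s t Hs Ht. now apply (vm_psi_x u v ux vy).
    + apply continuity_2d_pt_opp. now apply continuity_2d_of_quad.
    + apply vm_psi_y; auto. lra.
  - lra.
  - assert (C := vm_inv_cont_quad (vm_psi u) HG (vm_psi_cont_x u cu)).
    apply continuity_pt_locally. intros eps.
    destruct (C x p ltac:(lra) ltac:(lra) eps (cond_pos eps)) as [d [Hd H]].
    assert (Hm : 0 < Rmin d x) by now apply Rmin_glb_lt.
    exists (mkposreal _ Hm). intros s Hs. change (Rabs (s - x) < Rmin d x) in Hs.
    assert (M1 := Rmin_l d x). assert (M2 := Rmin_r d x).
    apply H; try lra; [|rewrite Rminus_diag, Rabs_R0; exact Hd]. apply Rabs_def2 in Hs. lra.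
  - generalize (locally_pos x Hx). apply filter_imp. intros t Ht. unfold vm_y.
    rewrite (proj2 (vm_inv_spec _ p (HG t ltac:(lra)) ltac:(lra))).
    now rewrite (proj2 (vm_inv_spec _ p (HG x ltac:(lra)) ltac:(lra))).
Qed.

(** The last clause is conditional because the linear lower bound on [w] is itself obtained by
    comparison. In it, [wpp = 2 * uyy / u]: near the wall [uyy = u * ux + v * uy] is of order [y],
    hence of order [sqrt p], just like the lower bound on [u]; away from the wall [uyy] is bounded
    and [u] is bounded below. *)
Lemma vm_regularity (u0 : R -> R) (u v w : R -> R -> R) :
  oleinik_solution u0 u v -> von_mises u w ->
  exists wx wp wpp : R -> R -> R,
    cont_on_quad w /\ smooth_xpp w wx wp wpp /\
    (forall x p, 0 < x -> 0 < p -> wx x p = sqrt (w x p) * wpp x p) /\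
    (forall x, 0 <= x -> w x 0 = 0) /\
    (forall x p, 0 <= x -> 0 < p -> 0 < w x p) /\
    (forall X, 0 < X -> exists M, 0 <= M /\
       forall x p, 0 <= x <= X -> 0 <= p -> w x p <= M ^ 2) /\
    (forall X c, 0 < X -> 0 < c ->
       (forall x p, 0 <= x <= X -> 0 < p -> c * Rmin p 1 <= w x p) ->
       exists K, 0 < K /\ forall x p, 0 < x <= X -> 0 < p -> wpp x p <= K).
Proof.
  intros [ux [uy [uyy [vy [Hd [Hpde [Hu0 [Hbc [Hlim [Hpos [cu [cux [cuy [cuyy [cv [cvy Hbd]]]]]]]]]]]]]]]] Hw.
  assert (HG : forall x, 0 <= x -> halfline_bij (vm_psi u x)).
  { intros x Hx. apply vm_psi_bij; auto. }
  set (Y := vm_y u).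
  assert (HY : forall x p, 0 <= x -> 0 <= p -> 0 <= Y x p /\ vm_psi u x (Y x p) = p).
  { intros x p Hx Hp. apply vm_inv_spec; auto. }
  assert (HYp : forall x p, 0 <= x -> 0 < p -> 0 < Y x p).
  { intros x p Hx Hp. apply vm_inv_pos; auto. }
  assert (HwY : forall x p, 0 <= x -> 0 <= p -> w x p = u x (Y x p) ^ 2).
  { intros x p Hx Hp. destruct (HY x p Hx Hp) as [H1 H2]. rewrite <- Hw by auto. now rewrite H2. }
  assert (HY0 : forall x, 0 <= x -> Y x 0 = 0).
  { intros x Hx. apply vm_inv_0; auto. }
  assert (Hsw : forall x p, 0 <= x -> 0 < p -> sqrt (w x p) = u x (Y x p)).
  { intros x p Hx Hp. rewrite HwY by lra. apply sqrt_pow2. left. apply Hpos; auto. }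
  assert (cY : cont_on_quad Y).
  { apply vm_inv_cont_quad; auto. apply vm_psi_cont_x; auto. }
  (* At a fixed value of the stream function the ordinate moves with speed [v / u], so the [x]
     derivative of [u^2] is [2 * (u * ux + v * uy)], which the momentum equation equates with
     [2 * uyy]. *)
  exists (fun x p => 2 * uyy x (Y x p)), (fun x p => 2 * uy x (Y x p)),
    (fun x p => 2 * uyy x (Y x p) / u x (Y x p)).
  split; [|split; [|split; [|split; [|split; [|split]]]]].
  - apply (cont_quad_ext_eq (fun x p => u x (Y x p) * u x (Y x p))).
    + intros x p Hx Hp. rewrite HwY by auto. ring.
    + assert (cont_on_quad (fun x p => u x (Y x p))).
      { apply (cont_quad_comp u (fun x _ => x) Y); auto; [apply cont_quad_fst|].
        intros x p Hx Hp. split; auto. now apply HY. }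
      now apply cont_quad_mult.
  - intros x p Hx Hp. assert (Hy := HYp x p ltac:(lra) Hp).
    destruct (Hd x (Y x p) Hx Hy) as [Dx [Dy [Dyy Dv]]].
    destruct (Hpde x (Y x p) Hx Hy) as [Pd _].
    assert (Pu := Hpos x (Y x p) ltac:(lra) Hy).
    split.
    + apply (is_derive_ext_pos (fun s => u s (Y s p) * u s (Y s p))); auto.
      { intros s Hs. rewrite HwY by lra. ring. }
      assert (DY : is_derive (fun s => Y s p) x (v x (Y x p) / u x (Y x p))).
      { apply (is_derive_vm_y_x u v ux vy); auto; intros; try (now apply Hd); try (now apply Hpde); try (now apply Hbc). }
      assert (DU : is_derive (fun s => u s (Y s p)) x (ux x (Y x p) * 1 + uy x (Y x p) * (v x (Y x p) / u x (Y x p)))).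
      { apply is_derive_Reals. apply (derivable_pt_lim_comp_2d u (fun s => s) (fun s => Y s p)).
        - apply (differentiable_of_partials u ux); auto.
          + intros s t Hs Ht. now apply Hd.
          + now apply continuity_2d_of_quad.
        - apply derivable_pt_lim_id.
        - now apply is_derive_Reals. }
      eapply is_derive_eq; [exact (is_derive_Rmult _ _ _ _ _ DU DU)|]. simpl.
      replace (uyy x (Y x p)) with (u x (Y x p) * ux x (Y x p) + v x (Y x p) * uy x (Y x p)) by lra.
      field. lra.
    + apply (vm_profile_derivatives (u x) (uy x) (uyy x) (vm_psi u x) (w x)); auto.
      * apply HG; lra.
      * intros y Hy'. destruct (Hd x y Hx Hy') as [_ [E1 [E2 _]]]. split; [|split]; auto.
        apply vm_psi_y; auto. lra.
      * intros y Hy'. apply Hpos; lra.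
      * intros y Hy'. apply Hw; lra.
  - intros x p Hx Hp. rewrite Hsw by lra. field.
    assert (Pu := Hpos x (Y x p) ltac:(lra) (HYp x p ltac:(lra) Hp)). lra.
  - intros x Hx. rewrite HwY, HY0 by lra. rewrite (proj1 (Hbc x Hx)). ring.
  - intros x p Hx Hp. rewrite HwY by lra. apply pow_lt. apply Hpos; auto.
  - intros X HX. destruct (Hbd X HX) as [[M HM] _]. exists (Rabs M). split; [apply Rabs_pos|].
    intros x p Hx Hp. rewrite HwY by lra. apply pow_maj_Rabs.
    eapply Rle_trans; [apply HM; auto; apply HY; lra|apply Rle_abs].
  - intros X c HX Hc Hlow.
    assert (Sc := sqrt_lt_R0 c Hc).
    assert (Scc : sqrt c * sqrt c = c) by (apply sqrt_sqrt; lra).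
    set (Y1 := 2 / sqrt c). assert (HY1 : 0 < Y1) by (apply Rdiv_lt_0_compat; lra).
    destruct (Hbd X HX) as [_ [_ [M5 HM5]]].
    destruct (cont_quad_bounded ux X Y1 ltac:(lra) ltac:(lra) cux) as [M1 [PM1 HM1]].
    destruct (cont_quad_bounded vy X Y1 ltac:(lra) ltac:(lra) cvy) as [M2 [PM2 HM2]].
    destruct (cont_quad_bounded uy X Y1 ltac:(lra) ltac:(lra) cuy) as [M3 [PM3 HM3]].
    set (M4 := M3 * M1 + M2 * M3). assert (PM4 : 0 < M4) by (unfold M4; nra).
    set (K1 := 4 * M4 / c). assert (PK1 : 0 < K1) by (apply Rdiv_lt_0_compat; lra).
    set (K2 := 2 * (Rabs M5 + 1) / sqrt c).
    assert (PK2 : 0 < K2) by (apply Rdiv_lt_0_compat; auto; generalize (Rabs_pos M5); lra).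
    exists (K1 + K2). split; [lra|]. intros x p Hx Hp.
    assert (Hy := HYp x p ltac:(lra) Hp).
    assert (Pu := Hpos x (Y x p) ltac:(lra) Hy).
    assert (Hs := Hsw x p ltac:(lra) Hp).
    assert (HuL : forall t, 0 < t -> sqrt c * sqrt (Rmin t 1) <= u x (Y x t)).
    { intros t Ht. rewrite <- Hsw by lra. rewrite <- sqrt_mult; try lra; [|apply Rmin_glb; lra].
      apply sqrt_le_1_alt. apply Hlow; lra. }
    assert (Dv : forall a b, 0 < b -> a <= (K1 + K2) * b -> a / b <= K1 + K2).
    { intros a b Hb H. apply Rmult_le_reg_r with b; auto. unfold Rdiv.
      rewrite Rmult_assoc, Rinv_l by lra. lra. }
    apply Dv; auto.
    assert (HuLp := HuL p Hp).
    destruct (Rle_dec p 1) as [Hp1|Hp1].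
    + rewrite Rmin_left in HuLp by auto.
      (* The ordinate has derivative [/ u <= / (sqrt c * sqrt p)] in [p]; [Y1 = 2 / sqrt c] is what
         integration gives. *)
      assert (HYb : Y x p <= Y1 * sqrt p).
      { assert (N : Y1 * sqrt 0 + -1 * Y x 0 <= Y1 * sqrt p + -1 * Y x p).
        { apply (halfline_nondecreasing (fun t => Y1 * sqrt t + -1 * Y x t)
            (fun t => Y1 * / (2 * sqrt t) + -1 * / u x (Y x t))); try lra.
          - apply cont_halfline_lin.
            + apply cont_halfline_of_cont. intros t Ht. apply continuity_pt_sqrt. lra.
            + apply vm_inv_cont. apply HG. lra.
          - intros t Ht. apply is_derive_Rplus; apply is_derive_scal.
            + apply is_derive_Reals. now apply derivable_pt_lim_sqrt.
            + apply (is_derive_vm_inv (u x)); auto.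
              * apply HG; lra.
              * apply vm_psi_y; auto; lra.
              * intros y Hy'. apply Hpos; lra.
          - intros t Ht. assert (L := HuL t ltac:(lra)). rewrite Rmin_left in L by lra.
            assert (St := sqrt_lt_R0 t ltac:(lra)).
            assert (/ u x (Y x t) <= / (sqrt c * sqrt t)) by (apply Rinv_le_contravar; auto; nra).
            replace (Y1 * / (2 * sqrt t)) with (/ (sqrt c * sqrt t)) by (unfold Y1; field; lra). lra. }
        rewrite HY0, sqrt_0 in N by lra. lra. }
      assert (Sp := sqrt_lt_R0 p Hp).
      assert (Sp1 : sqrt p <= 1) by (rewrite <- sqrt_1; now apply sqrt_le_1_alt).
      assert (HYY : Y x p <= Y1) by nra.
      destruct (cont_halfline_mvt (u x) (uy x) 0 (Y x p)) as [a [Pa Ea]]; try lra.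
      { apply cont_quad_row; auto; lra. }
      { intros t Ht. apply Hd; lra. }
      destruct (cont_halfline_mvt (v x) (vy x) 0 (Y x p)) as [b [Pb Eb]]; try lra.
      { apply cont_quad_row; auto; lra. }
      { intros t Ht. apply Hd; lra. }
      destruct (Hbc x ltac:(lra)) as [B1 B2]. rewrite B1 in Ea. rewrite B2 in Eb.
      assert (Ha := HM3 x a ltac:(lra) ltac:(lra)). assert (Hb := HM2 x b ltac:(lra) ltac:(lra)).
      assert (Hux := HM1 x (Y x p) ltac:(lra) ltac:(lra)).
      assert (Huy := HM3 x (Y x p) ltac:(lra) ltac:(lra)).
      destruct (Hpde x (Y x p) ltac:(lra) Hy) as [Pd _].
      (* Both [u] and [v] vanish at the wall, so the momentum equation bounds [uyy] linearly without
         any third derivative. *)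
      assert (Huyy : uyy x (Y x p) <= M4 * Y x p).
      { replace (uyy x (Y x p)) with (u x (Y x p) * ux x (Y x p) + v x (Y x p) * uy x (Y x p)) by lra.
        replace (u x (Y x p)) with (uy x a * Y x p) by lra.
        replace (v x (Y x p)) with (vy x b * Y x p) by lra.
        assert (T1 : Rabs (uy x a * ux x (Y x p)) <= M3 * M1).
        { rewrite Rabs_mult. apply Rmult_le_compat; auto; apply Rabs_pos. }
        assert (T2 : Rabs (vy x b * uy x (Y x p)) <= M2 * M3).
        { rewrite Rabs_mult. apply Rmult_le_compat; auto; apply Rabs_pos. }
        apply Rabs_le_between in T1. apply Rabs_le_between in T2. unfold M4. nra. }
      assert (E1 : 2 * uyy x (Y x p) <= 2 * M4 * (Y1 * sqrt p)) by nra.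
      assert (E2 : 2 * M4 * (Y1 * sqrt p) = K1 * (sqrt c * sqrt p)).
      { unfold K1, Y1. rewrite <- Scc at 2. field. lra. }
      assert (E3 : K1 * (sqrt c * sqrt p) <= K1 * u x (Y x p)) by (apply Rmult_le_compat_l; lra).
      nra.
    + rewrite Rmin_right, sqrt_1 in HuLp by lra.
      assert (H5 := HM5 x (Y x p) ltac:(lra) ltac:(lra)).
      apply Rabs_le_between in H5. generalize (Rle_abs M5). intros A5.
      assert (E3 : K2 * (sqrt c * 1) <= K2 * u x (Y x p)) by (apply Rmult_le_compat_l; lra).
      assert (E4 : K2 * (sqrt c * 1) = 2 * (Rabs M5 + 1)) by (unfold K2; field; lra).
      nra.
Qed.

(** * Concave profiles and the initial datum *)

Lemma concave_derivative_nonincreasing (h1 h2 : R -> R) (a b : R) :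
  (forall y, 0 < y -> is_derive h1 y (h2 y)) -> (forall y, 0 < y -> h2 y <= 0) ->
  0 < a <= b -> h1 b <= h1 a.
Proof.
  intros H2 Hneg [Ha Hab]. destruct (Req_dec a b) as [->|Hn]; [lra|].
  destruct (MVT_cor2 h1 h2 a b) as [c [E Pc]]; [lra| |].
  - intros c Hc. apply is_derive_Reals, H2. lra.
  - specialize (Hneg c ltac:(lra)). nra.
Qed.

Lemma concave_ratio (h h1 h2 : R -> R) (a b : R) :
  cont_on_halfline h -> (forall y, 0 < y -> is_derive h y (h1 y)) ->
  (forall y, 0 < y -> is_derive h1 y (h2 y)) -> (forall y, 0 < y -> h2 y <= 0) ->
  h 0 = 0 -> 0 < a <= b -> h b * a <= h a * b.
Proof.
  intros Hc H1 H2 Hneg H0 [Ha Hab]. destruct (Req_dec a b) as [->|Hn]; [lra|].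
  destruct (cont_halfline_mvt h h1 0 a) as [c [Pc E1]]; auto; [lra|].
  destruct (cont_halfline_mvt h h1 a b) as [d [Pd E2]]; auto; [lra|].
  assert (h1 d <= h1 c) by (apply (concave_derivative_nonincreasing h1 h2); auto; lra).
  rewrite H0 in E1.
  assert (Ea : h a = h1 c * a) by lra.
  assert (Eb : h b = h1 c * a + h1 d * (b - a)) by lra.
  rewrite Eb, Ea.
  assert (h1 d * ((b - a) * a) <= h1 c * ((b - a) * a)) by (apply Rmult_le_compat_r; nra).
  nra.
Qed.

Lemma concave_tangent (h h1 h2 : R -> R) (a b : R) :
  cont_on_halfline h -> (forall y, 0 < y -> is_derive h y (h1 y)) ->
  (forall y, 0 < y -> is_derive h1 y (h2 y)) -> (forall y, 0 < y -> h2 y <= 0) ->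
  0 < a -> 0 <= b -> h b <= h a + h1 a * (b - a).
Proof.
  intros Hc H1 H2 Hneg Ha Hb. destruct (Rtotal_order a b) as [Hl|[->|Hl]]; [|lra|].
  - destruct (cont_halfline_mvt h h1 a b) as [c [Pc E]]; auto; [lra|].
    assert (h1 c <= h1 a) by (apply (concave_derivative_nonincreasing h1 h2); auto; lra). nra.
  - destruct (cont_halfline_mvt h h1 b a) as [c [Pc E]]; auto.
    assert (h1 a <= h1 c) by (apply (concave_derivative_nonincreasing h1 h2); auto; lra). nra.
Qed.

(** A tangent of negative slope would reach zero at a finite point and force [h] to be nonpositive
    there. *)
Lemma concave_positive_nondecreasing (h h1 h2 : R -> R) :
  cont_on_halfline h -> (forall y, 0 < y -> is_derive h y (h1 y)) ->
  (forall y, 0 < y -> is_derive h1 y (h2 y)) -> (forall y, 0 < y -> h2 y <= 0) ->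
  (forall y, 0 < y -> 0 < h y) -> forall y, 0 < y -> 0 <= h1 y.
Proof.
  intros Hc H1 H2 Hneg Hp y Hy. apply Rnot_lt_le. intros Hl.
  assert (Py := Hp y Hy).
  set (b := y + h y / - h1 y).
  assert (Hb : 0 < h y / - h1 y) by (apply Rdiv_lt_0_compat; lra).
  assert (T := concave_tangent h h1 h2 y b Hc H1 H2 Hneg Hy ltac:(unfold b; lra)).
  assert (E : h1 y * (b - y) = - h y) by (unfold b; field; lra).
  assert (Pb := Hp b ltac:(unfold b; lra)). lra.
Qed.

Lemma nondecreasing_le_lim (h : R -> R) (l y : R) :
  (forall a b, 0 <= a <= b -> h a <= h b) -> is_lim h p_infty l -> 0 <= y -> h y <= l.
Proof.
  intros Hm Hl Hy. apply Rnot_lt_le. intros Hlt. apply is_lim_spec in Hl.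
  destruct (Hl (mkposreal (h y - l) ltac:(lra))) as [N HN]. simpl in HN.
  assert (M1 := Rmax_l y N). assert (M2 := Rmax_r y N).
  specialize (HN (Rmax y N + 1) ltac:(lra)). apply Rabs_def2 in HN.
  specialize (Hm y (Rmax y N + 1) ltac:(lra)). lra.
Qed.

Lemma exp_le (a b : R) : a <= b -> exp a <= exp b.
Proof. intros [H| ->]; [left; now apply exp_increasing|lra]. Qed.

(** At [x = 0] the product [sqrt w * w2] equals [2 * d2], hence the factor 2 before [C6]; the one
    before [C4] comes from [1 - u0^2 <= 2 * (1 - u0)]. The Gaussian bounds pass from [y] to [p]
    because [u0 <= 1] gives [p <= y]. The bound by [k * w] is where the compatibility condition on
    the second derivative at the wall enters. *)
Lemma vm_datum (u0 d1 d2 : R -> R) (C4 C5 C6 C7 : R) (u w : R -> R -> R) :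
  oleinik_datum u0 d1 d2 ->
  0 < C4 -> 0 < C5 -> 0 < C6 -> 0 < C7 ->
  (forall y, 0 <= y -> Rabs (u0 y - 1) <= C4 * exp (- C5 * y ^ 2)) ->
  (forall y, 0 <= y -> - C6 * exp (- C7 * y ^ 2) <= d2 y /\ d2 y <= 0) ->
  cont_on_quad u -> (forall y, 0 <= y -> u 0 y = u0 y) -> von_mises u w ->
  exists (w1 w2 : R -> R) (k D : R), 0 < k /\ 0 < D /\
    (forall p, 0 < p -> is_derive (w 0) p (w1 p) /\ is_derive w1 p (w2 p)) /\
    (forall p, 0 < p -> 0 <= w1 p /\ w2 p <= 0) /\
    (forall p, 0 <= p -> w 0 p <= 1 /\ w 0 p <= D * p /\
       1 - w 0 p <= 2 * C4 * exp (- C5 * p ^ 2)) /\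
    (forall p, 0 < p -> - (sqrt (w 0 p) * w2 p) <= k * w 0 p /\
       - (sqrt (w 0 p) * w2 p) <= 2 * C6 * exp (- C7 * p ^ 2)).
Proof.
  intros [Hd [cu0 [cd1 [cd2 [_ [_ [_ [_ [H00 [Hd10 [Hpos [Hq Hlim]]]]]]]]]]]] P4 P5 P6 P7 Hg Hc cu Hu0 Hw.
  assert (Hneg : forall y, 0 < y -> d2 y <= 0) by (intros y Hy; apply Hc; lra).
  assert (D1 : forall y, 0 < y -> is_derive u0 y (d1 y)) by (intros y Hy; apply Hd; auto).
  assert (D2 : forall y, 0 < y -> is_derive d1 y (d2 y)) by (intros y Hy; apply Hd; auto).
  assert (Hd1 := concave_positive_nondecreasing u0 d1 d2 cu0 D1 D2 Hneg Hpos).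
  assert (Hmono : forall a b, 0 <= a <= b -> u0 a <= u0 b).
  { intros a b Hab. apply (halfline_nondecreasing u0 d1); auto. intros t Ht. apply Hd1. lra. }
  assert (Hle1 : forall y, 0 <= y -> u0 y <= 1).
  { intros y Hy. now apply (nondecreasing_le_lim u0). }
  assert (Hpos0 : forall y, 0 <= y -> 0 <= u0 y).
  { intros y Hy. destruct (Req_dec y 0) as [->|]; [lra|]. left. apply Hpos. lra. }
  assert (Hd1le : forall y, 0 < y -> d1 y <= d1 0).
  { intros y Hy. destruct (cont_halfline_mvt d1 d2 0 y) as [c [Pc E]]; auto; [lra|].
    specialize (Hneg c ltac:(lra)). nra. }
  (* Near the wall [d2] is of order [y^2] and, by concavity, [u0] is at least a multiple of [y];
     farther out [d2] is bounded and [u0] is at least its value [m] at [e]. *)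
  assert (Hk : exists k, 0 < k /\ forall y, 0 < y -> 2 * - d2 y <= k * u0 y ^ 2).
  { destruct Hq as [K [d [Hdp HK]]]. set (e := d / 2). assert (He : 0 < e) by (unfold e; lra).
    assert (Pe := Hpos e He). set (m := u0 e) in *.
    assert (Pm2 : 0 < m ^ 2) by now apply pow_lt.
    set (A := Rabs K * e ^ 2 + C6). assert (PA : 0 < A).
    { unfold A. generalize (Rabs_pos K) (pow2_ge_0 e). nra. }
    exists (2 * (A / m ^ 2)). split; [apply Rmult_lt_0_compat; [lra|now apply Rdiv_lt_0_compat]|].
    intros y Hy. apply Rmult_le_reg_r with (m ^ 2); auto.
    replace (2 * (A / m ^ 2) * u0 y ^ 2 * m ^ 2) with (2 * (A * u0 y ^ 2)) by (field; lra).
    destruct (Rle_dec y e) as [Hye|Hye].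
    - assert (Hr := concave_ratio u0 d1 d2 y e cu0 D1 D2 Hneg H00 ltac:(lra)). fold m in Hr.
      assert (H1 := HK y ltac:(unfold e in Hye; lra)). apply Rabs_le_between in H1.
      assert (H2 := Rle_abs K). assert (H3 := pow2_ge_0 y).
      assert (H4 : - d2 y <= Rabs K * y ^ 2) by nra.
      assert (H5 : (m * y) ^ 2 <= (u0 y * e) ^ 2) by (apply pow_incr; nra).
      rewrite !Rpow_mult_distr in H5.
      assert (H6 : Rabs K * (m ^ 2 * y ^ 2) <= Rabs K * (u0 y ^ 2 * e ^ 2)).
      { apply Rmult_le_compat_l; auto. apply Rabs_pos. }
      assert (H7 := pow2_ge_0 (u0 y)). unfold A. nra.
    - assert (Hm := Hmono e y ltac:(lra)). fold m in Hm.
      assert (H1 := proj1 (Hc y ltac:(lra))).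
      assert (H2 : exp (- C7 * y ^ 2) <= 1).
      { rewrite <- exp_0. apply exp_le. generalize (pow2_ge_0 y). nra. }
      assert (H3 : - d2 y <= C6) by nra.
      assert (H4 : m ^ 2 <= u0 y ^ 2) by (apply pow_incr; lra).
      assert (H5 : C6 <= A) by (unfold A; generalize (Rabs_pos K) (pow2_ge_0 e); nra).
      assert (H6 : - d2 y * m ^ 2 <= A * u0 y ^ 2); [|lra].
      specialize (Hneg y Hy). apply Rmult_le_compat; lra. }
  destruct Hk as [k [Pk Hk]].
  assert (HG : halfline_bij (vm_psi u 0)).
  { apply vm_psi_bij; auto; [lra| |].
    - intros y Hy. rewrite Hu0 by lra. auto.
    - apply (is_lim_ext_loc u0); auto. exists 0. intros y Hy. rewrite Hu0; auto. lra. }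
  set (Y := vm_inv (vm_psi u 0)).
  assert (HY : forall p, 0 <= p -> 0 <= Y p /\ vm_psi u 0 (Y p) = p) by (intros; now apply vm_inv_spec).
  assert (HYp : forall p, 0 < p -> 0 < Y p) by (intros; now apply vm_inv_pos).
  assert (HpY : forall p, 0 <= p -> p <= Y p).
  { intros p Hp. destruct (HY p Hp) as [H1 H2]. destruct (Req_dec (Y p) 0) as [E|E].
    - rewrite E in H2. rewrite vm_psi_0 in H2. lra.
    - destruct (vm_psi_y u cu 0 ltac:(lra)) as [V1 V2].
      destruct (cont_halfline_mvt (vm_psi u 0) (u 0) 0 (Y p)) as [c [Pc E1]]; auto; [lra|].
      rewrite vm_psi_0, H2, Hu0 in E1 by lra. assert (B := Hle1 c ltac:(lra)). nra. }
  assert (HwY : forall p, 0 <= p -> w 0 p = u0 (Y p) ^ 2).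
  { intros p Hp. destruct (HY p Hp) as [H1 H2]. rewrite <- Hu0, <- Hw by (auto; lra). now rewrite H2. }
  assert (Hder : forall p, 0 < p -> is_derive (w 0) p (2 * d1 (Y p)) /\
    is_derive (fun p => 2 * d1 (Y p)) p (2 * d2 (Y p) / u0 (Y p))).
  { intros p Hp. apply (vm_profile_derivatives u0); auto.
    - intros y Hy. split; [|split]; auto. rewrite <- Hu0 by lra. apply vm_psi_y; auto; lra.
    - intros y Hy. rewrite Hw, Hu0; auto. lra. }
  assert (cw : cont_on_halfline (w 0)).
  { assert (C : cont_on_halfline (fun p => u0 (Y p) ^ 2)).
    { apply cont_halfline_sq.
      intros p Hp eps He. destruct (cu0 (Y p) (proj1 (HY p Hp)) eps He) as [a [Ha Q]].
      destruct (vm_inv_cont _ HG p Hp a Ha) as [b [Hb Q']]. exists b. split; auto.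
      intros t Ht Htp. apply Q; [now apply HY|]. now apply Q'. }
    intros p Hp eps He. destruct (C p Hp eps He) as [a [Ha Q]]. exists a. split; auto.
    intros t Ht Htp. rewrite !HwY by auto. now apply Q. }
  assert (w00 : w 0 0 = 0).
  { rewrite HwY by lra. unfold Y. rewrite vm_inv_0 by auto. rewrite H00. ring. }
  exists (fun p => 2 * d1 (Y p)), (fun p => 2 * d2 (Y p) / u0 (Y p)), k, (2 * d1 0).
  split; [auto|split; [lra|split; [exact Hder|split; [|split]]]].
  - intros p Hp. assert (Hy := HYp p Hp). assert (Pu := Hpos _ Hy). split.
    + specialize (Hd1 _ Hy). lra.
    + specialize (Hneg _ Hy). assert (0 < / u0 (Y p)) by now apply Rinv_0_lt_compat.
      unfold Rdiv. nra.
  - intros p Hp. destruct (HY p Hp) as [Hy _]. assert (B := Hle1 _ Hy). assert (B0 := Hpos0 _ Hy).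
    split; [rewrite HwY by auto; nra|split].
    + destruct (Req_dec p 0) as [->|Hp0]; [lra|].
      destruct (cont_halfline_mvt (w 0) (fun p => 2 * d1 (Y p)) 0 p) as [c [Pc E]]; auto; [|lra|].
      { intros t Ht. now apply Hder. }
      specialize (Hd1le (Y c) (HYp c ltac:(lra))). rewrite w00 in E. nra.
    + rewrite HwY by auto.
      assert (G := Hg _ Hy). apply Rabs_le_between in G.
      assert (X : exp (- C5 * Y p ^ 2) <= exp (- C5 * p ^ 2)).
      { apply exp_le. assert (p ^ 2 <= Y p ^ 2) by (apply pow_incr; auto). nra. }
      assert (1 - u0 (Y p) <= C4 * exp (- C5 * p ^ 2)) by nra. nra.
  - intros p Hp. assert (Hy := HYp p Hp). assert (Pu := Hpos _ Hy).
    rewrite HwY by lra. rewrite sqrt_pow2 by lra.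
    replace (- (u0 (Y p) * (2 * d2 (Y p) / u0 (Y p)))) with (2 * - d2 (Y p)) by (field; lra).
    split; [now apply Hk|].
    assert (X : exp (- C7 * Y p ^ 2) <= exp (- C7 * p ^ 2)).
    { apply exp_le. assert (p ^ 2 <= Y p ^ 2) by (apply pow_incr; split; [lra|apply HpY; lra]). nra. }
    assert (Q := proj1 (Hc (Y p) ltac:(lra))). nra.
Qed.

(** * The Blasius profile in von Mises variables *)

Lemma lim_ub (h : R -> R) (l C N : R) :
  is_lim h p_infty l -> (forall b, N < b -> h b <= C) -> l <= C.
Proof.
  intros Hl Hb. apply Rnot_lt_le. intros Hlt. apply is_lim_spec in Hl.
  destruct (Hl (mkposreal (l - C) ltac:(lra))) as [M HM]. simpl in HM.
  assert (M1 := Rmax_l N M). assert (M2 := Rmax_r N M).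
  specialize (HM (Rmax N M + 1) ltac:(lra)). apply Rabs_def2 in HM.
  specialize (Hb (Rmax N M + 1) ltac:(lra)). lra.
Qed.

Lemma mult_gauss_le (c z : R) :
  0 < c -> z * exp (- c * z ^ 2) <= (1 / c + 1) * exp (- (c / 2) * z ^ 2).
Proof.
  intros Hc. replace (- c * z ^ 2) with (- (c / 2) * z ^ 2 + - (c / 2 * z ^ 2)) by field.
  rewrite exp_plus, exp_Ropp.
  assert (H := exp_ineq1_le (c / 2 * z ^ 2)).
  set (e := exp (c / 2 * z ^ 2)) in *. set (g := exp (- (c / 2) * z ^ 2)).
  assert (Hg : 0 < g) by apply exp_pos. assert (He : 0 < e) by apply exp_pos.
  assert (Hi : 0 < 1 / c) by (apply Rdiv_lt_0_compat; lra).
  assert (H1 : z <= (1 / c + 1) * e).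
  { apply Rle_trans with ((1 / c + 1) * (1 + c / 2 * z ^ 2)).
    - replace ((1 / c + 1) * (1 + c / 2 * z ^ 2))
        with (1 / c + 1 + z ^ 2 / 2 + c / 2 * z ^ 2) by (field; lra).
      assert (0 <= z ^ 2) by apply pow2_ge_0. assert (0 <= (z - 1) ^ 2) by apply pow2_ge_0. nra.
    - apply Rmult_le_compat_l; lra. }
  assert (H2 : z * / e <= 1 / c + 1).
  { apply Rmult_le_reg_r with e; auto. rewrite Rmult_assoc, Rinv_l by lra. lra. }
  replace (z * (g * / e)) with (g * (z * / e)) by ring. rewrite (Rmult_comm (1 / c + 1)).
  apply Rmult_le_compat_l; lra.
Qed.

Lemma is_derive_gauss (a s : R) :
  is_derive (fun s => exp (- a * s ^ 2)) s (- (2 * a) * s * exp (- a * s ^ 2)).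
Proof.
  apply (is_derive_eq _ _ (exp (- a * s ^ 2) * (- a * (2 * s)))); [|ring].
  apply (is_derive_Rcomp exp (fun s => - a * s ^ 2)); [apply is_derive_exp|].
  apply is_derive_scal. auto_derive; [trivial|]. ring.
Qed.

Lemma is_derive_exp_half (s : R) : is_derive (fun t => exp (t / 2)) s (exp (s / 2) / 2).
Proof. auto_derive; [trivial|]. unfold Rdiv. ring. Qed.

(** The equation makes [f2] times the exponential of half a primitive of [f] constant, and the
    asymptotic rate fixes the sign of the constant at one large point. *)
Lemma blasius_f2_pos (f f1 f2 : R -> R) (C1 : R) :
  blasius f f1 f2 -> blasius_rate f2 C1 -> forall z, 0 <= z -> 0 < f2 z.
Proof.
  intros [Hd [cf [cf1 [cf2 _]]]] [C2 [K1 [K2 [Z [PK1 [_ Hr]]]]]].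
  destruct (RInt_halfline f cf) as [DJ cJ]. set (J := fun z => RInt f 0 z) in *.
  set (H := fun z => f2 z * exp (J z / 2)).
  assert (cH : cont_on_halfline H).
  { apply (cont_quad_row (fun _ z => f2 z * exp (J z / 2)) 0); [lra|].
    apply (cont_quad_mult (fun _ z => f2 z)).
    - apply (cont_quad_comp_halfline f2 (fun _ z => z)); auto. apply cont_quad_snd.
    - apply (cont_quad_comp_1d (fun t => exp (t / 2)) (fun _ z => J z)).
      + intros x y _ _. apply (is_derive_continuity_pt _ _ (exp (J y / 2) / 2)).
        apply is_derive_exp_half.
      + apply (cont_quad_comp_halfline J (fun _ z => z)); auto. apply cont_quad_snd. }
  assert (DH : forall z, 0 < z -> is_derive H z 0).
  { intros z Hz. destruct (Hd z Hz) as [_ [_ D2]].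
    assert (De : is_derive (fun z => exp (J z / 2)) z (exp (J z / 2) / 2 * f z)).
    { apply (is_derive_Rcomp (fun t => exp (t / 2))); [|now apply DJ]. apply is_derive_exp_half. }
    eapply is_derive_eq; [exact (is_derive_Rmult _ _ _ _ _ D2 De)|]. simpl. field. }
  set (N := Rmax 0 Z + 1). assert (M1 := Rmax_l 0 Z). assert (M2 := Rmax_r 0 Z).
  assert (HN : 0 < H N).
  { unfold H. apply Rmult_lt_0_compat; [|apply exp_pos].
    destruct (Hr N ltac:(unfold N; lra)) as [L _].
    assert (E := exp_pos (- C1 * N ^ 2 - C2 * N)). nra. }
  intros z Hz.
  assert (HE : H z = H N).
  { destruct (Rtotal_order z N) as [Hl|[->|Hl]]; auto.
    - destruct (cont_halfline_mvt H (fun _ => 0) z N) as [c [_ E]]; auto. cbv beta in E. lra.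
    - destruct (cont_halfline_mvt H (fun _ => 0) N z) as [c [_ E]]; auto; [unfold N in *; lra|].
      cbv beta in E. lra. }
  rewrite <- HE in HN. unfold H in HN. assert (E := exp_pos (J z / 2)).
  apply Rnot_le_lt. intros Hle. nra.
Qed.

(** Completing the square absorbs the linear term of the exponent, whatever its sign, at the price
    of halving or doubling the rate; [A1] and [B1] carry the constants left over. On the bounded
    interval before [N] monotonicity of [f2] suffices. *)
Lemma blasius_f2_gauss (f2 : R -> R) (C1 : R) :
  0 < C1 -> blasius_rate f2 C1 -> (forall z, 0 <= z -> 0 < f2 z) ->
  (forall a b, 0 <= a <= b -> f2 b <= f2 a) ->
  exists A B, 0 < A /\ 0 < B /\ forall z, 0 <= z ->
    B * exp (- (2 * C1) * z ^ 2) <= f2 z <= A * exp (- (C1 / 2) * z ^ 2).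
Proof.
  intros HC [C2 [K1 [K2 [Z [PK1 [PK2 Hr]]]]]] Hp Hm.
  set (N := Rmax 0 Z). assert (M1 : 0 <= N) by apply Rmax_l. assert (M2 : Z <= N) by apply Rmax_r.
  set (A1 := K2 * exp (C2 ^ 2 / (2 * C1))). set (A2 := f2 0 * exp (C1 / 2 * N ^ 2)).
  assert (P0 := Hp 0 ltac:(lra)). assert (PN := Hp N M1).
  assert (PA1 : 0 < A1) by (apply Rmult_lt_0_compat; auto; apply exp_pos).
  assert (PA2 : 0 < A2) by (apply Rmult_lt_0_compat; auto; apply exp_pos).
  set (B1 := K1 * exp (- (C2 ^ 2 / (4 * C1)))).
  assert (PB1 : 0 < B1) by (apply Rmult_lt_0_compat; auto; apply exp_pos).
  exists (A1 + A2), (Rmin B1 (f2 N)). split; [lra|]. split; [now apply Rmin_glb_lt|].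
  intros z Hz. assert (Q1 := Rmin_l B1 (f2 N)). assert (Q2 := Rmin_r B1 (f2 N)).
  set (B := Rmin B1 (f2 N)) in *.
  assert (E1 := exp_pos (- (2 * C1) * z ^ 2)). assert (E2 := exp_pos (- (C1 / 2) * z ^ 2)).
  destruct (Rle_dec N z) as [HNz|HNz].
  - destruct (Hr z ltac:(lra)) as [L U]. split.
    + eapply Rle_trans; [|exact L].
      apply Rle_trans with (B1 * exp (- (2 * C1) * z ^ 2)); [apply Rmult_le_compat_r; lra|].
      unfold B1. rewrite Rmult_assoc, <- exp_plus. apply Rmult_le_compat_l; [lra|]. apply exp_le.
      assert (H := pow2_ge_0 (z - C2 / (2 * C1))).
      assert (E : C1 * (z - C2 / (2 * C1)) ^ 2 = C1 * z ^ 2 - C2 * z + C2 ^ 2 / (4 * C1)) by (field; lra).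
      nra.
    + eapply Rle_trans; [exact U|].
      apply Rle_trans with (A1 * exp (- (C1 / 2) * z ^ 2)); [|apply Rmult_le_compat_r; lra].
      unfold A1. rewrite Rmult_assoc, <- exp_plus. apply Rmult_le_compat_l; [lra|]. apply exp_le.
      assert (H := pow2_ge_0 (z + C2 / C1)).
      assert (E : C1 / 2 * (z + C2 / C1) ^ 2 = C1 / 2 * z ^ 2 + C2 * z + C2 ^ 2 / (2 * C1)) by (field; lra).
      nra.
  - assert (Hz2 : z ^ 2 <= N ^ 2) by (apply pow_incr; lra). assert (H0 := pow2_ge_0 z). split.
    + assert (F := Hm z N ltac:(lra)).
      assert (exp (- (2 * C1) * z ^ 2) <= 1) by (rewrite <- exp_0; apply exp_le; nra). nra.
    + assert (F := Hm 0 z ltac:(lra)).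
      apply Rle_trans with (A2 * exp (- (C1 / 2) * z ^ 2)); [|apply Rmult_le_compat_r; lra].
      unfold A2. rewrite Rmult_assoc, <- exp_plus.
      assert (1 <= exp (C1 / 2 * N ^ 2 + - (C1 / 2) * z ^ 2)) by (rewrite <- exp_0; apply exp_le; nra).
      nra.
Qed.

(** The identity [sqrt (F t) * F2 t = - (t * F1 t) / 2] says that [F (p / sqrt (x + s))] solves the
    von Mises equation. The Gaussian lower bound on [1 - F] is what allows a similarity solution to
    be placed below the datum. *)
Definition vm_similarity (F F1 F2 : R -> R) (K c k c' : R) : Prop :=
  0 < K /\ 0 < c /\ 0 < k /\ 0 < c' /\ cont_on_halfline F /\ F 0 = 0 /\
  (forall t, 0 < t ->
     is_derive F t (F1 t) /\ is_derive F1 t (F2 t) /\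
     0 < F t /\ 0 <= F1 t /\ F2 t <= 0 /\ sqrt (F t) * F2 t = - (t * F1 t) / 2 /\
     F1 t <= K * exp (- c * t ^ 2) /\ t * F1 t <= K * exp (- c * t ^ 2) /\
     - F2 t <= K * exp (- c * t ^ 2)) /\
  (forall t, 0 <= t ->
     0 <= F t <= 1 /\ F t <= K * t /\
     k * exp (- c' * t ^ 2) <= 1 - F t <= K * exp (- c * t ^ 2)).

Lemma blasius_similarity (f f1 f2 : R -> R) (C1 : R) :
  blasius f f1 f2 -> 0 < C1 -> blasius_rate f2 C1 ->
  exists F F1 F2 K c k c', vm_similarity F F1 F2 K c k c' /\
    forall wb, blasius_vm f f1 wb ->
      forall x p, 0 <= x -> 0 <= p -> wb x p = F (p / sqrt (x + 1)).
Proof.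
  intros Hb HC Hrate. assert (H2 := blasius_f2_pos f f1 f2 C1 Hb Hrate).
  destruct Hb as [Hd [cf [cf1 [cf2 [f0 [f10 Hlim]]]]]].
  assert (Df : forall z, 0 < z -> is_derive f z (f1 z)) by (intros z Hz; apply Hd; auto).
  assert (Df1 : forall z, 0 < z -> is_derive f1 z (f2 z)) by (intros z Hz; apply Hd; auto).
  assert (Df2 : forall z, 0 < z -> is_derive f2 z (- (1/2) * f z * f2 z)) by (intros z Hz; apply Hd; auto).
  assert (m1 : forall a b, 0 <= a < b -> f1 a < f1 b).
  { intros a b Hab. apply (halfline_increasing f1 f2); auto. intros t Ht. apply H2. lra. }
  assert (p1 : forall z, 0 < z -> 0 < f1 z).
  { intros z Hz. rewrite <- f10. apply m1. lra. }
  assert (b1 : forall z, 0 <= z -> f1 z <= 1).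
  { intros z Hz. apply (nondecreasing_le_lim f1); auto. intros a b Hab.
    destruct (Req_dec a b) as [->|]; [lra|]. left. apply m1. lra. }
  assert (pf : forall z, 0 <= z -> 0 <= f z).
  { intros z Hz. rewrite <- f0. apply (halfline_nondecreasing f f1); auto; [lra|].
    intros t Ht. left. apply p1. lra. }
  assert (m2 : forall a b, 0 <= a <= b -> f2 b <= f2 a).
  { intros a b Hab. assert (Q : -1 * f2 a + 0 * f2 a <= -1 * f2 b + 0 * f2 b); [|lra].
    apply (halfline_nondecreasing (fun t => -1 * f2 t + 0 * f2 t)
      (fun t => -1 * (- (1/2) * f t * f2 t) + 0 * (- (1/2) * f t * f2 t))); auto.
    - now apply cont_halfline_lin.
    - intros t Ht. apply is_derive_Rplus; apply is_derive_scal; auto.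
    - intros t Ht. assert (A := pf t ltac:(lra)). assert (B := H2 t ltac:(lra)). nra. }
  destruct (blasius_f2_gauss f2 C1 HC Hrate H2 m2) as [A [B [PA [PB Hg]]]].
  assert (HG : halfline_bij f) by (now apply (halfline_bij_antiderivative f1)).
  set (Y := vm_inv f).
  assert (HY : forall t, 0 <= t -> 0 <= Y t /\ f (Y t) = t) by (intros; now apply vm_inv_spec).
  assert (HYp : forall t, 0 < t -> 0 < Y t) by (intros; now apply vm_inv_pos).
  assert (fub : forall z, 0 < z -> f z <= z * f1 z).
  { intros z Hz. destruct (cont_halfline_mvt f f1 0 z) as [c [Pc E]]; auto; [lra|].
    assert (m := m1 c z ltac:(lra)). rewrite f0 in E. nra. }
  assert (HtY : forall t, 0 <= t -> t <= Y t).
  { intros t Ht. destruct (HY t Ht) as [H1 E]. destruct (Req_dec t 0) as [->|]; [lra|].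
    assert (Q := HYp t ltac:(lra)). assert (fu := fub _ Q). assert (bb := b1 _ H1). nra. }
  set (m := f1 1). assert (Pm : 0 < m) by (apply p1; lra).
  (* Beyond 1 the profile [f] has slope at least [m = f1 1], so its inverse grows at most linearly;
     this carries Gaussian lower bounds from [z] to [t]. *)
  assert (HYu : forall t, 0 <= t -> Y t ^ 2 <= 2 + 2 * (t / m) ^ 2).
  { intros t Ht. destruct (HY t Ht) as [H1 E].
    assert (Htm : 0 <= t / m) by (apply Rdiv_le_0_compat; lra).
    assert (L : Y t <= 1 + t / m).
    { destruct (Rle_dec (Y t) 1) as [|Hn]; [lra|].
      destruct (cont_halfline_mvt f f1 1 (Y t)) as [c [Pc E1]]; auto; [lra|].
      assert (mm := m1 1 c ltac:(lra)). fold m in mm. rewrite E in E1.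
      assert (Q := pf 1 ltac:(lra)).
      apply Rplus_le_reg_l with (-1). apply Rmult_le_reg_r with m; auto.
      replace ((-1 + (1 + t / m)) * m) with t by (field; lra). nra. }
    assert (Y t ^ 2 <= (1 + t / m) ^ 2) by (apply pow_incr; lra).
    assert (0 <= (1 - t / m) ^ 2) by apply pow2_ge_0. nra. }
  set (F := fun t => f1 (Y t) ^ 2).
  set (a := C1 / 2). assert (Pa : 0 < a) by (unfold a; lra).
  assert (Hea : forall t, 0 <= t -> exp (- (a / 2) * Y t ^ 2) <= exp (- (a / 2) * t ^ 2)).
  { intros t Ht. apply exp_le. assert (t ^ 2 <= Y t ^ 2) by (apply pow_incr; auto). nra. }
  assert (Hea' : forall z, exp (- a * z ^ 2) <= exp (- (a / 2) * z ^ 2)).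
  { intros z. apply exp_le. assert (0 <= z ^ 2) by apply pow2_ge_0. nra. }
  (* [K0] pays for a factor [z] absorbed by halving the Gaussian rate, and [K3] for the tail of
     [1 - f1], doubled on passing to [1 - f1^2]. *)
  set (K0 := 2 * A * (1 / a + 1)). set (K3 := 2 * (A / (2 * a) + exp a)).
  assert (Pia : 0 < 1 / a) by (apply Rdiv_lt_0_compat; lra).
  assert (PK0 : 2 * A < K0) by (unfold K0; nra).
  assert (PK3 : 0 < K3).
  { unfold K3. assert (0 < A / (2 * a)) by (apply Rdiv_lt_0_compat; lra). generalize (exp_pos a). lra. }
  assert (P20 := H2 0 ltac:(lra)).
  set (K := K0 + K3 + 2 * f2 0).
  assert (zf2 : forall z, 0 <= z -> z * (2 * f2 z) <= K0 * exp (- (a / 2) * z ^ 2)).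
  { intros z Hz. destruct (Hg z Hz) as [_ U]. fold a in U.
    assert (M := mult_gauss_le a z Pa).
    apply Rle_trans with (2 * A * (z * exp (- a * z ^ 2))); [nra|]. unfold K0. nra. }
  exists F, (fun t => 2 * f2 (Y t)), (fun t => 2 * (- (1/2) * f (Y t) * f2 (Y t)) / f1 (Y t)),
    K, (a / 2), (B * exp (- (4 * C1)) * exp (- (8 * C1))), (8 * C1 / m ^ 2).
  assert (Pm2 : 0 < m ^ 2) by now apply pow_lt.
  split; [split; [unfold K; lra|split; [lra|split; [|split; [|split; [|split; [|split]]]]]]|].
  - repeat apply Rmult_lt_0_compat; auto; apply exp_pos.
  - apply Rdiv_lt_0_compat; lra.
  - apply cont_halfline_sq. intros p Hp eps He.
    destruct (cf1 (Y p) (proj1 (HY p Hp)) eps He) as [q [Hq Q]].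
    destruct (vm_inv_cont _ HG p Hp q Hq) as [b [Hb Q']]. exists b. split; auto.
    intros t Ht Htp. apply Q; [now apply HY|]. now apply Q'.
  - unfold F, Y. rewrite vm_inv_0 by auto. rewrite f10. ring.
  - intros t Ht. destruct (HY t ltac:(lra)) as [H1 E]. assert (Py := HYp t Ht).
    assert (P1 := p1 _ Py). assert (P2 := H2 _ H1). assert (Z2 := zf2 _ H1).
    assert (Et := Hea t ltac:(lra)). assert (Et' := Hea' (Y t)).
    destruct (vm_profile_derivatives f1 f2 (fun z => - (1/2) * f z * f2 z) f F t) as [V1 V2]; auto.
    { intros y Hy. unfold F, Y. now rewrite vm_inv_left. }
    assert (Ep := exp_pos (- (a / 2) * t ^ 2)). assert (Ep' := exp_pos (- (a / 2) * Y t ^ 2)).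
    assert (G0 : K0 * exp (- (a / 2) * Y t ^ 2) <= K * exp (- (a / 2) * t ^ 2)).
    { apply Rmult_le_compat; unfold K; lra. }
    split; [exact V1|split; [exact V2|]]. split; [now apply pow_lt|]. split; [lra|].
    split; [|split; [|split; [|split]]].
    + rewrite E. replace (2 * (- (1 / 2) * t * f2 (Y t)) / f1 (Y t))
        with (- (t * f2 (Y t) / f1 (Y t))) by (field; lra).
      assert (0 <= t * f2 (Y t) / f1 (Y t)) by (apply Rdiv_le_0_compat; nra). lra.
    + unfold F. rewrite sqrt_pow2 by lra. rewrite E. field. lra.
    + destruct (Hg _ H1) as [_ U]. fold a in U. eapply Rle_trans; [|exact G0].
      apply Rle_trans with (2 * A * exp (- (a / 2) * Y t ^ 2)); [nra|]. apply Rmult_le_compat_r; lra.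
    + eapply Rle_trans; [|exact G0]. eapply Rle_trans; [|exact Z2].
      apply Rmult_le_compat_r; [lra|]. apply HtY. lra.
    + eapply Rle_trans; [|exact G0]. eapply Rle_trans; [|exact Z2].
      assert (fu := fub _ Py). apply Rmult_le_reg_r with (f1 (Y t)); auto.
      replace (- (2 * (- (1 / 2) * f (Y t) * f2 (Y t)) / f1 (Y t)) * f1 (Y t)) with (f (Y t) * f2 (Y t)) by (field; lra).
      nra.
  - intros t Ht. destruct (HY t Ht) as [H1 E]. assert (bb := b1 _ H1).
    assert (b0 : 0 <= f1 (Y t)).
    { destruct (Req_dec (Y t) 0) as [Q|]; [rewrite Q; lra|]. left. apply p1. lra. }
    split; [unfold F; split; nra|]. split; [|split].
    + destruct (Req_dec t 0) as [->|Hn].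
      { unfold F, Y. rewrite vm_inv_0 by auto. rewrite f10. lra. }
      unfold F. assert (Py := HYp t ltac:(lra)).
      (* [f1 z ^ 2 <= 2 f2(0) f z]: both vanish at 0 and the derivatives compare. *)
      assert (Q : 2 * f2 0 * f 0 + -1 * f1 0 ^ 2 <= 2 * f2 0 * f (Y t) + -1 * f1 (Y t) ^ 2).
      { apply (halfline_nondecreasing (fun z => 2 * f2 0 * f z + -1 * f1 z ^ 2)
          (fun z => 2 * f2 0 * f1 z + -1 * (2 * f2 z * f1 z))); try lra.
        - apply (cont_halfline_lin f (fun z => f1 z ^ 2)); auto. now apply cont_halfline_sq.
        - intros z Hz. apply is_derive_Rplus; apply is_derive_scal; auto.
          eapply is_derive_eq; [exact (is_derive_pow f1 2 z _ (Df1 z Hz))|]. simpl. ring.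
        - intros z Hz. assert (mz := m2 0 z ltac:(lra)). assert (pz := p1 z ltac:(lra)). nra. }
      rewrite f0, f10, E in Q. unfold K. nra.
    (* Over one unit [f1] increases by at least [f2 (Y t + 1)], so the lower bound on [f2] passes to
       [1 - f1]; then [(Y + 1)^2 <= 6 + 4 * (t / m)^2] accounts for the constants chosen for [k] and
       [c']. *)
    + destruct (cont_halfline_mvt f1 f2 (Y t) (Y t + 1)) as [c [Pc E1]]; auto; [lra|].
      assert (bb' := b1 (Y t + 1) ltac:(lra)). assert (m2c := m2 c (Y t + 1) ltac:(lra)).
      destruct (Hg (Y t + 1) ltac:(lra)) as [L _].
      apply Rle_trans with (B * exp (- (2 * C1) * (Y t + 1) ^ 2)); [|unfold F; nra].
      rewrite !Rmult_assoc, <- !exp_plus. apply Rmult_le_compat_l; [lra|]. apply exp_le.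
      assert (U := HYu t Ht). assert (0 <= (Y t - 1) ^ 2) by apply pow2_ge_0.
      replace (- (8 * C1 / m ^ 2) * t ^ 2) with (- (8 * C1 * (t / m) ^ 2)) by (field; lra).
      assert ((Y t + 1) ^ 2 <= 6 + 4 * (t / m) ^ 2) by nra. nra.
    (* For [z > 1] the sum of [f1] and [A / (2 * a)] times the Gaussian is nonincreasing, because
       the derivative of the Gaussian brings the factor [z >= 1]; hence it stays above the limit 1.
       For [z <= 1] the factor [exp a] suffices. *)
    + assert (T : 1 - f1 (Y t) <= K3 / 2 * exp (- a * Y t ^ 2)).
      { set (z := Y t) in *. assert (Ez := exp_pos (- a * z ^ 2)).
        destruct (Rle_dec z 1) as [Hz|Hz].
        - assert (1 <= exp a * exp (- a * z ^ 2)).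
          { rewrite <- exp_plus, <- exp_0. apply exp_le. assert (z ^ 2 <= 1) by nra. nra. }
          assert (0 < A / (2 * a)) by (apply Rdiv_lt_0_compat; lra). unfold K3. nra.
        - apply Rle_trans with (A / (2 * a) * exp (- a * z ^ 2)).
          2:{ apply Rmult_le_compat_r; [lra|]. unfold K3. generalize (exp_pos a). lra. }
          cut (1 <= f1 z + A / (2 * a) * exp (- a * z ^ 2)); [lra|].
          apply (lim_ub f1 _ _ z Hlim). intros b Hbz.
          destruct (MVT_cor2 (fun s => f1 s + A / (2 * a) * exp (- a * s ^ 2))
            (fun s => f2 s + A / (2 * a) * (- (2 * a) * s * exp (- a * s ^ 2))) z b Hbz) as [c [E1 Pc]].
          { intros s Hs. apply is_derive_Reals. apply is_derive_Rplus; [apply Df1; lra|].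
            apply is_derive_scal, is_derive_gauss. }
          assert (Ebz := exp_pos (- a * b ^ 2)).
          assert (PAa : 0 < A / (2 * a)) by (apply Rdiv_lt_0_compat; lra).
          destruct (Hg c ltac:(lra)) as [_ U]. fold a in U.
          assert (Ec := exp_pos (- a * c ^ 2)).
          replace (A / (2 * a) * (- (2 * a) * c * exp (- a * c ^ 2))) with (- (A * exp (- a * c ^ 2) * c)) in E1 by (field; lra).
          assert (PAe : 0 < A * exp (- a * c ^ 2)) by (apply Rmult_lt_0_compat; lra).
          assert (N : f2 c + - (A * exp (- a * c ^ 2) * c) <= 0).
          { assert (A * exp (- a * c ^ 2) * 1 <= A * exp (- a * c ^ 2) * c)
              by (apply Rmult_le_compat_l; lra). lra. }
          assert (0 < A / (2 * a) * exp (- a * b ^ 2)) by (apply Rmult_lt_0_compat; lra).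
          assert ((f2 c + - (A * exp (- a * c ^ 2) * c)) * (b - z) <= 0) by nra. lra. }
      assert (Et := Hea t Ht). assert (Et' := Hea' (Y t)).
      assert (T2 : 1 - F t <= K3 * exp (- a * Y t ^ 2)) 
        by (unfold F; assert (1 - f1 (Y t) ^ 2 <= 2 * (1 - f1 (Y t))) by nra; lra).
      assert (Ep := exp_pos (- a * Y t ^ 2)).
      eapply Rle_trans; [exact T2|]. apply Rmult_le_compat; unfold K; lra.
  - intros wb Hwb x p Hx Hp.
    assert (Hs : 0 <= p / sqrt (x + 1)) by (apply Rdiv_le_0_compat; auto; apply sqrt_lt_R0; lra).
    destruct (HY _ Hs) as [H1 E]. apply (Hwb x p (Y (p / sqrt (x + 1)))); auto.
Qed.

(** * Solutions obtained from the symmetries of the equation *)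

Lemma is_derive_affine (a b x : R) : is_derive (fun t => a * t + b) x a.
Proof. auto_derive; [trivial|ring]. Qed.

Lemma smooth_xpp_scale (A Ax Ap App : R -> R -> R) (mu a h b : R) :
  smooth_xpp A Ax Ap App -> 0 < a -> 0 <= h -> 0 < b ->
  smooth_xpp (fun x p => mu * A (a * x + h) (b * p))
    (fun x p => mu * (Ax (a * x + h) (b * p) * a))
    (fun x p => mu * (Ap (a * x + h) (b * p) * b))
    (fun x p => mu * (App (a * x + h) (b * p) * b * b)).
Proof.
  intros HA Ha Hh Hb x p Hx Hp.
  assert (Hx' : 0 < a * x + h) by nra. assert (Hp' : 0 < b * p) by nra.
  destruct (HA _ _ Hx' Hp') as [A1 [A2 A3]].
  assert (Hl : is_derive (fun t => b * t) p b) by (auto_derive; [trivial|ring]).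
  split; [|split]; apply is_derive_scal.
  - apply (is_derive_Rcomp (fun s => A s (b * p)) (fun s => a * s + h)); auto. apply is_derive_affine.
  - now apply (is_derive_Rcomp (A (a * x + h)) (fun t => b * t)).
  - eapply is_derive_eq;
      [exact (is_derive_Rmult _ _ _ _ _ (is_derive_Rcomp (Ap (a * x + h)) (fun t => b * t) p _ _ A3 Hl)
                (is_derive_const (V := R_NormedModule) b p))|].
    simpl. unfold zero; simpl. ring.
Qed.

Lemma cont_quad_scale (A : R -> R -> R) (mu a h b : R) :
  cont_on_quad A -> 0 <= a -> 0 <= h -> 0 <= b ->
  cont_on_quad (fun x p => mu * A (a * x + h) (b * p)).
Proof.
  intros HA Ha Hh Hb. apply cont_quad_mult; [apply cont_quad_const|].
  apply (cont_quad_comp A (fun x _ => a * x + h) (fun _ p => b * p)); auto.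
  - apply cont_quad_plus; [|apply cont_quad_const].
    apply cont_quad_mult; [apply cont_quad_const|apply cont_quad_fst].
  - apply cont_quad_mult; [apply cont_quad_const|apply cont_quad_snd].
  - intros x y Hx Hy. split; nra.
Qed.

Lemma vm_similarity_nondecreasing (F F1 F2 : R -> R) (K c k c' a b : R) :
  vm_similarity F F1 F2 K c k c' -> 0 <= a <= b -> F a <= F b.
Proof.
  intros [_ [_ [_ [_ [cF [_ [Hd _]]]]]]] Hab.
  apply (halfline_nondecreasing F F1); auto.
  - intros t Ht. now apply Hd.
  - intros t Ht. apply Hd. lra.
Qed.

Lemma vm_similarity_ratio (F F1 F2 : R -> R) (K c k c' a b : R) :
  vm_similarity F F1 F2 K c k c' -> 0 < a <= b -> F b * a <= F a * b.
Proof.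
  intros [_ [_ [_ [_ [cF [F0 [Hd _]]]]]]] Hab.
  apply (concave_ratio F F1 F2); auto; intros t Ht; apply Hd; lra.
Qed.

Lemma is_derive_sim_arg (m s p x : R) :
  0 < m -> 0 < x + s ->
  is_derive (fun x => p / (m * sqrt (x + s))) x
    (- (p / (m * sqrt (x + s))) / (2 * (x + s))).
Proof.
  intros Hm Hx. assert (Hs := sqrt_lt_R0 _ Hx).
  auto_derive.
  - split; auto. split; [|trivial]. apply Rgt_not_eq. nra.
  - assert (E : x + s = sqrt (x + s) * sqrt (x + s)) by (symmetry; apply sqrt_sqrt; lra).
    set (r := sqrt (x + s)) in *. rewrite E. field. lra.
Qed.

(** The Blasius solution, which is the case [m = s = 1], moved by translation in [x] and by the
    scaling that multiplies [p] by [m]; the factor [m ^ 4] is forced by the square root in the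
    equation. Taking [m > 1] raises the value at infinity strictly above 1. *)
Definition sim_sol (F : R -> R) (m s x p : R) : R := m ^ 4 * F (p / (m * sqrt (x + s))).
Definition sim_sol_x (F1 : R -> R) (m s x p : R) : R :=
  m ^ 4 * (F1 (p / (m * sqrt (x + s))) * (- (p / (m * sqrt (x + s))) / (2 * (x + s)))).
Definition sim_sol_p (F1 : R -> R) (m s x p : R) : R :=
  m ^ 4 * (F1 (p / (m * sqrt (x + s))) * / (m * sqrt (x + s))).
Definition sim_sol_pp (F2 : R -> R) (m s x p : R) : R :=
  m ^ 4 * (F2 (p / (m * sqrt (x + s))) * / (m * sqrt (x + s)) * / (m * sqrt (x + s))).

Lemma sim_sol_p_derivatives (F F1 F2 : R -> R) (K c k c' m s x p : R) :
  vm_similarity F F1 F2 K c k c' -> 0 < m -> 0 < x + s -> 0 < p ->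
  is_derive (sim_sol F m s x) p (sim_sol_p F1 m s x p) /\
  is_derive (sim_sol_p F1 m s x) p (sim_sol_pp F2 m s x p).
Proof.
  intros [_ [_ [_ [_ [cF [F0 [Hd _]]]]]]] Hm Hx Hp.
  assert (Hs := sqrt_lt_R0 _ Hx). set (r := m * sqrt (x + s)).
  assert (Hr : 0 < r) by (unfold r; nra).
  assert (Ht : 0 < p / r) by now apply Rdiv_lt_0_compat.
  destruct (Hd _ Ht) as [D1 [D2 _]].
  assert (Hl : is_derive (fun t => t / r) p (/ r)) by (auto_derive; [trivial|ring]).
  unfold sim_sol, sim_sol_p, sim_sol_pp. fold r. split; apply is_derive_scal.
  - now apply (is_derive_Rcomp F (fun t => t / r)).
  - eapply is_derive_eq;
      [exact (is_derive_Rmult _ _ _ _ _ (is_derive_Rcomp F1 (fun t => t / r) p _ _ D2 Hl)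
                (is_derive_const (V := R_NormedModule) (/ r) p))|].
    simpl. unfold zero; simpl. ring.
Qed.

Lemma sim_sol_x_derivative (F F1 F2 : R -> R) (K c k c' m s x p : R) :
  vm_similarity F F1 F2 K c k c' -> 0 < m -> 0 < x + s -> 0 < p ->
  is_derive (fun x => sim_sol F m s x p) x (sim_sol_x F1 m s x p).
Proof.
  intros [_ [_ [_ [_ [cF [F0 [Hd _]]]]]]] Hm Hx Hp.
  assert (Hs := sqrt_lt_R0 _ Hx).
  assert (Ht : 0 < p / (m * sqrt (x + s))) by (apply Rdiv_lt_0_compat; nra).
  destruct (Hd _ Ht) as [D1 _].
  unfold sim_sol, sim_sol_x. apply is_derive_scal.
  apply (is_derive_Rcomp F (fun x => p / (m * sqrt (x + s)))); auto. now apply is_derive_sim_arg.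
Qed.

Lemma sim_sol_spec (F F1 F2 : R -> R) (K c k c' m s : R) :
  vm_similarity F F1 F2 K c k c' -> 0 < m -> 0 < s ->
  cont_on_quad (sim_sol F m s) /\
  smooth_xpp (sim_sol F m s) (sim_sol_x F1 m s) (sim_sol_p F1 m s) (sim_sol_pp F2 m s) /\
  (forall x p, 0 <= x -> 0 <= p -> 0 <= sim_sol F m s x p <= m ^ 4) /\
  (forall x, 0 <= x -> sim_sol F m s x 0 = 0) /\
  (forall x p, 0 < x -> 0 < p ->
     sim_sol_x F1 m s x p = sqrt (sim_sol F m s x p) * sim_sol_pp F2 m s x p /\
     sim_sol_pp F2 m s x p <= 0).
Proof.
  intros HF Hm Hs. assert (HF' := HF).
  destruct HF' as [_ [_ [_ [_ [cF [F0 [Hd Hb]]]]]]].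
  assert (Hm4 : 0 < m ^ 4) by now apply pow_lt.
  assert (Hr : forall x, 0 <= x -> 0 < m * sqrt (x + s)).
  { intros x Hx. assert (H := sqrt_lt_R0 (x + s) ltac:(lra)). nra. }
  assert (Ht : forall x p, 0 <= x -> 0 <= p -> 0 <= p / (m * sqrt (x + s))).
  { intros x p Hx Hp. apply Rdiv_le_0_compat; auto. }
  split; [|split; [|split; [|split]]].
  - unfold sim_sol. apply cont_quad_mult; [apply cont_quad_const|].
    apply (cont_quad_comp_halfline F (fun x p => p / (m * sqrt (x + s)))); auto.
    apply cont_quad_of_2d. intros x p Hx Hp. unfold Rdiv. apply continuity_2d_pt_mult; [apply continuity_2d_pt_id2|].
    apply continuity_2d_pt_inv; [|generalize (Hr x Hx); lra].
    apply continuity_2d_pt_mult; [apply continuity_2d_pt_const|].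
    apply (continuity_1d_2d_pt_comp sqrt (fun x _ => x + s)); [apply continuity_pt_sqrt; lra|].
    apply continuity_2d_pt_plus; [apply continuity_2d_pt_id1|apply continuity_2d_pt_const].
  - intros x p Hx Hp. split; [eapply sim_sol_x_derivative; eauto; lra|].
    eapply sim_sol_p_derivatives; eauto; lra.
  - intros x p Hx Hp. unfold sim_sol. destruct (Hb _ (Ht x p Hx Hp)) as [B _]. nra.
  - intros x Hx. unfold sim_sol, Rdiv. rewrite Rmult_0_l, F0. ring.
  - intros x p Hx Hp. assert (R := Hr x ltac:(lra)). set (t := p / (m * sqrt (x + s))).
    assert (Pt : 0 < t) by (now apply Rdiv_lt_0_compat).
    destruct (Hd t Pt) as [_ [_ [Pf [_ [N [Eq _]]]]]].
    unfold sim_sol, sim_sol_x, sim_sol_pp. fold t.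
    assert (Hsx := sqrt_lt_R0 (x + s) ltac:(lra)).
    assert (E : x + s = sqrt (x + s) * sqrt (x + s)) by (symmetry; apply sqrt_sqrt; lra).
    split.
    + replace (m ^ 4) with ((m ^ 2) ^ 2) at 2 by ring.
      assert (Hm2 : 0 < m ^ 2) by now apply pow_lt.
      rewrite sqrt_mult by (try apply pow2_ge_0; lra). rewrite sqrt_pow2 by lra.
      replace (m ^ 2 * sqrt (F t) * (m ^ 4 * (F2 t * / (m * sqrt (x + s)) * / (m * sqrt (x + s)))))
        with (m ^ 6 * (sqrt (F t) * F2 t) * / (m * sqrt (x + s)) * / (m * sqrt (x + s))) by ring.
      rewrite Eq. set (r := sqrt (x + s)) in *. rewrite E. field. lra.
    + assert (Hi : 0 < / (m * sqrt (x + s))) by now apply Rinv_0_lt_compat.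
      assert (0 < / (m * sqrt (x + s)) * / (m * sqrt (x + s))) by nra.
      assert (F2 t * (/ (m * sqrt (x + s)) * / (m * sqrt (x + s))) <= 0) by nra.
      rewrite Rmult_assoc. nra.
Qed.

(** * Gaussian barriers *)

Definition gauss (g x p : R) : R := exp (- g * p ^ 2 / (x + 1)).

Lemma gauss_smooth (g : R) :
  smooth_xpp (gauss g)
    (fun x p => g * p ^ 2 / (x + 1) ^ 2 * gauss g x p)
    (fun x p => - (2 * g) * p / (x + 1) * gauss g x p)
    (fun x p => (4 * g ^ 2 * p ^ 2 / (x + 1) ^ 2 - 2 * g / (x + 1)) * gauss g x p).
Proof.
  intros x p Hx Hp. unfold gauss.
  assert (Dp : is_derive (fun p => exp (- g * p ^ 2 / (x + 1))) p
    (- (2 * g) * p / (x + 1) * exp (- g * p ^ 2 / (x + 1)))).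
  { eapply is_derive_eq; [apply (is_derive_Rcomp exp (fun p => - g * p ^ 2 / (x + 1))); [apply is_derive_exp|]|].
    - instantiate (1 := - (2 * g) * p / (x + 1)). auto_derive; [trivial|]. field. lra.
    - ring. }
  split; [|split; [exact Dp|]].
  - eapply is_derive_eq; [apply (is_derive_Rcomp exp (fun x => - g * p ^ 2 / (x + 1))); [apply is_derive_exp|]|].
    + instantiate (1 := g * p ^ 2 / (x + 1) ^ 2). auto_derive; [lra|]. field. lra.
    + ring.
  - assert (Dl : is_derive (fun p => - (2 * g) * p / (x + 1)) p (- (2 * g) / (x + 1))).
    { auto_derive; [trivial|]. field. lra. }
    eapply is_derive_eq; [exact (is_derive_Rmult _ _ _ _ _ Dl Dp)|]. simpl. field. lra.
Qed.

Lemma cont_quad_gauss (g : R) : cont_on_quad (gauss g).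
Proof.
  unfold gauss. apply (cont_quad_comp_1d exp (fun x p => - g * p ^ 2 / (x + 1))).
  - intros. apply derivable_continuous_pt, derivable_pt_exp.
  - unfold Rdiv. apply cont_quad_mult.
    + apply cont_quad_mult; [apply cont_quad_const|].
      apply (cont_quad_comp_1d (fun t => t ^ 2) (fun _ p => p)); [|apply cont_quad_snd].
      intros. apply derivable_continuous_pt, derivable_pt_pow.
    + apply cont_quad_of_2d. intros x y Hx Hy. apply continuity_2d_pt_inv; [|lra].
      apply continuity_2d_pt_plus; [apply continuity_2d_pt_id1|apply continuity_2d_pt_const].
Qed.

(** A heat kernel without its decaying prefactor: for diffusion at most 1 and rate at most [1 / 4]
    the quadratic terms compare, and the remaining term has the good sign. *)
Lemma gauss_supersolution (g a x p : R) :
  0 < g -> 4 * g <= 1 -> 0 <= a <= 1 -> 0 <= x ->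
  a * ((4 * g ^ 2 * p ^ 2 / (x + 1) ^ 2 - 2 * g / (x + 1)) * gauss g x p)
  <= g * p ^ 2 / (x + 1) ^ 2 * gauss g x p.
Proof.
  intros Hg Hg4 Ha Hx. assert (E : 0 < gauss g x p) by apply exp_pos.
  rewrite <- Rmult_assoc. apply Rmult_le_compat_r; [lra|].
  set (T := p ^ 2 / (x + 1) ^ 2).
  assert (HT : 0 <= T) by (apply Rdiv_le_0_compat; [apply pow2_ge_0|apply pow_lt; lra]).
  replace (4 * g ^ 2 * p ^ 2 / (x + 1) ^ 2) with (4 * g * g * T) by (unfold T; field; lra).
  replace (g * p ^ 2 / (x + 1) ^ 2) with (g * T) by (unfold T; field; lra).
  assert (0 < 2 * g / (x + 1)) by (apply Rdiv_lt_0_compat; lra).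
  assert (0 <= g * T) by nra.
  assert (4 * g * (g * T) <= 1 * (g * T)) by (apply Rmult_le_compat_r; lra).
  assert (a * (4 * g * g * T) <= 1 * (g * T)) by nra.
  nra.
Qed.

Lemma gauss_le_initial (g C x p : R) :
  0 < g <= C -> 0 <= x -> exp (- C * p ^ 2) <= gauss g x p.
Proof.
  intros Hg Hx. unfold gauss. apply exp_le.
  assert (H : p ^ 2 / (x + 1) <= p ^ 2).
  { apply Rmult_le_reg_r with (x + 1); [lra|].
    replace (p ^ 2 / (x + 1) * (x + 1)) with (p ^ 2) by (field; lra). generalize (pow2_ge_0 p). nra. }
  assert (H0 : 0 <= p ^ 2 / (x + 1)) by (apply Rdiv_le_0_compat; [apply pow2_ge_0|lra]).
  replace (- g * p ^ 2 / (x + 1)) with (- g * (p ^ 2 / (x + 1))) by (field; lra). nra.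
Qed.

Lemma max_principle_step (a t : R) :
  0 <= a <= 1 -> 0 < t -> a * (2 - / (4 * (t * sqrt t))) + 0 * weight t < 3 * weight t.
Proof.
  intros Ha Ht. assert (Pinv : 0 < / (4 * (t * sqrt t))).
  { apply Rinv_0_lt_compat. generalize (sqrt_lt_R0 t Ht). nra. }
  assert (W := weight_ge t). assert (1 <= weight t) by nra. nra.
Qed.

Lemma smooth_xpp_mult_x (A Ax Ap App : R -> R -> R) (mu : R) :
  smooth_xpp A Ax Ap App ->
  smooth_xpp (fun x p => mu * x * A x p) (fun x p => mu * A x p + mu * x * Ax x p)
    (fun x p => mu * x * Ap x p) (fun x p => mu * x * App x p).
Proof.
  intros HA x p Hx Hp. destruct (HA x p Hx Hp) as [A1 [A2 A3]].
  split; [|split; now apply is_derive_scal].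
  apply (is_derive_Rmult (fun s => mu * s) (fun s => A s p)); auto. auto_derive; [trivial|ring].
Qed.

Lemma gauss_antitone (g g' x p : R) : 0 <= x -> g <= g' -> gauss g' x p <= gauss g x p.
Proof.
  intros Hx Hg. unfold gauss. apply exp_le.
  assert (H0 : 0 <= p ^ 2 / (x + 1)) by (apply Rdiv_le_0_compat; [apply pow2_ge_0|lra]).
  replace (- g' * p ^ 2 / (x + 1)) with (- g' * (p ^ 2 / (x + 1))) by (field; lra).
  replace (- g * p ^ 2 / (x + 1)) with (- g * (p ^ 2 / (x + 1))) by (field; lra). nra.
Qed.

(** A shift [s >= 1] in [x] is exchanged for a smaller rate, since [x + s <= s * (x + 1)]. *)
Lemma gauss_shift (a s x p : R) :
  0 <= x -> 0 < a -> 1 <= s -> exp (- a * (p / sqrt (x + s)) ^ 2) <= gauss (a / s) x p.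
Proof.
  intros Hx Ha Hs. unfold gauss. apply exp_le.
  replace ((p / sqrt (x + s)) ^ 2) with (p ^ 2 / (x + s)).
  2:{ unfold Rdiv. rewrite Rpow_mult_distr, pow_inv, pow2_sqrt by lra. ring. }
  replace (- a * (p ^ 2 / (x + s))) with (- (a * p ^ 2) * / (x + s)) by (field; lra).
  replace (- (a / s) * p ^ 2 / (x + 1)) with (- (a * p ^ 2) * / (s * (x + 1))) by (field; lra).
  assert (H : / (s * (x + 1)) <= / (x + s)) by (apply Rinv_le_contravar; nra).
  assert (0 <= a * p ^ 2) by (generalize (pow2_ge_0 p); nra). nra.
Qed.

Lemma weaken_bound (X A A' d E E' : R) :
  Rabs X <= A / d * E -> 0 < d -> 0 <= A <= A' -> 0 <= E <= E' -> Rabs X <= A' / d * E'.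
Proof.
  intros H Hd HA HE. eapply Rle_trans; [exact H|].
  assert (0 < / d) by now apply Rinv_0_lt_compat.
  apply Rmult_le_compat; try lra; unfold Rdiv; nra.
Qed.

Lemma gauss_half (g x p : R) : 0 <= x -> gauss g x p = gauss (g / 2) x p ^ 2.
Proof.
  intros Hx. unfold gauss. set (t := - (g / 2) * p ^ 2 / (x + 1)).
  transitivity (exp t * exp t); [|ring]. rewrite <- exp_plus. f_equal. unfold t. field. lra.
Qed.

Lemma le_of_sq_le (a b : R) : 0 <= b -> a ^ 2 <= b ^ 2 -> a <= b.
Proof. intros Hb H. apply Rnot_lt_le. intros Hl. nra. Qed.

(** * Comparison estimates for the von Mises solution *)

Section flow.

Variables (w wx wp wpp : R -> R -> R).
Hypothesis cw : cont_on_quad w.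
Hypothesis sw : smooth_xpp w wx wp wpp.
Hypothesis eqw : forall x p, 0 < x -> 0 < p -> wx x p = sqrt (w x p) * wpp x p.
Hypothesis w_0 : forall x, 0 <= x -> w x 0 = 0.
Hypothesis wpos : forall x p, 0 <= x -> 0 < p -> 0 < w x p.
Hypothesis wbd : forall X, 0 < X -> exists M, 0 <= M /\
  forall x p, 0 <= x <= X -> 0 <= p -> w x p <= M ^ 2.
Hypothesis wppK : forall X c, 0 < X -> 0 < c ->
  (forall x p, 0 <= x <= X -> 0 < p -> c * Rmin p 1 <= w x p) ->
  exists K, 0 < K /\ forall x p, 0 < x <= X -> 0 < p -> wpp x p <= K.

Variables (w1 w2 : R -> R) (kd D G0 C5 M0 C7 : R).
Hypotheses (Pkd : 0 < kd) (PD : 0 < D) (PG0 : 0 < G0) (PC5 : 0 < C5) (PM0 : 0 < M0) (PC7 : 0 < C7).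
Hypothesis dw0 : forall p, 0 < p -> is_derive (w 0) p (w1 p) /\ is_derive w1 p (w2 p).
Hypothesis sgn0 : forall p, 0 < p -> 0 <= w1 p /\ w2 p <= 0.
Hypothesis bd0 : forall p, 0 <= p -> w 0 p <= 1 /\ w 0 p <= D * p /\
  1 - w 0 p <= G0 * exp (- C5 * p ^ 2).
Hypothesis dat0 : forall p, 0 < p -> - (sqrt (w 0 p) * w2 p) <= kd * w 0 p /\
  - (sqrt (w 0 p) * w2 p) <= M0 * exp (- C7 * p ^ 2).

Variables (F F1 F2 : R -> R) (K c k c' : R).
Hypothesis HF : vm_similarity F F1 F2 K c k c'.

Lemma w_nonneg (x p : R) : 0 <= x -> 0 <= p -> 0 <= w x p.
Proof.
  intros Hx Hp. destruct (Req_dec p 0) as [->|]; [rewrite w_0; lra|]. left. apply wpos; lra.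
Qed.

Lemma cw0 : cont_on_halfline (w 0).
Proof. apply cont_quad_row; auto. lra. Qed.

Lemma w0_nondecreasing (a b : R) : 0 <= a <= b -> w 0 a <= w 0 b.
Proof.
  intros Hab. apply (halfline_nondecreasing (w 0) w1); auto; [apply cw0| |].
  - intros t Ht. now apply dw0.
  - intros t Ht. apply sgn0. lra.
Qed.

Lemma w0_ratio (a b : R) : 0 < a <= b -> w 0 b * a <= w 0 a * b.
Proof.
  intros Hab. apply (concave_ratio (w 0) w1 w2); auto; try (intros; now apply dw0);
    try (intros; now apply sgn0); [apply cw0|apply w_0; lra].
Qed.

(** * The datum as a stationary barrier *)

Lemma stationary_smooth : smooth_xpp (fun _ p => w 0 p) (fun _ _ => 0) (fun _ p => w1 p) (fun _ p => w2 p).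
Proof.
  intros x p Hx Hp. split; [apply @is_derive_const|]. now apply dw0.
Qed.

Lemma stationary_cont : cont_on_quad (fun _ p => w 0 p).
Proof. apply (cont_quad_comp_halfline (w 0) (fun _ p => p)); auto; [apply cw0|apply cont_quad_snd]. Qed.

Lemma w_le_initial (x p : R) : 0 <= x -> 0 <= p -> w x p <= w 0 p.
Proof.
  intros Hx Hp. destruct (wbd (x + 1) ltac:(lra)) as [M [PM HM]].
  apply (comparison_principle w wx wp wpp (fun _ p => w 0 p) (fun _ _ => 0) (fun _ p => w1 p) (fun _ p => w2 p)
    (x + 1) M); auto; try lra.
  - apply stationary_cont.
  - apply stationary_smooth.
  - intros s t Hs Ht. split; auto. apply w_nonneg; lra.
  - intros s t Hs Ht _. rewrite eqw by lra. destruct (sgn0 t Ht) as [_ N].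
    assert (S := sqrt_pos (w 0 t)). split; [lra|split; [nra|auto]].
  - intros t Ht. lra.
  - intros s Hs. rewrite !w_0; lra.
Qed.

Lemma w_le_1 (x p : R) : 0 <= x -> 0 <= p -> w x p <= 1.
Proof.
  intros Hx Hp. apply Rle_trans with (w 0 p); [now apply w_le_initial|]. now apply bd0.
Qed.

Lemma sqrt_w_le_1 (x p : R) : 0 <= x -> 0 <= p -> sqrt (w x p) <= 1.
Proof. intros Hx Hp. rewrite <- sqrt_1. apply sqrt_le_1_alt. now apply w_le_1. Qed.

(** * Bracketing between similarity solutions *)

Lemma initial_above_similarity :
  exists s, 1 <= s /\ forall p, 0 <= p -> F (p / sqrt s) <= w 0 p.
Proof.
  assert (HF' := HF). destruct HF' as [PK [Pc [Pk [Pc' [cF [F0 [Hd Hb]]]]]]].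
  (* Beyond [P] half of the Gaussian decay of [1 - w 0 p] already outweighs the ratio [G0 / k] of
     the two tail constants. *)
  set (P := 1 + 2 * G0 / (k * C5)).
  assert (PP : 1 < P).
  { assert (0 < 2 * G0 / (k * C5)) by (apply Rdiv_lt_0_compat; nra). unfold P. lra. }
  assert (Pw := wpos 0 P ltac:(lra) ltac:(lra)).
  set (q := K * P / w 0 P). assert (Pq : 0 < q) by (apply Rdiv_lt_0_compat; nra).
  assert (Pcc : 0 < 2 * c' / C5) by (apply Rdiv_lt_0_compat; lra).
  (* The second term brings the rate [c' / s] of the profile's tail below [C5 / 2]. The term [q ^ 2]
     makes the profile flat enough at the wall to lie under the chord of the concave datum on
     [[0, P]]. *)
  set (s := 1 + 2 * c' / C5 + q ^ 2).
  assert (Pq2 : 0 < q ^ 2) by now apply pow_lt.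
  exists s. split; [unfold s; lra|]. intros p Hp.
  assert (Ps : 0 < s) by (unfold s; lra).
  assert (Ss := sqrt_lt_R0 s Ps).
  assert (Sq : q <= sqrt s).
  { rewrite <- (sqrt_pow2 q) by lra. apply sqrt_le_1_alt. unfold s. lra. }
  assert (Ht : 0 <= p / sqrt s) by (apply Rdiv_le_0_compat; auto).
  destruct (Hb _ Ht) as [_ [B1 [B2 _]]].
  destruct (Rle_dec p P) as [HpP|HpP].
  - destruct (Req_dec p 0) as [->|Hp0].
    { unfold Rdiv. rewrite Rmult_0_l, F0, w_0; lra. }
    assert (R := w0_ratio p P ltac:(lra)).
    eapply Rle_trans; [exact B1|].
    apply Rmult_le_reg_r with (P * sqrt s); [nra|].
    replace (K * (p / sqrt s) * (P * sqrt s)) with (K * P * p) by (field; lra).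
    assert (E : K * P = q * w 0 P) by (unfold q; field; lra). rewrite E.
    apply Rle_trans with (q * (w 0 p * P)); [nra|].
    assert (0 <= w 0 p * P) by (generalize (wpos 0 p ltac:(lra) ltac:(lra)); nra).
    nra.
  - destruct (bd0 p Hp) as [_ [_ T]].
    cut (G0 * exp (- C5 * p ^ 2) <= k * exp (- c' * (p / sqrt s) ^ 2)); [lra|].
    assert (E1 : - (C5 / 2) * p ^ 2 <= - c' * (p / sqrt s) ^ 2).
    { replace ((p / sqrt s) ^ 2) with (p ^ 2 / s).
      2:{ unfold Rdiv. rewrite Rpow_mult_distr, pow_inv, pow2_sqrt by lra. ring. }
      apply Rmult_le_reg_r with s; auto.
      replace (- c' * (p ^ 2 / s) * s) with (- (c' * p ^ 2)) by (field; lra).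
      assert (c' <= C5 / 2 * s).
      { unfold s. assert (C5 / 2 * (2 * c' / C5) = c') by (field; lra). nra. }
      generalize (pow2_ge_0 p). nra. }
    apply exp_le in E1.
    apply Rle_trans with (k * exp (- (C5 / 2) * p ^ 2)); [|apply Rmult_le_compat_l; lra].
    replace (- C5 * p ^ 2) with (- (C5 / 2) * p ^ 2 + - (C5 / 2 * p ^ 2)) by field.
    rewrite exp_plus, exp_Ropp.
    assert (X := exp_ineq1_le (C5 / 2 * p ^ 2)).
    set (e := exp (C5 / 2 * p ^ 2)) in *. set (g := exp (- (C5 / 2) * p ^ 2)).
    assert (Pg : 0 < g) by apply exp_pos. assert (Pe : 0 < e) by apply exp_pos.
    assert (Gk : G0 <= k * e).
    { assert (p <= p ^ 2) by nra.
      assert (Q : 2 * G0 / (k * C5) <= p ^ 2) by (unfold P in HpP; lra).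
      assert (Q2 : k * (C5 / 2) * (2 * G0 / (k * C5)) <= k * (C5 / 2) * p ^ 2)
        by (apply Rmult_le_compat_l; nra).
      replace (k * (C5 / 2) * (2 * G0 / (k * C5))) with G0 in Q2 by (field; lra). nra. }
    assert (Ge : G0 * / e <= k).
    { apply Rmult_le_reg_r with e; auto. rewrite Rmult_assoc, Rinv_l by lra. lra. }
    replace (G0 * (g * / e)) with (G0 * / e * g) by ring. apply Rmult_le_compat_r; lra.
Qed.

Lemma w_lower :
  exists s, 1 <= s /\ forall x p, 0 <= x -> 0 <= p -> F (p / sqrt (x + s)) <= w x p.
Proof.
  destruct initial_above_similarity as [s [Hs H0]]. exists s. split; auto.
  intros x p Hx Hp.
  destruct (sim_sol_spec F F1 F2 K c k c' 1 s HF ltac:(lra) ltac:(lra)) as [S1 [S2 [S3 [S4 S5]]]].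
  assert (E : forall x p, sim_sol F 1 s x p = F (p / sqrt (x + s))).
  { intros a b. unfold sim_sol. rewrite Rmult_1_l. ring. }
  rewrite <- E.
  apply (comparison_principle (sim_sol F 1 s) _ _ _ w wx wp wpp (x + 1) 1 ltac:(lra) ltac:(lra) S1 cw S2 sw); auto; try lra.
  - intros a b Ha Hb. split; [|apply w_nonneg; lra].
    replace (1 ^ 2) with (1 ^ 4) by ring. apply S3; lra.
  - intros a b Ha Hb _. destruct (S5 a b) as [Q1 Q2]; try lra. rewrite eqw by lra.
    split; [lra|split; [lra|auto]].
  - intros b Hb. rewrite E, Rplus_0_l. auto.
  - intros a Ha. rewrite S4, w_0; lra.
Qed.

Lemma initial_below_similarity (m : R) :
  1 < m -> exists s, 0 < s /\ forall p, 0 <= p -> w 0 p <= m ^ 4 * F (p / (m * sqrt s)).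
Proof.
  intros Hm. assert (HF' := HF). destruct HF' as [PK [Pc [Pk [Pc' [cF [F0 [Hd Hb]]]]]]].
  assert (Pm4 : 1 < m ^ 4) by (apply Rlt_pow_R1; [lra|lia]).
  set (d := 1 - / m ^ 4).
  assert (Hd0 : 0 < d).
  { unfold d. assert (/ m ^ 4 < 1) by (rewrite <- Rinv_1; apply Rinv_lt_contravar; lra). lra. }
  (* Chosen so that the profile has come within [d] of 1 at [e], which makes [m ^ 4 * F e] at least
     1. *)
  set (e := 1 + K / (c * d)).
  assert (Pe : 1 < e).
  { assert (0 < K / (c * d)) by (apply Rdiv_lt_0_compat; nra). unfold e. lra. }
  assert (Fe : 1 <= m ^ 4 * F e).
  { destruct (Hb e ltac:(lra)) as [_ [_ [_ B]]].
    assert (X := exp_ineq1_le (c * e ^ 2)).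
    assert (Ke : K <= d * exp (c * e ^ 2)).
    { assert (e <= e ^ 2) by nra.
      assert (Q : c * d * (K / (c * d)) <= c * d * e ^ 2).
      { apply Rmult_le_compat_l; [nra|]. unfold e in *. lra. }
      replace (c * d * (K / (c * d))) with K in Q by (field; lra). nra. }
    assert (Pexp := exp_pos (c * e ^ 2)).
    replace (- c * e ^ 2) with (- (c * e ^ 2)) in B by ring. rewrite exp_Ropp in B.
    assert (K * / exp (c * e ^ 2) <= d).
    { apply Rmult_le_reg_r with (exp (c * e ^ 2)); auto. rewrite Rmult_assoc, Rinv_l by lra. lra. }
    assert (/ m ^ 4 <= F e) by (unfold d in *; lra).
    assert (E1 : m ^ 4 * / m ^ 4 = 1) by (field; lra). rewrite <- E1.
    apply Rmult_le_compat_l; lra. }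
  (* With this scale the bound [D * p] on the datum equals [t / e]. Past [e] the profile already
     exceeds 1, and before [e] concavity places it above the line [t / e]. *)
  set (r := / (e * D * m)).
  assert (Pr : 0 < r) by (apply Rinv_0_lt_compat; repeat apply Rmult_lt_0_compat; lra).
  exists (r ^ 2). split; [now apply pow_lt|]. intros p Hp. rewrite sqrt_pow2 by lra.
  assert (Pmr : 0 < m * r) by nra.
  set (t := p / (m * r)). assert (Pt : 0 <= t) by (apply Rdiv_le_0_compat; auto).
  assert (Ep : p = t * (m * r)) by (unfold t; field; lra).
  destruct (bd0 p Hp) as [b1 [b2 _]].
  destruct (Rle_dec e t) as [Het|Het].
  - assert (N := vm_similarity_nondecreasing _ _ _ _ _ _ _ e t HF ltac:(lra)). nra.
  - destruct (Req_dec t 0) as [E0|E0].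
    { assert (p = 0) by (rewrite Ep, E0; ring). rewrite E0, F0. nra. }
    assert (Rt := vm_similarity_ratio _ _ _ _ _ _ _ t e HF ltac:(lra)).
    eapply Rle_trans; [exact b2|]. rewrite Ep.
    replace (D * (t * (m * r))) with (t / e) by (unfold r; field; lra).
    apply Rmult_le_reg_r with e; [lra|].
    replace (t / e * e) with t by (field; lra). nra.
Qed.

(* Letting the shift tend to 0 makes the similarity solution start from the
   constant 1, hence the maximal solution. *)
Lemma w_upper (x p : R) : 0 < x -> 0 <= p -> w x p <= F (p / sqrt x).
Proof.
  intros Hx Hp. assert (HF' := HF). destruct HF' as [PK [Pc [Pk [Pc' [cF [F0 [Hd Hb]]]]]]].
  assert (Sx := sqrt_lt_R0 x Hx).
  assert (Ht : 0 <= p / sqrt x) by (apply Rdiv_le_0_compat; auto).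
  assert (Hm : forall m, 1 < m -> w x p <= m ^ 4 * F (p / sqrt x)).
  { intros m Hm. destruct (initial_below_similarity m Hm) as [s [Ps H0]].
    destruct (sim_sol_spec F F1 F2 K c k c' m s HF ltac:(lra) Ps) as [S1 [S2 [S3 [S4 S5]]]].
    apply Rle_trans with (sim_sol F m s x p).
    - apply (comparison_principle w wx wp wpp (sim_sol F m s) _ _ _ (x + 1) 1 ltac:(lra) ltac:(lra) cw S1 sw S2); auto; try lra.
      + intros a b Ha Hb'. split; [rewrite pow1; apply w_le_1; lra|apply S3; lra].
      + intros a b Ha Hb' _. destruct (S5 a b) as [Q1 Q2]; try lra. rewrite eqw by lra.
        split; [lra|split; [lra|auto]].
      + intros b Hb'. unfold sim_sol. rewrite Rplus_0_l. auto.
      + intros a Ha. rewrite S4, w_0; lra.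
    (* Increasing the argument of [F] removes the shift, which depends on [m], so that [m] can tend
       to 1 afterwards. *)
    - unfold sim_sol. apply Rmult_le_compat_l; [apply pow_le; lra|].
      apply (vm_similarity_nondecreasing _ _ _ _ _ _ _ _ _ HF).
      assert (sqrt x <= sqrt (x + s)) by (apply sqrt_le_1_alt; lra).
      split; [apply Rdiv_le_0_compat; nra|]. unfold Rdiv. apply Rmult_le_compat_l; auto.
      apply Rinv_le_contravar; nra. }
  destruct (Hb _ Ht) as [[B0 B1] _].
  apply Rnot_lt_le. intros Hlt.
  (* Since [(1 + e)^4 <= 1 + 15 * e], this choice costs only half of the supposed gap. *)
  set (e := (w x p - F (p / sqrt x)) / 30).
  assert (w x p <= 1) by (apply w_le_1; lra).
  assert (Pe : 0 < e <= 1) by (unfold e; lra).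
  specialize (Hm (1 + e) ltac:(lra)).
  assert (E4 : (1 + e) ^ 4 <= 1 + 15 * e).
  { assert (e ^ 2 <= e) by nra. assert (e ^ 3 <= e) by nra. assert (e ^ 4 <= e) by nra. nra. }
  assert ((1 + e) ^ 4 * F (p / sqrt x) <= (1 + 15 * e) * F (p / sqrt x)) by (apply Rmult_le_compat_r; lra).
  assert (15 * e * F (p / sqrt x) <= 15 * e * 1) by (apply Rmult_le_compat_l; lra).
  unfold e in *. lra.
Qed.

(** * Monotonicity in [x] and concavity in [p] *)

Lemma w_lower_linear (X : R) :
  0 < X -> exists l, 0 < l /\ forall x p, 0 <= x <= X -> 0 < p -> l * Rmin p 1 <= w x p.
Proof.
  intros HX. destruct w_lower as [s [Hs H]].
  assert (HF' := HF). destruct HF' as [PK [Pc [Pk [Pc' [cF [F0 [Hd Hb]]]]]]].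
  set (q := sqrt (X + s)). assert (Pq : 0 < q) by (apply sqrt_lt_R0; lra).
  assert (Piq : 0 < 1 / q) by (apply Rdiv_lt_0_compat; lra).
  exists (F (1 / q)). split; [now apply Hd|].
  intros x p Hx Hp. eapply Rle_trans; [|apply H; lra].
  assert (Sx := sqrt_lt_R0 (x + s) ltac:(lra)).
  assert (Sq : sqrt (x + s) <= q) by (apply sqrt_le_1_alt; lra).
  assert (Ppq : 0 < p / q) by (apply Rdiv_lt_0_compat; lra).
  apply Rle_trans with (F (p / q)).
  - destruct (Rle_dec p 1) as [H1|H1].
    + rewrite Rmin_left by auto.
      assert (H2 : p / q <= 1 / q) by (unfold Rdiv; apply Rmult_le_compat_r; [left; now apply Rinv_0_lt_compat|auto]).
      assert (R := vm_similarity_ratio _ _ _ _ _ _ _ (p / q) (1 / q) HF ltac:(lra)).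
      apply Rmult_le_reg_r with (1 / q); auto.
      replace (F (1 / q) * p * (1 / q)) with (F (1 / q) * (p / q)) by (field; lra). exact R.
    + rewrite Rmin_right, Rmult_1_r by lra.
      apply (vm_similarity_nondecreasing _ _ _ _ _ _ _ _ _ HF). split; [lra|].
      unfold Rdiv. apply Rmult_le_compat_r; [left; now apply Rinv_0_lt_compat|lra].
  - apply (vm_similarity_nondecreasing _ _ _ _ _ _ _ _ _ HF). split; [lra|].
    unfold Rdiv. apply Rmult_le_compat_l; [lra|]. now apply Rinv_le_contravar.
Qed.

(* Before concavity is known, the zeroth order coefficient can be positive and
   as large as [1 / sqrt p] near the wall; the weight absorbs it because the
   diffusion [sqrt w] is at least of order [sqrt p] there. *)
Lemma w_decreasing_x (x h p : R) : 0 <= x -> 0 < h -> 0 <= p -> w (x + h) p <= w x p.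
Proof.
  intros Hx0 Hh Hp0. set (X := x + 1). assert (HX : 0 < X) by (unfold X; lra).
  destruct (w_lower_linear (X + h) ltac:(lra)) as [l [Pl Hl]].
  destruct (wppK X l HX Pl) as [K4 [PK4 HK4]].
  { intros a b Ha Hb. apply Hl; lra. }
  assert (Sl := sqrt_lt_R0 l Pl). assert (Sll : sqrt l * sqrt l = l) by (apply sqrt_sqrt; lra).
  (* Near the wall the weight is at most 3, so the zeroth order term is at most [Bc * t] with
     [t = / sqrt p], while the diffusion yields [sqrt l / 4 * t^2]. Completing the square costs
     [Bc ^ 2 / sqrt l], a term of [L]; the term [K4 / sqrt l] serves the region beyond 1. *)
  set (Bc := 3 * K4 / sqrt l).
  set (L := 2 + Bc ^ 2 / sqrt l + K4 / sqrt l + 1).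
  assert (PBc : 0 <= Bc ^ 2 / sqrt l) by (apply Rdiv_le_0_compat; auto; apply pow2_ge_0).
  assert (PKl : 0 < K4 / sqrt l) by (now apply Rdiv_lt_0_compat).
  apply Rminus_le.
  assert (E : forall x p, w (x + h) p = 1 * w (1 * x + h) (1 * p)).
  { intros a b. rewrite !Rmult_1_l. reflexivity. }
  rewrite E.
  assert (Q := max_principle _ _ _ _ X L 1 HX ltac:(unfold L; lra)
    (cont_quad_minus _ _ (cont_quad_scale w 1 1 h 1 cw ltac:(lra) ltac:(lra) ltac:(lra)) cw)
    (smooth_xpp_minus _ _ _ _ _ _ _ _
      (smooth_xpp_scale w wx wp wpp 1 1 h 1 sw ltac:(lra) ltac:(lra) ltac:(lra)) sw)).
  apply Q; auto; try (unfold X; lra); clear Q.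
  - intros a b Ha Hb. rewrite <- E. assert (w (a + h) b <= 1) by (apply w_le_1; lra).
    assert (0 <= w a b) by (apply w_nonneg; lra). lra.
  - intros b Hb. rewrite <- E, Rplus_0_l. assert (w h b <= w 0 b) by (apply w_le_initial; lra). lra.
  - intros a Ha. rewrite <- E, !w_0; lra.
  - intros a b Ha Hb. rewrite <- E. rewrite !Rmult_1_l, !Rmult_1_r. intros Hq.
    assert (Pw := wpos a b ltac:(lra) Hb).
    assert (PA : 0 < w (a + h) b) by (apply wpos; lra).
    set (sA := sqrt (w (a + h) b)). set (sZ := sqrt (w a b)).
    assert (PsA : 0 < sA) by (now apply sqrt_lt_R0). assert (PsZ : 0 < sZ) by (now apply sqrt_lt_R0).
    assert (EA : sA * sA = w (a + h) b) by (apply sqrt_sqrt; lra).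
    assert (EZ : sZ * sZ = w a b) by (apply sqrt_sqrt; lra).
    assert (sA1 : sA <= 1) by (apply sqrt_w_le_1; lra).
    assert (sAZ : sZ <= sA) by (apply sqrt_le_1_alt; lra).
    (* The term [(sA - sZ) * wpp] is at most [K4 * (sA - sZ)], and [sA - sZ] is at most the
       difference of the two values of [w] divided by [sZ]. *)
    exists sA, (K4 / sZ). split; [lra|]. split.
    + rewrite !eqw by lra. fold sA sZ.
      assert (HKp := HK4 a b Ha Hb).
      assert (T : (sA - sZ) * wpp a b <= K4 / sZ * (w (a + h) b - w a b)).
      { apply Rle_trans with ((sA - sZ) * K4); [apply Rmult_le_compat_l; lra|].
        apply Rmult_le_reg_r with sZ; auto.
        replace (K4 / sZ * (w (a + h) b - w a b) * sZ) with (K4 * (w (a + h) b - w a b)) by (field; lra).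
        rewrite <- EA, <- EZ.
        replace (K4 * (sA * sA - sZ * sZ)) with ((sA - sZ) * K4 * (sA + sZ)) by ring.
        apply Rmult_le_compat_l; [nra|lra]. }
      nra.
    + set (r := sqrt b). assert (Pr : 0 < r) by (now apply sqrt_lt_R0).
      assert (Er : r * r = b) by (apply sqrt_sqrt; lra).
      assert (HlA := Hl (a + h) b ltac:(unfold X in *; lra) Hb).
      assert (HlZ := Hl a b ltac:(unfold X in *; lra) Hb).
      assert (Wd : weight b = 1 + r + b ^ 2) by reflexivity.
      assert (PL : 0 <= L) by (unfold L; lra).
      assert (Pinv : 0 < / (4 * (b * r))) by (apply Rinv_0_lt_compat; nra).
      destruct (Rle_dec b 1) as [Hb1|Hb1].
      * rewrite Rmin_left in HlA, HlZ by auto.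
        assert (Slb : sqrt (l * b) = sqrt l * r) by (apply sqrt_mult; lra).
        assert (LA : sqrt l * r <= sA) by (rewrite <- Slb; now apply sqrt_le_1_alt).
        assert (LZ : sqrt l * r <= sZ) by (rewrite <- Slb; now apply sqrt_le_1_alt).
        assert (r1 : r <= 1) by nra.
        assert (W3 : weight b <= 3) by (rewrite Wd; nra).
        assert (W1 : 1 <= weight b) by (rewrite Wd; generalize (pow2_ge_0 b); lra).
        set (t := / r). assert (Pt : 0 < t) by now apply Rinv_0_lt_compat.
        assert (Plr : 0 < sqrt l * r) by nra.
        assert (T1 : K4 / sZ * weight b <= Bc * t).
        { apply Rle_trans with (K4 / (sqrt l * r) * 3).
          - assert (/ sZ <= / (sqrt l * r)) by now apply Rinv_le_contravar.
            assert (0 < / sZ) by now apply Rinv_0_lt_compat.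
            apply Rmult_le_compat; try lra; unfold Rdiv; nra.
          - right. unfold Bc, t. field. lra. }
        assert (T2 : sqrt l / 4 * t ^ 2 <= sA * / (4 * (b * r))).
        { apply Rle_trans with (sqrt l * r * / (4 * (b * r))); [|apply Rmult_le_compat_r; lra].
          right. unfold t. rewrite <- Er. field. lra. }
        assert (T3 : 0 <= sqrt l / 4 * t ^ 2 - Bc * t + Bc ^ 2 / sqrt l).
        { replace (sqrt l / 4 * t ^ 2 - Bc * t + Bc ^ 2 / sqrt l)
            with (sqrt l * (t / 2 - Bc / sqrt l) ^ 2) by (field; lra).
          apply Rmult_le_pos; [lra|apply pow2_ge_0]. }
        assert (T4 : L <= L * weight b) by nra.
        unfold L in *. nra.
      * rewrite Rmin_right, Rmult_1_r in HlZ by lra.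
        assert (LZ : sqrt l <= sZ) by now apply sqrt_le_1_alt.
        assert (W1 : 1 <= weight b) by (rewrite Wd; generalize (pow2_ge_0 b); lra).
        assert (T1 : K4 / sZ * weight b <= K4 / sqrt l * weight b).
        { apply Rmult_le_compat_r; [lra|]. unfold Rdiv. apply Rmult_le_compat_l; [lra|].
          now apply Rinv_le_contravar. }
        assert (T2 : sA * (2 - / (4 * (b * r))) <= 2) by nra.
        assert (T5 : 0 <= Bc ^ 2 / sqrt l * weight b) by (apply Rmult_le_pos; lra).
        unfold L. nra.
Qed.

Lemma wx_nonpos (x p : R) : 0 < x -> 0 < p -> wx x p <= 0.
Proof.
  intros Hx Hp.
  apply (derivative_le_of_right (fun s => w s p) (fun _ => w x p) x).
  - now apply sw.
  - apply @is_derive_const.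
  - reflexivity.
  - exists 1. split; [lra|]. intros t Ht. replace t with (x + (t - x)) by ring.
    apply w_decreasing_x; lra.
Qed.

Lemma wpp_nonpos (x p : R) : 0 < x -> 0 < p -> wpp x p <= 0.
Proof.
  intros Hx Hp. assert (N := wx_nonpos x p Hx Hp). rewrite eqw in N by auto.
  assert (S := sqrt_lt_R0 _ (wpos x p ltac:(lra) Hp)). apply Rnot_lt_le. intros H. nra.
Qed.

(** * Bounds on the [x] derivative from the scaling symmetries *)

Lemma w_scale (m x p : R) : 1 < m -> 0 <= x -> 0 <= p -> w x p <= w (m ^ 2 * x) (m * p).
Proof.
  intros Hm Hx Hp. assert (Pm : 0 < m ^ 2) by (apply pow_lt; lra).
  assert (E : forall a b, w (m ^ 2 * a) (m * b) = 1 * w (m ^ 2 * a + 0) (m * b)).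
  { intros a b. now rewrite Rplus_0_r, Rmult_1_l. }
  rewrite E.
  apply (comparison_principle w wx wp wpp (fun x p => 1 * w (m ^ 2 * x + 0) (m * p)) _ _ _ (x + 1) 1
    ltac:(lra) ltac:(lra) cw (cont_quad_scale w 1 (m ^ 2) 0 m cw ltac:(lra) ltac:(lra) ltac:(lra)) sw
    (smooth_xpp_scale w wx wp wpp 1 (m ^ 2) 0 m sw Pm ltac:(lra) ltac:(lra))); auto; try lra.
  - intros a b Ha Hb. rewrite <- E. split; [rewrite pow1; apply w_le_1; lra|]. apply w_nonneg; nra.
  - intros a b Ha Hb _. rewrite <- E. rewrite !Rplus_0_r, !Rmult_1_l.
    rewrite !eqw by nra. split; [lra|]. split; [right; ring|]. left. apply wpp_nonpos; lra.
  - intros b Hb. rewrite <- E, Rmult_0_r. apply w0_nondecreasing. nra.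
  - intros a Ha. rewrite <- E, Rmult_0_r, !w_0; nra.
Qed.

(** The derivative of the dilation inequality at the identity. Moving the dilation of [p] to the
    other side leaves one varying argument on each side, so partial derivatives suffice. *)
Lemma wx_ge_scaling (x p : R) : 0 < x -> 0 < p -> - (p * wp x p) <= 2 * x * wx x p.
Proof.
  intros Hx Hp. destruct (sw x p Hx Hp) as [D1 [D2 _]].
  apply (derivative_le_of_right (fun e => w x (p / (1 + e))) (fun e => w ((1 + e) ^ 2 * x) p) 0).
  - apply (is_derive_eq _ _ (wp x p * (- p))); [|ring].
    apply (is_derive_Rcomp (w x) (fun e => p / (1 + e))).
    + replace (p / (1 + 0)) with p by field. exact D2.
    + auto_derive; [lra|]. field.
  - apply (is_derive_eq _ _ (wx x p * (2 * x))); [|ring].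
    apply (is_derive_Rcomp (fun s => w s p) (fun e => (1 + e) ^ 2 * x)).
    + replace ((1 + 0) ^ 2 * x) with x by ring. exact D1.
    + auto_derive; [trivial|]. ring.
  - f_equal; field.
  - exists 1. split; [lra|]. intros t Ht. rewrite Rplus_0_l in Ht.
    assert (E : p = (1 + t) * (p / (1 + t))) by (field; lra).
    rewrite E at 2. apply w_scale; try lra. apply Rdiv_le_0_compat; lra.
Qed.

(** The damped datum is a subsolution: its diffusion term carries the extra factor
    [sqrt (exp (- kd * x)) <= 1], and at [x = 0] that term is at least [- kd] times the datum. *)
Lemma w_ge_exp_initial (x p : R) : 0 <= x -> 0 <= p -> exp (- kd * x) * w 0 p <= w x p.
Proof.
  intros Hx Hp.
  assert (De : forall a, is_derive (fun s => exp (- kd * s)) a (- kd * exp (- kd * a))).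
  { intros a. auto_derive; [trivial|]. ring. }
  apply (comparison_principle (fun x p => exp (- kd * x) * w 0 p) (fun x p => - kd * exp (- kd * x) * w 0 p)
    (fun x p => exp (- kd * x) * w1 p) (fun x p => exp (- kd * x) * w2 p) w wx wp wpp (x + 1) 1); auto; try lra.
  - apply cont_quad_mult; [|apply stationary_cont].
    apply (cont_quad_comp_1d (fun t => exp (- kd * t)) (fun x _ => x)); [|apply cont_quad_fst].
    intros a b _ _. apply (is_derive_continuity_pt _ _ _ (De a)).
  - intros a b Ha Hb. destruct (dw0 b Hb) as [E1 E2]. split; [|split].
    + eapply is_derive_eq; [exact (is_derive_Rmult _ _ _ _ _ (De a) (is_derive_const (V := R_NormedModule) (w 0 b) a))|].
      simpl. unfold zero; simpl. ring.
    + now apply is_derive_scal.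
    + now apply is_derive_scal.
  - intros a b Ha Hb. split; [|apply w_nonneg; lra].
    assert (B := proj1 (bd0 b Hb)). assert (B0 := w_nonneg 0 b ltac:(lra) Hb).
    assert (exp (- kd * a) <= 1) by (rewrite <- exp_0; apply exp_le; nra).
    assert (Pe := exp_pos (- kd * a)). nra.
  - intros a b Ha Hb _. rewrite eqw by lra. split; [|split; [lra|left]].
    + destruct (dat0 b Hb) as [B _].
      assert (Pe := exp_pos (- kd * a)).
      rewrite sqrt_mult by (try apply w_nonneg; lra).
      assert (Se : sqrt (exp (- kd * a)) <= 1).
      { rewrite <- sqrt_1. apply sqrt_le_1_alt. rewrite <- exp_0. apply exp_le. nra. }
      assert (Se0 := sqrt_pos (exp (- kd * a))).
      assert (N : 0 <= - (sqrt (w 0 b) * w2 b)).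
      { assert (S := sqrt_pos (w 0 b)). assert (Z := proj2 (sgn0 b Hb)). nra. }
      assert (sqrt (exp (- kd * a)) * - (sqrt (w 0 b) * w2 b) <= kd * w 0 b) by nra.
      assert (exp (- kd * a) * (sqrt (exp (- kd * a)) * - (sqrt (w 0 b) * w2 b))
        <= exp (- kd * a) * (kd * w 0 b)) by (apply Rmult_le_compat_l; lra).
      lra.
    + assert (Pe := exp_pos (- kd * a)). assert (Z := proj2 (sgn0 b Hb)). nra.
  - intros b Hb. rewrite Rmult_0_r, exp_0. lra.
  - intros a Ha. rewrite !w_0; lra.
Qed.

(** For a constant [m], the function [m ^ 2 * w (m * x) p] again solves the equation. The choice
    [m = exp (- (kd / 2) * h)] makes its initial value the damped datum, which lies below [w h p],
    so comparison starts from there. *)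
Lemma w_shift_ge (x h p : R) :
  0 <= x -> 0 < h -> 0 <= p ->
  exp (- kd * h) * w (exp (- (kd / 2) * h) * x) p <= w (x + h) p.
Proof.
  intros Hx Hh Hp. set (m := exp (- (kd / 2) * h)). assert (Pm : 0 < m) by apply exp_pos.
  assert (m1 : m <= 1) by (unfold m; rewrite <- exp_0; apply exp_le; nra).
  assert (Em : exp (- kd * h) = m ^ 2).
  { unfold m. replace (- kd * h) with (- (kd / 2) * h + - (kd / 2) * h) by field.
    rewrite exp_plus. ring. }
  rewrite Em.
  assert (E : forall a b, m ^ 2 * w (m * a) b = m ^ 2 * w (m * a + 0) (1 * b)).
  { intros a b. now rewrite Rplus_0_r, Rmult_1_l. }
  assert (E' : forall a b, w (a + h) b = 1 * w (1 * a + h) (1 * b)).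
  { intros a b. now rewrite !Rmult_1_l. }
  rewrite E, E'.
  apply (comparison_principle (fun x p => m ^ 2 * w (m * x + 0) (1 * p)) _ _ _
    (fun x p => 1 * w (1 * x + h) (1 * p)) _ _ _ (x + 1) 1 ltac:(lra) ltac:(lra)
    (cont_quad_scale w (m ^ 2) m 0 1 cw ltac:(lra) ltac:(lra) ltac:(lra))
    (cont_quad_scale w 1 1 h 1 cw ltac:(lra) ltac:(lra) ltac:(lra))
    (smooth_xpp_scale w wx wp wpp (m ^ 2) m 0 1 sw ltac:(lra) ltac:(lra) ltac:(lra))
    (smooth_xpp_scale w wx wp wpp 1 1 h 1 sw ltac:(lra) ltac:(lra) ltac:(lra))); auto; try lra.
  - intros a b Ha Hb. rewrite <- E, <- E'. split; [|apply w_nonneg; lra].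
    assert (B := w_le_1 (m * a) b ltac:(nra) Hb). assert (B0 := w_nonneg (m * a) b ltac:(nra) Hb).
    assert (m ^ 2 <= 1) by nra. assert (0 < m ^ 2) by nra. nra.
  - intros a b Ha Hb _. rewrite <- E, <- E'. rewrite !Rplus_0_r, !Rmult_1_l, !Rmult_1_r.
    assert (Pma : 0 < m * a) by nra. rewrite !eqw by lra.
    split; [|split; [lra|left]].
    + rewrite sqrt_mult by (try apply pow2_ge_0; apply w_nonneg; lra).
      rewrite sqrt_pow2 by lra. right. ring.
    + assert (N := wpp_nonpos (m * a) b Pma Hb). generalize (pow2_ge_0 m). nra.
  - intros b Hb. rewrite <- E, <- E', Rmult_0_r, Rplus_0_l, <- Em. apply w_ge_exp_initial; lra.
  - intros a Ha. rewrite <- E, <- E', !w_0; nra.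
Qed.

Lemma wx_ge_w (x p : R) : 0 < x -> 0 < p -> - (kd * w x p) <= (1 + kd / 2 * x) * wx x p.
Proof.
  intros Hx Hp. destruct (sw x p Hx Hp) as [D1 _].
  cut (- kd * w x p + wx x p * (- (kd / 2) * x) <= wx x p); [nra|].
  apply (derivative_le_of_right (fun h => exp (- kd * h) * w (exp (- (kd / 2) * h) * x) p)
    (fun h => w (x + h) p) 0).
  - eapply is_derive_eq;
      [apply (is_derive_Rmult (fun h => exp (- kd * h)) (fun h => w (exp (- (kd / 2) * h) * x) p) 0 (- kd))|].
    + auto_derive; [trivial|]. rewrite Rmult_0_r, exp_0. ring.
    + apply (is_derive_Rcomp (fun s => w s p) (fun h => exp (- (kd / 2) * h) * x)).
      * rewrite Rmult_0_r, exp_0, Rmult_1_l. exact D1.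
      * instantiate (1 := - (kd / 2) * x). auto_derive; [trivial|]. rewrite Rmult_0_r, exp_0. field.
    + simpl. rewrite !Rmult_0_r, exp_0, !Rmult_1_l. reflexivity.
  - apply (is_derive_eq _ _ (wx x p * 1)); [|ring].
    apply (is_derive_Rcomp (fun s => w s p) (fun h => x + h)).
    + rewrite Rplus_0_r. exact D1.
    + auto_derive; [trivial|ring].
  - rewrite !Rmult_0_r, exp_0, !Rmult_1_l, Rplus_0_r. reflexivity.
  - exists 1. split; [lra|]. intros t Ht. apply w_shift_ge; lra.
Qed.

(** * A Gaussian bound on the [x] derivative that is uniform down to [x = 0] *)

Section gaussian.

Variable g : R.
Hypotheses (Pg : 0 < g) (g4 : 4 * g <= 1) (gC : g <= C7).

(** The difference [w 0 p - w x p] starts at 0 and is driven by the source [- sqrt w * w2], itself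
    below [M0] times the Gaussian; the factor [x] in the barrier supplies exactly this source. *)
Lemma w_ge_initial_gauss (x p : R) :
  0 <= x -> 0 <= p -> w 0 p - w x p - M0 * x * gauss g x p <= 0.
Proof.
  intros Hx Hp.
  assert (Q := max_principle _ _ _ _ (x + 1) 3 1 ltac:(lra) ltac:(lra)
    (cont_quad_minus _ _ (cont_quad_minus _ _ stationary_cont cw)
      (cont_quad_mult _ _ (cont_quad_mult _ _ (cont_quad_const M0) cont_quad_fst) (cont_quad_gauss g)))
    (smooth_xpp_minus _ _ _ _ _ _ _ _ (smooth_xpp_minus _ _ _ _ _ _ _ _ stationary_smooth sw)
      (smooth_xpp_mult_x _ _ _ _ M0 (gauss_smooth g)))).
  apply Q; auto; try lra; clear Q.
  - intros a b Ha Hb. assert (0 < gauss g a b) by apply exp_pos.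
    assert (B := proj1 (bd0 b Hb)). assert (0 <= w a b) by (apply w_nonneg; lra).
    assert (0 <= M0 * a * gauss g a b) by (repeat apply Rmult_le_pos; lra). lra.
  - intros b Hb. rewrite Rmult_0_r, Rmult_0_l. lra.
  - intros a Ha. assert (0 < gauss g a 0) by apply exp_pos. rewrite !w_0 by lra.
    assert (0 <= M0 * a * gauss g a 0) by (repeat apply Rmult_le_pos; lra). lra.
  - intros a b Ha Hb _.
    assert (S0 := sqrt_pos (w a b)). assert (S1 := sqrt_w_le_1 a b ltac:(lra) ltac:(lra)).
    exists (sqrt (w a b)), 0. split; [auto|]. split; [|apply max_principle_step; auto].
    rewrite eqw by lra.
    assert (U := gauss_supersolution g (sqrt (w a b)) a b Pg g4 ltac:(lra) ltac:(lra)).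
    set (Epp := (4 * g ^ 2 * b ^ 2 / (a + 1) ^ 2 - 2 * g / (a + 1)) * gauss g a b) in *.
    set (Ex := g * b ^ 2 / (a + 1) ^ 2 * gauss g a b) in *.
    assert (T : - (sqrt (w a b) * w2 b) <= M0 * gauss g a b).
    { destruct (dat0 b Hb) as [_ B]. assert (G := gauss_le_initial g C7 a b ltac:(lra) ltac:(lra)).
      assert (Sw : sqrt (w a b) <= sqrt (w 0 b)) by (apply sqrt_le_1_alt, w_le_initial; lra).
      assert (N := proj2 (sgn0 b Hb)).
      assert (M0 * exp (- C7 * b ^ 2) <= M0 * gauss g a b) by (apply Rmult_le_compat_l; lra). nra. }
    assert (M0 * a * (sqrt (w a b) * Epp) <= M0 * a * Ex) by (apply Rmult_le_compat_l; nra).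
    lra.
Qed.

(** The bound on the loss over the first interval of length [h] propagates. Monotonicity and
    concavity give the quasilinear term the good sign, so the difference obeys a linear inequality
    with diffusion at most 1, for which the shifted Gaussian is a barrier. *)
Lemma w_shift_ge_gauss (x h p : R) :
  0 <= x -> 0 < h -> 0 <= p -> w x p - w (x + h) p - h * M0 * gauss g (x + h) p <= 0.
Proof.
  intros Hx Hh Hp.
  assert (E1 : forall a b, w (a + h) b = 1 * w (1 * a + h) (1 * b)).
  { intros a b. now rewrite !Rmult_1_l. }
  assert (E2 : forall a b, h * M0 * gauss g (a + h) b = h * M0 * gauss g (1 * a + h) (1 * b)).
  { intros a b. now rewrite !Rmult_1_l. }
  rewrite E1, E2.
  assert (Q := max_principle _ _ _ _ (x + 1) 3 1 ltac:(lra) ltac:(lra)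
    (cont_quad_minus _ _ (cont_quad_minus _ _ cw (cont_quad_scale w 1 1 h 1 cw ltac:(lra) ltac:(lra) ltac:(lra)))
      (cont_quad_scale (gauss g) (h * M0) 1 h 1 (cont_quad_gauss g) ltac:(lra) ltac:(lra) ltac:(lra)))
    (smooth_xpp_minus _ _ _ _ _ _ _ _
      (smooth_xpp_minus _ _ _ _ _ _ _ _ sw (smooth_xpp_scale w wx wp wpp 1 1 h 1 sw ltac:(lra) ltac:(lra) ltac:(lra)))
      (smooth_xpp_scale _ _ _ _ (h * M0) 1 h 1 (gauss_smooth g) ltac:(lra) ltac:(lra) ltac:(lra)))).
  apply Q; auto; try lra; clear Q.
  - intros a b Ha Hb. rewrite <- E1, <- E2. assert (0 < gauss g (a + h) b) by apply exp_pos.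
    assert (B := w_le_1 a b ltac:(lra) Hb). assert (0 <= w (a + h) b) by (apply w_nonneg; lra).
    assert (0 <= h * M0 * gauss g (a + h) b) by (repeat apply Rmult_le_pos; lra). lra.
  - intros b Hb. rewrite <- E1, <- E2, Rplus_0_l.
    assert (B := w_ge_initial_gauss h b ltac:(lra) Hb). lra.
  - intros a Ha. rewrite <- E1, <- E2. assert (0 < gauss g (a + h) 0) by apply exp_pos. rewrite !w_0 by lra.
    assert (0 <= h * M0 * gauss g (a + h) 0) by (repeat apply Rmult_le_pos; lra). lra.
  - intros a b Ha Hb _. rewrite !Rmult_1_l, !Rmult_1_r.
    assert (S0 := sqrt_pos (w (a + h) b)). assert (S1 := sqrt_w_le_1 (a + h) b ltac:(lra) ltac:(lra)).
    exists (sqrt (w (a + h) b)), 0. split; [auto|]. split; [|apply max_principle_step; auto].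
    rewrite !eqw by lra.
    assert (U := gauss_supersolution g (sqrt (w (a + h) b)) (a + h) b Pg g4 ltac:(lra) ltac:(lra)).
    set (Epp := (4 * g ^ 2 * b ^ 2 / (a + h + 1) ^ 2 - 2 * g / (a + h + 1)) * gauss g (a + h) b) in *.
    set (Ex := g * b ^ 2 / (a + h + 1) ^ 2 * gauss g (a + h) b) in *.
    assert (Sw : sqrt (w (a + h) b) <= sqrt (w a b)) by (apply sqrt_le_1_alt, w_decreasing_x; lra).
    assert (N := wpp_nonpos a b ltac:(lra) Hb).
    assert (T : (sqrt (w a b) - sqrt (w (a + h) b)) * wpp a b <= 0) by nra.
    assert (h * M0 * (sqrt (w (a + h) b) * Epp) <= h * M0 * Ex) by (apply Rmult_le_compat_l; nra).
    lra.
Qed.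

Lemma wx_ge_gauss (x p : R) : 0 < x -> 0 < p -> - (M0 * gauss g x p) <= wx x p.
Proof.
  intros Hx Hp. destruct (sw x p Hx Hp) as [D1 _].
  destruct (gauss_smooth g x p Hx Hp) as [G1 _].
  apply (derivative_le_of_right (fun t => w x p - (t - x) * M0 * gauss g t p) (fun t => w t p) x); auto.
  - eapply is_derive_eq; [apply is_derive_Rminus; [apply @is_derive_const|]|].
    + apply (is_derive_Rmult (fun t => (t - x) * M0) (fun t => gauss g t p) x M0); [|exact G1].
      auto_derive; [trivial|ring].
    + simpl. unfold zero; simpl. ring.
  - rewrite Rminus_diag, !Rmult_0_l. ring.
  - exists 1. split; [lra|]. intros t Ht.
    assert (B := w_shift_ge_gauss x (t - x) p ltac:(lra) ltac:(lra) ltac:(lra)).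
    replace (x + (t - x)) with t in B by ring. lra.
Qed.

End gaussian.

(** * Decay of the difference and of the derivatives *)

(** The tangent of the concave [F] at [t = p / sqrt b] reduces the difference to [t * F1 t], which
    has a Gaussian bound, times [sqrt (b / a) - 1], which is at most [(b - a) / a]. *)
Lemma similarity_difference (a b p : R) :
  0 < a <= b -> 0 <= p ->
  F (p / sqrt a) - F (p / sqrt b) <= K * ((b - a) / a) * exp (- c * (p / sqrt b) ^ 2).
Proof.
  intros Hab Hp. assert (HF' := HF). destruct HF' as [PK [Pc [_ [_ [cF [F0 [Hd _]]]]]]].
  assert (Sa := sqrt_lt_R0 a ltac:(lra)). assert (Sb := sqrt_lt_R0 b ltac:(lra)).
  assert (Sab : sqrt a <= sqrt b) by (apply sqrt_le_1_alt; lra).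
  assert (Ea : sqrt a * sqrt a = a) by (apply sqrt_sqrt; lra).
  assert (Eb : sqrt b * sqrt b = b) by (apply sqrt_sqrt; lra).
  assert (Pr : 0 <= (b - a) / a) by (apply Rdiv_le_0_compat; lra).
  destruct (Req_dec p 0) as [->|Hp0].
  { unfold Rdiv at 1 2. rewrite !Rmult_0_l, F0.
    assert (0 <= K * ((b - a) / a) * exp (- c * (0 / sqrt b) ^ 2)); [|lra].
    apply Rmult_le_pos; [nra|left; apply exp_pos]. }
  set (t := p / sqrt b). assert (Pt : 0 < t) by (apply Rdiv_lt_0_compat; lra).
  destruct (Hd t Pt) as [_ [_ [_ [P1 [_ [_ [_ [B _]]]]]]]].
  assert (T : F (p / sqrt a) <= F t + F1 t * (p / sqrt a - t)).
  { apply (concave_tangent F F1 F2); auto; try (intros; now apply Hd). apply Rdiv_le_0_compat; lra. }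
  assert (Ht : p / sqrt a - t = t * (sqrt b / sqrt a - 1)) by (unfold t; field; lra).
  assert (Hq : sqrt b / sqrt a - 1 <= (b - a) / a).
  { replace ((b - a) / a) with (b / a - 1) by (field; lra).
    assert (Q : sqrt b / sqrt a <= (sqrt b * sqrt b) / (sqrt a * sqrt a)).
    { apply Rmult_le_reg_r with (sqrt a * sqrt a); [nra|].
      replace (sqrt b / sqrt a * (sqrt a * sqrt a)) with (sqrt b * sqrt a) by (field; lra).
      replace (sqrt b * sqrt b / (sqrt a * sqrt a) * (sqrt a * sqrt a)) with (sqrt b * sqrt b) by (field; lra).
      apply Rmult_le_compat_l; lra. }
    rewrite Ea, Eb in Q. lra. }
  rewrite Ht in T.
  assert (H1 : t * F1 t * (sqrt b / sqrt a - 1) <= t * F1 t * ((b - a) / a)) by (apply Rmult_le_compat_l; nra).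
  assert (H2 : t * F1 t * ((b - a) / a) <= K * exp (- c * t ^ 2) * ((b - a) / a)) by (apply Rmult_le_compat_r; lra).
  lra.
Qed.

Lemma phi_estimate :
  exists C g, 0 < C /\ 0 < g /\ forall x p, 0 <= x -> 0 <= p ->
    Rabs (w x p - F (p / sqrt (x + 1))) <= C / sqrt (x + 1) * gauss g x p.
Proof.
  assert (HF' := HF). destruct HF' as [PK [Pc [_ [_ [cF [F0 [Hd Hb]]]]]]].
  destruct w_lower as [s [Hs Hlow]].
  exists (2 * K + K * s), (c / s).
  split; [nra|]. split; [apply Rdiv_lt_0_compat; lra|]. intros x p Hx Hp.
  assert (Sx : 1 <= sqrt (x + 1)) by (rewrite <- sqrt_1 at 1; apply sqrt_le_1_alt; lra).
  assert (Ex : sqrt (x + 1) * sqrt (x + 1) = x + 1) by (apply sqrt_sqrt; lra).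
  set (E := gauss (c / s) x p). assert (PE : 0 < E) by apply exp_pos.
  assert (Pcs : c / s <= c).
  { apply Rmult_le_reg_r with s; [lra|]. replace (c / s * s) with c by (field; lra). nra. }
  assert (EE : exp (- c * (p / sqrt (x + 1)) ^ 2) <= E).
  { eapply Rle_trans; [apply (gauss_shift c 1 x p); lra|].
    apply gauss_antitone; auto. replace (c / 1) with c by field. exact Pcs. }
  assert (ES : exp (- c * (p / sqrt (x + s)) ^ 2) <= E) by (now apply gauss_shift).
  assert (Pi : 0 < / sqrt (x + 1)) by (apply Rinv_0_lt_compat; lra).
  (* The bracketing solutions are translates by a bounded amount, so they differ by order
     [/ (x + 1)]; this is relaxed here to the required power. *)
  assert (Ei : / (x + 1) <= / sqrt (x + 1)) by (apply Rinv_le_contravar; nra).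
  assert (Ht : 0 <= p / sqrt (x + 1)) by (apply Rdiv_le_0_compat; lra).
  assert (KsE : 0 <= K * s * / sqrt (x + 1) * E) by (repeat apply Rmult_le_pos; lra).
  assert (KE : 0 <= 2 * K * / sqrt (x + 1) * E) by (repeat apply Rmult_le_pos; lra).
  replace ((2 * K + K * s) / sqrt (x + 1) * E)
    with (2 * K * / sqrt (x + 1) * E + K * s * / sqrt (x + 1) * E) by (unfold Rdiv; ring).
  apply Rabs_le. split.
  - assert (L := Hlow x p Hx Hp).
    assert (Df := similarity_difference (x + 1) (x + s) p ltac:(lra) Hp).
    assert (K * ((x + s - (x + 1)) / (x + 1)) * exp (- c * (p / sqrt (x + s)) ^ 2)
      <= K * s * / sqrt (x + 1) * E); [|lra].
    assert (Pix : 0 < / (x + 1)) by (apply Rinv_0_lt_compat; lra).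
    apply Rmult_le_compat; auto; [|left; apply exp_pos|].
    + apply Rmult_le_pos; [lra|]. apply Rdiv_le_0_compat; lra.
    + rewrite Rmult_assoc. apply Rmult_le_compat_l; [lra|]. unfold Rdiv. apply Rmult_le_compat; lra.
  - cut (w x p - F (p / sqrt (x + 1)) <= 2 * K * / sqrt (x + 1) * E); [lra|].
    (* Comparing the shifts [x] and [x + 1] costs a factor [/ x]; for small [x] the bound [w <= 1]
       and the tail of [1 - F] replace it. *)
    destruct (Rle_dec x 1) as [H1|H1].
    + assert (W := w_le_1 x p Hx Hp). destruct (Hb _ Ht) as [_ [_ [_ B]]].
      assert (S2 : sqrt (x + 1) <= 2) by nra.
      assert (1 <= 2 * / sqrt (x + 1)).
      { apply Rmult_le_reg_r with (sqrt (x + 1)); [lra|]. rewrite Rmult_assoc, Rinv_l by lra. lra. }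
      assert (K * exp (- c * (p / sqrt (x + 1)) ^ 2) <= K * E) by (apply Rmult_le_compat_l; lra).
      assert (1 * (K * E) <= 2 * / sqrt (x + 1) * (K * E)) by (apply Rmult_le_compat_r; nra). lra.
    + assert (U := w_upper x p ltac:(lra) Hp).
      assert (Df := similarity_difference x (x + 1) p ltac:(lra) Hp).
      assert (K * ((x + 1 - x) / x) * exp (- c * (p / sqrt (x + 1)) ^ 2)
        <= 2 * K * / sqrt (x + 1) * E); [|lra].
      assert (Q : (x + 1 - x) / x <= 2 * / sqrt (x + 1)).
      { apply Rle_trans with (2 * / (x + 1)); [|lra].
        apply Rmult_le_reg_r with (x * (x + 1)); [nra|].
        replace ((x + 1 - x) / x * (x * (x + 1))) with (x + 1) by (field; lra).
        replace (2 * / (x + 1) * (x * (x + 1))) with (2 * x) by (field; lra). lra. }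
      assert (Q0 : 0 <= (x + 1 - x) / x) by (apply Rdiv_le_0_compat; lra).
      replace (2 * K * / sqrt (x + 1) * E) with (K * (2 * / sqrt (x + 1)) * E) by ring.
      apply Rmult_le_compat; auto; [nra|left; apply exp_pos|]. apply Rmult_le_compat_l; lra.
Qed.

Lemma wx_estimate :
  exists C g, 0 < C /\ 0 < g <= C7 /\ forall x p, 0 < x -> 0 < p ->
    - wx x p <= C / (x + 1) * gauss g x p.
Proof.
  assert (HF' := HF). destruct HF' as [PK [Pc [_ [_ [cF [F0 [Hd Hb]]]]]]].
  destruct w_lower as [s [Hs Hlow]].
  set (g1 := Rmin (1 / 4) C7). assert (Pg1 : 0 < g1) by (apply Rmin_glb_lt; lra).
  assert (g1a : g1 <= 1 / 4) by apply Rmin_l. assert (g1b : g1 <= C7) by apply Rmin_r.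
  (* The tail of the profile is evaluated at [p / 2], which divides the rate by 4, and at shift [s],
     which divides it by [s]. *)
  set (g2 := c / 4 / s). assert (Pg2 : 0 < g2) by (repeat apply Rdiv_lt_0_compat; lra).
  set (g := Rmin g1 g2). assert (ga : g <= g1) by apply Rmin_l. assert (gb : g <= g2) by apply Rmin_r.
  assert (Pg : 0 < g) by (now apply Rmin_glb_lt).
  exists (2 * M0 + 2 * K), g. split; [lra|]. split; [lra|]. intros x p Hx Hp.
  set (E := gauss g x p). assert (PE : 0 < E) by apply exp_pos.
  assert (Pi : 0 < / (x + 1)) by (apply Rinv_0_lt_compat; lra).
  assert (Ei : / (x + 1) * (x + 1) = 1) by (field; lra).
  assert (KE : 0 <= 2 * K * / (x + 1) * E) by (repeat apply Rmult_le_pos; lra).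
  assert (ME : 0 <= 2 * M0 * / (x + 1) * E) by (repeat apply Rmult_le_pos; lra).
  replace ((2 * M0 + 2 * K) / (x + 1) * E)
    with (2 * M0 * / (x + 1) * E + 2 * K * / (x + 1) * E) by (unfold Rdiv; ring).
  destruct (Rle_dec x 1) as [H1|H1].
  - assert (B := wx_ge_gauss g1 Pg1 ltac:(lra) g1b x p Hx Hp).
    assert (G := gauss_antitone g g1 x p ltac:(lra) ga). fold E in G.
    assert (M0 * gauss g1 x p <= M0 * E) by (apply Rmult_le_compat_l; lra).
    assert (1 <= 2 * / (x + 1)) by nra.
    assert (1 * (M0 * E) <= 2 * / (x + 1) * (M0 * E)) by (apply Rmult_le_compat_r; nra). lra.
  - assert (B := wx_ge_scaling x p Hx Hp).
    assert (T : w x (p / 2) <= w x p + wp x p * (p / 2 - p)).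
    { apply (concave_tangent (w x) (wp x) (wpp x)); try lra.
      - apply cont_quad_row; auto; lra.
      - intros y Hy. now apply sw.
      - intros y Hy. now apply sw.
      - intros y Hy. now apply wpp_nonpos. }
    assert (W := w_le_1 x p ltac:(lra) ltac:(lra)).
    assert (L := Hlow x (p / 2) ltac:(lra) ltac:(lra)).
    assert (Ss := sqrt_lt_R0 (x + s) ltac:(lra)).
    destruct (Hb (p / 2 / sqrt (x + s)) ltac:(apply Rdiv_le_0_compat; lra)) as [_ [_ [_ U]]].
    assert (G : exp (- c * (p / 2 / sqrt (x + s)) ^ 2) <= E).
    { replace (- c * (p / 2 / sqrt (x + s)) ^ 2) with (- (c / 4) * (p / sqrt (x + s)) ^ 2) by (field; lra).
      eapply Rle_trans; [apply gauss_shift; lra|]. fold g2. apply gauss_antitone; lra. }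
    assert (K * exp (- c * (p / 2 / sqrt (x + s)) ^ 2) <= K * E) by (apply Rmult_le_compat_l; lra).
    assert (Q : x * - wx x p <= K * E) by lra.
    assert (PKE : 0 < K * E) by nra.
    assert (R : - wx x p * (x + 1) <= 2 * (K * E)).
    { assert (N := wx_nonpos x p Hx Hp). nra. }
    assert (- wx x p * (x + 1) * / (x + 1) <= 2 * (K * E) * / (x + 1)) by (apply Rmult_le_compat_r; lra).
    rewrite Rmult_assoc, (Rmult_comm (x + 1)), Ei in H0. lra.
Qed.

(* The two bounds on [w_x = sqrt w * w_pp], one by [w] and one by a Gaussian,
   are multiplied, so that the degenerate factor [w] cancels. *)
Lemma second_derivative_estimate :
  exists C g, 0 < C /\ 0 < g /\
    (forall x p, 0 < x -> 0 < p ->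
       Rabs (wx x p) <= C / (x + 1) * gauss g x p /\
       Rabs (wpp x p) <= C / (x + 1) * gauss g x p) /\
    (forall p, 0 < p -> Rabs (w2 p) <= C * gauss g 0 p).
Proof.
  destruct wx_estimate as [C2 [g [PC2 [Pg H]]]].
  (* [C3] replaces [kd / (1 + kd / 2 * x)] by [C3 / (x + 1)]. The rate is halved because a square
     root is taken of a product with one Gaussian factor; the square roots of [C2 * C3] and
     [kd * M0] are bounded by sums. *)
  set (C3 := kd + 2). exists (C2 + C3 + kd + M0), (g / 2).
  assert (PC3 : 0 < C3) by (unfold C3; lra). split; [lra|]. split; [lra|]. split.
  - intros x p Hx Hp. assert (B := H x p Hx Hp). assert (N := wx_nonpos x p Hx Hp).
    set (E := gauss (g / 2) x p). assert (PE : 0 < E) by apply exp_pos.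
    assert (GE : gauss g x p <= E) by (apply gauss_antitone; lra).
    assert (PG : 0 < gauss g x p) by apply exp_pos.
    assert (Pi : 0 < / (x + 1)) by (apply Rinv_0_lt_compat; lra).
    split.
    + apply (weaken_bound _ C2 _ _ (gauss g x p)); try lra. now rewrite Rabs_left1 by lra.
    + apply (weaken_bound _ (C2 + C3) _ _ E); try lra.
      assert (N2 := wpp_nonpos x p Hx Hp). rewrite Rabs_left1 by lra.
      apply le_of_sq_le.
      { apply Rmult_le_pos; [apply Rdiv_le_0_compat; lra|lra]. }
      assert (Pw := wpos x p ltac:(lra) Hp).
      assert (Ew : sqrt (w x p) * sqrt (w x p) = w x p) by (apply sqrt_sqrt; lra).
      assert (Q := eqw x p Hx Hp).
      assert (A1 : - wx x p <= C3 / (x + 1) * w x p).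
      { assert (B1 := wx_ge_w x p Hx Hp).
        assert (Pk2 : 0 < 1 + kd / 2 * x) by nra.
        apply Rmult_le_reg_l with ((1 + kd / 2 * x) * (x + 1)); [nra|].
        replace ((1 + kd / 2 * x) * (x + 1) * (C3 / (x + 1) * w x p))
          with ((1 + kd / 2 * x) * C3 * w x p) by (field; lra).
        assert (B2 : (x + 1) * ((1 + kd / 2 * x) * - wx x p) <= (x + 1) * (kd * w x p)) by (apply Rmult_le_compat_l; lra).
        assert (kd * (x + 1) <= (1 + kd / 2 * x) * C3) by (unfold C3; nra).
        assert (kd * (x + 1) * w x p <= (1 + kd / 2 * x) * C3 * w x p) by (apply Rmult_le_compat_r; lra).
        lra. }
      assert (A2 : (- wx x p) * (- wx x p) <= C3 / (x + 1) * w x p * (C2 / (x + 1) * gauss g x p)).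
      { apply Rmult_le_compat; lra. }
      rewrite (gauss_half g x p) in A2 by lra. fold E in A2.
      apply Rmult_le_reg_r with (w x p); auto.
      replace ((- wpp x p) ^ 2 * w x p) with (- wx x p * - wx x p) 
        by (transitivity (sqrt (w x p) * sqrt (w x p) * wpp x p ^ 2); [rewrite Q; ring|rewrite Ew; ring]).
      eapply Rle_trans; [exact A2|].
      replace (C3 / (x + 1) * w x p * (C2 / (x + 1) * E ^ 2))
        with (C2 * C3 * (/ (x + 1) * E) ^ 2 * w x p) by (unfold Rdiv; ring).
      replace (((C2 + C3) / (x + 1) * E) ^ 2 * w x p)
        with ((C2 + C3) ^ 2 * (/ (x + 1) * E) ^ 2 * w x p) by (unfold Rdiv; ring).
      apply Rmult_le_compat_r; [lra|]. apply Rmult_le_compat_r; [apply pow2_ge_0|]. nra.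
  (* On the initial line the same product is formed from the two bounds on the datum, which play the
     role of the two bounds on [wx]. *)
  - intros p Hp. destruct (dat0 p Hp) as [A1 A2]. destruct (sgn0 p Hp) as [_ N].
    assert (Pw := wpos 0 p ltac:(lra) Hp). assert (S := sqrt_lt_R0 _ Pw).
    assert (Ew : sqrt (w 0 p) * sqrt (w 0 p) = w 0 p) by (apply sqrt_sqrt; lra).
    set (E := gauss (g / 2) 0 p). assert (PE : 0 < E) by apply exp_pos.
    rewrite Rabs_left1 by lra. apply le_of_sq_le; [nra|].
    assert (GE : exp (- C7 * p ^ 2) <= E ^ 2).
    { unfold E. rewrite <- gauss_half by lra. apply gauss_le_initial; lra. }
    set (v := - (sqrt (w 0 p) * w2 p)) in *. assert (Pv : 0 <= v) by (unfold v; nra).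
    assert (A3 : M0 * exp (- C7 * p ^ 2) <= M0 * E ^ 2) by (apply Rmult_le_compat_l; lra).
    assert (A4 : v * v <= kd * w 0 p * (M0 * E ^ 2)) by (apply Rmult_le_compat; lra).
    apply Rmult_le_reg_r with (w 0 p); auto.
    replace ((- w2 p) ^ 2 * w 0 p) with (v * v) 
      by (transitivity (sqrt (w 0 p) * sqrt (w 0 p) * w2 p ^ 2); [unfold v; ring|rewrite Ew; ring]).
    eapply Rle_trans; [exact A4|].
    replace (kd * w 0 p * (M0 * E ^ 2)) with (kd * M0 * E ^ 2 * w 0 p) by ring.
    apply Rmult_le_compat_r; [lra|]. rewrite Rpow_mult_distr.
    apply Rmult_le_compat_r; [apply pow2_ge_0|]. nra.
Qed.

End flow.

(** * Interpolation and conclusion *)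

(** A difference quotient over [[p, p + r]] gives the slope at some intermediate point, and the
    second derivative transports it back to [p]. Stepping only to the right stays off the wall and
    lets the decreasing envelope be evaluated at [p]. *)
Lemma interpolation (h h1 h2 E : R -> R) (A B r p : R) :
  0 < p -> 0 < r -> 0 <= A -> 0 <= B ->
  (forall t, 0 < t -> is_derive h t (h1 t)) -> (forall t, 0 < t -> is_derive h1 t (h2 t)) ->
  (forall t, 0 < t -> Rabs (h t) <= A * E t) -> (forall t, 0 < t -> Rabs (h2 t) <= B * E t) ->
  (forall t, p <= t -> E t <= E p) ->
  Rabs (h1 p) <= (2 * A / r + B * r) * E p.
Proof.
  intros Hp Hr HA HB D1 D2 B0 B2 HE.
  destruct (MVT_cor2 h h1 p (p + r)) as [a [Ea Pa]]; [lra| |].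
  { intros t Ht. apply is_derive_Reals, D1. lra. }
  destruct (MVT_cor2 h1 h2 p a) as [b [Eb Pb]]; [lra| |].
  { intros t Ht. apply is_derive_Reals, D2. lra. }
  assert (U1 := B0 (p + r) ltac:(lra)). assert (U2 := B0 p Hp). assert (U3 := B2 b ltac:(lra)).
  assert (E1 := HE (p + r) ltac:(lra)). assert (E2 := HE b ltac:(lra)).
  assert (V1 : A * E (p + r) <= A * E p) by (apply Rmult_le_compat_l; auto).
  assert (V2 : B * E b <= B * E p) by (apply Rmult_le_compat_l; auto).
  replace (p + r - p) with r in Ea by ring.
  assert (Ha : h1 a = (h (p + r) - h p) / r) by (rewrite Ea; field; lra).
  assert (Wa : Rabs (h1 a) <= 2 * A / r * E p).
  { rewrite Ha. unfold Rdiv. rewrite Rabs_mult, Rabs_inv, (Rabs_right r) by lra.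
    assert (Pi : 0 < / r) by now apply Rinv_0_lt_compat.
    replace (2 * A * / r * E p) with (2 * (A * E p) * / r) by ring.
    apply Rmult_le_compat_r; [lra|].
    replace (h (p + r) - h p) with (h (p + r) + - h p) by ring.
    eapply Rle_trans; [apply Rabs_triang|]. rewrite Rabs_Ropp. lra. }
  assert (Wb : Rabs (h2 b * (a - p)) <= B * r * E p).
  { rewrite Rabs_mult, (Rabs_right (a - p)) by lra.
    replace (B * r * E p) with (B * E p * r) by ring.
    apply Rmult_le_compat; try lra. apply Rabs_pos. }
  replace (h1 p) with (h1 a + - (h2 b * (a - p))) by lra.
  eapply Rle_trans; [apply Rabs_triang|]. rewrite Rabs_Ropp. lra.
Qed.

Lemma quarter_power (y : R) :
  0 < y -> exists r, 0 < r /\ sqrt y = r ^ 2 /\ y = r ^ 4 /\ Rpower y (3 / 4) = r ^ 3.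
Proof.
  intros Hy. exists (Rpower y (1 / 4)).
  assert (Pr : 0 < Rpower y (1 / 4)) by apply exp_pos.
  assert (Q : forall n, Rpower y (1 / 4) ^ n = Rpower y (1 / 4 * INR n)).
  { intros n. rewrite <- Rpower_pow by auto. apply Rpower_mult. }
  rewrite !Q. split; [auto|]. split; [|split].
  - rewrite <- Rpower_sqrt by auto. f_equal. simpl. field.
  - rewrite <- (Rpower_1 y) at 1 by auto. f_equal. simpl. field.
  - f_equal. simpl. field.
Qed.

Lemma blasius_bounds (F F1 F2 : R -> R) (K c k c' x p : R) :
  vm_similarity F F1 F2 K c k c' -> 0 <= x -> 0 < p ->
  Rabs (sim_sol_x F1 1 1 x p) <= K / (x + 1) * gauss c x p /\
  Rabs (sim_sol_pp F2 1 1 x p) <= K / (x + 1) * gauss c x p.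
Proof.
  intros [PK [Pc [_ [_ [_ [_ [Hd _]]]]]]] Hx Hp.
  assert (S := sqrt_lt_R0 (x + 1) ltac:(lra)).
  assert (Es : sqrt (x + 1) * sqrt (x + 1) = x + 1) by (apply sqrt_sqrt; lra).
  assert (Pi : 0 < / (x + 1)) by (apply Rinv_0_lt_compat; lra).
  assert (Ei : / sqrt (x + 1) * / sqrt (x + 1) = / (x + 1)) by (rewrite <- Rinv_mult, Es; reflexivity).
  unfold sim_sol_x, sim_sol_pp. rewrite !Rmult_1_l, !pow1, !Rmult_1_l.
  set (t := p / sqrt (x + 1)). assert (Pt : 0 < t) by (now apply Rdiv_lt_0_compat).
  destruct (Hd t Pt) as [_ [_ [_ [P1 [N2 [_ [_ [B1 B2]]]]]]]].
  assert (Et : exp (- c * t ^ 2) = gauss c x p).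
  { unfold gauss. f_equal. unfold t, Rdiv. rewrite Rpow_mult_distr, pow_inv, pow2_sqrt by lra. ring. }
  rewrite Et in B1, B2. split.
  - replace (F1 t * (- t / (2 * (x + 1)))) with (- (t * F1 t * / (x + 1) / 2)) by (field; lra).
    assert (0 <= t * F1 t) by (apply Rmult_le_pos; lra).
    assert (0 <= t * F1 t * / (x + 1)) by (apply Rmult_le_pos; lra).
    rewrite Rabs_Ropp, Rabs_right by lra.
    assert (t * F1 t * / (x + 1) <= K * gauss c x p * / (x + 1)) by (apply Rmult_le_compat_r; lra).
    unfold Rdiv at 2. lra.
  - rewrite Rmult_assoc, Ei. rewrite Rabs_left1 by nra.
    assert (- F2 t * / (x + 1) <= K * gauss c x p * / (x + 1)) by (apply Rmult_le_compat_r; lra).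
    unfold Rdiv. lra.
Qed.

Lemma Rabs_minus_bound (a b A B d E : R) :
  Rabs a <= A / d * E -> Rabs b <= B / d * E -> Rabs (a - b) <= (A + B) / d * E.
Proof.
  intros Ha Hb. replace (a - b) with (a + - b) by ring.
  eapply Rle_trans; [apply Rabs_triang|]. rewrite Rabs_Ropp. unfold Rdiv in *. lra.
Qed.

Theorem theorem1p7
  (u0 d1 d2 f f1 f2 : R -> R) (C1 C4 C5 C6 C7 : R)
  (u v w wb : R -> R -> R) :
  blasius f f1 f2 -> 0 < C1 -> blasius_rate f2 C1 ->
  oleinik_datum u0 d1 d2 ->
  0 < C4 -> 0 < C5 -> 0 < C6 -> 0 < C7 -> C1 < C5 -> C1 < C7 ->
  (forall y, 0 <= y -> Rabs (u0 y - 1) <= C4 * exp (- C5 * y ^ 2)) ->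
  (forall y, 0 <= y ->
     - C6 * exp (- C7 * y ^ 2) <= d2 y /\ d2 y <= 0) ->
  oleinik_solution u0 u v ->
  von_mises u w ->
  blasius_vm f f1 wb ->
  exists C c : R, 0 < C /\ 0 < c /\
  exists phix phip phipp : R -> R -> R,
    (forall x p, 0 <= x -> 0 <= p ->
       Rabs (w x p - wb x p)
         <= C / sqrt (x + 1) * exp (- c * p ^ 2 / (x + 1))) /\
    (forall x p, 0 <= x -> 0 < p ->
       is_derive (fun s => w x s - wb x s) p (phip x p) /\
       is_derive (fun s => phip x s) p (phipp x p) /\
       Rabs (phipp x p) <= C / (x + 1) * exp (- c * p ^ 2 / (x + 1)) /\
       Rabs (phip x p)
         <= C / Rpower (x + 1) (3 / 4) * exp (- c * p ^ 2 / (x + 1))) /\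
    (forall x p, 0 < x -> 0 <= p ->
       is_derive (fun s => w s p - wb s p) x (phix x p) /\
       Rabs (phix x p) <= C / (x + 1) * exp (- c * p ^ 2 / (x + 1))).
Proof.
  intros Hbl PC1 Hrate Hdat P4 P5 P6 P7 _ _ Hg Hc Hsol Hvm Hbvm.
  destruct (blasius_similarity f f1 f2 C1 Hbl PC1 Hrate) as [F [F1 [F2 [K [c [k [c' [HF HFwb]]]]]]]].
  specialize (HFwb wb Hbvm).
  destruct (vm_regularity u0 u v w Hsol Hvm) as [wx [wp [wpp [cw [sw [eqw [w_0 [wpos [wbd wppK]]]]]]]]].
  assert (Hcu : cont_on_quad u /\ (forall y, 0 <= y -> u 0 y = u0 y)).
  { destruct Hsol as [? [? [? [? [_ [_ [Hu0 [_ [_ [_ [cu _]]]]]]]]]]]. auto. }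
  destruct Hcu as [cu Hu0].
  destruct (vm_datum u0 d1 d2 C4 C5 C6 C7 u w Hdat P4 P5 P6 P7 Hg Hc cu Hu0 Hvm)
    as [w1 [w2 [kd [D [Pkd [PD [dw0 [sgn0 [bd0 dat0]]]]]]]]].
  assert (P4' : 0 < 2 * C4) by lra. assert (P6' : 0 < 2 * C6) by lra.
  destruct (phi_estimate w wx wp wpp cw sw eqw w_0 wpos wbd w1 w2 D _ C5 PD P4' P5 dw0 sgn0 bd0
    F F1 F2 K c k c' HF) as [Ca [ga [PCa [Pga Ha]]]].
  destruct (second_derivative_estimate w wx wp wpp cw sw eqw w_0 wpos wbd wppK w1 w2 kd D _ C5 _ C7
    Pkd P4' P5 P6' P7 dw0 sgn0 bd0 dat0 F F1 F2 K c k c' HF) as [Cb [gb [PCb [Pgb [Hb Hb0]]]]].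
  assert (PK : 0 < K) by apply HF. assert (Pc : 0 < c) by apply HF.
  set (g := Rmin c (Rmin ga gb)).
  assert (gc : g <= c) by apply Rmin_l.
  assert (gga : g <= ga) by (eapply Rle_trans; [apply Rmin_r|apply Rmin_l]).
  assert (ggb : g <= gb) by (eapply Rle_trans; [apply Rmin_r|apply Rmin_r]).
  assert (Pg : 0 < g) by (repeat apply Rmin_glb_lt; auto).
  set (B := Ca + Cb + K). assert (PB : 0 < B) by (unfold B; lra).
  assert (Hwbs : forall x p, 0 <= x -> 0 <= p -> wb x p = sim_sol F 1 1 x p).
  { intros x p Hx Hp. rewrite HFwb by auto. unfold sim_sol. rewrite Rmult_1_l. ring. }
  (* The interior derivatives [wp] and [wpp] are controlled only for [x > 0]; on the initial line
     those of the datum take their place. *)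
  set (W1 := fun x p => if Req_EM_T x 0 then w1 p else wp x p).
  set (W2 := fun x p => if Req_EM_T x 0 then w2 p else wpp x p).
  assert (HW : forall x p, 0 <= x -> 0 < p ->
    is_derive (w x) p (W1 x p) /\ is_derive (W1 x) p (W2 x p) /\
    Rabs (W2 x p) <= Cb / (x + 1) * gauss gb x p).
  { intros x p Hx Hp. unfold W1, W2. destruct (Req_EM_T x 0) as [->|Hn].
    - destruct (dw0 p Hp) as [E1 E2]. split; [|split]; auto.
      replace (Cb / (0 + 1)) with Cb by field. auto.
    - destruct (sw x p ltac:(lra) Hp) as [_ [E1 E2]]. split; [|split]; auto. apply Hb; lra. }
  set (phip := fun x p => W1 x p - sim_sol_p F1 1 1 x p).
  set (phipp := fun x p => W2 x p - sim_sol_pp F2 1 1 x p).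
  (* Both solutions vanish along the wall, so their difference has [x] derivative 0 there. *)
  set (phix := fun x p => if Req_EM_T p 0 then 0 else wx x p - sim_sol_x F1 1 1 x p).
  assert (PG : forall h x p, 0 < gauss h x p) by (intros; apply exp_pos).
  assert (Hphi0 : forall x p, 0 <= x -> 0 <= p ->
    Rabs (w x p - wb x p) <= B / sqrt (x + 1) * gauss g x p).
  { intros x p Hx Hp. rewrite HFwb by auto.
    apply (weaken_bound _ Ca _ _ (gauss ga x p)); auto.
    - apply sqrt_lt_R0. lra.
    - unfold B. lra.
    - split; [left; apply PG|]. now apply gauss_antitone. }
  assert (Hder : forall x p, 0 <= x -> 0 < p ->
    is_derive (fun s => w x s - wb x s) p (phip x p) /\ is_derive (phip x) p (phipp x p) /\
    Rabs (phipp x p) <= B / (x + 1) * gauss g x p).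
  { intros x p Hx Hp. destruct (HW x p Hx Hp) as [E1 [E2 E3]].
    destruct (sim_sol_p_derivatives F F1 F2 K c k c' 1 1 x p HF ltac:(lra) ltac:(lra) Hp) as [G1 G2].
    destruct (blasius_bounds F F1 F2 K c k c' x p HF Hx Hp) as [_ G3].
    split; [|split].
    - apply is_derive_Rminus; auto. apply (is_derive_ext_pos (sim_sol F 1 1 x)); auto.
      intros t Ht. symmetry. apply Hwbs; lra.
    - now apply is_derive_Rminus.
    - unfold phipp. apply (weaken_bound _ (Cb + K) _ _ (gauss g x p)); try (unfold B; lra);
        [|split; [left; apply PG|lra]].
      apply Rabs_minus_bound.
      + apply (weaken_bound _ Cb _ _ (gauss gb x p)); try lra.
        split; [left; apply PG|]. now apply gauss_antitone.
      + apply (weaken_bound _ K _ _ (gauss c x p)); try lra.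
        split; [left; apply PG|]. now apply gauss_antitone. }
  assert (PB3 : B <= 3 * B) by lra.
  exists (3 * B), g. split; [lra|]. split; [auto|]. exists phix, phip, phipp.
  split; [|split].
  - intros x p Hx Hp. apply (weaken_bound _ B _ _ (gauss g x p)); auto; try lra.
    + apply sqrt_lt_R0. lra.
    + split; [left; apply PG|apply Rle_refl].
  - intros x p Hx Hp. destruct (Hder x p Hx Hp) as [E1 [E2 E3]].
    split; [exact E1|]. split; [exact E2|]. split.
    + apply (weaken_bound _ B _ _ (gauss g x p)); auto; try lra.
      split; [left; apply PG|apply Rle_refl].
    (* The step [r = (x + 1)^(1/4)] balances the two terms of the interpolation: with bounds
       [B / r^2] and [B / r^4] they become [2 * B / r^3] and [B / r^3], whence the constant
       [3 * B]. *)
    + destruct (quarter_power (x + 1) ltac:(lra)) as [r [Pr [Q2 [Q4 Q3]]]].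
      rewrite Q3. fold (gauss g x p).
      replace (3 * B / r ^ 3) with (2 * (B / sqrt (x + 1)) / r + B / (x + 1) * r).
      2:{ rewrite Q2. set (y := x + 1) in *. rewrite Q4. field. lra. }
      assert (Pr2 : 0 < sqrt (x + 1)) by (apply sqrt_lt_R0; lra).
      apply (interpolation (fun s => w x s - wb x s) (phip x) (phipp x) (gauss g x)); auto.
      * left. now apply Rdiv_lt_0_compat.
      * left. apply Rdiv_lt_0_compat; lra.
      * intros t Ht. now apply Hder.
      * intros t Ht. now apply Hder.
      * intros t Ht. apply Hphi0; lra.
      * intros t Ht. now apply Hder.
      * intros t Ht. unfold gauss. apply exp_le.
        assert (p ^ 2 <= t ^ 2) by (apply pow_incr; lra).
        assert (Pi : 0 < / (x + 1)) by (apply Rinv_0_lt_compat; lra).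
        unfold Rdiv. apply Rmult_le_compat_r; [lra|]. nra.
  - intros x p Hx Hp. unfold phix. destruct (Req_EM_T p 0) as [->|Hn].
    + split.
      * apply (is_derive_ext_pos (fun _ => 0)); auto; [|apply @is_derive_const].
        intros t Ht. rewrite w_0, HFwb by lra. unfold Rdiv. rewrite Rmult_0_l.
        rewrite (proj1 (proj2 (proj2 (proj2 (proj2 (proj2 HF)))))). ring.
      * rewrite Rabs_R0. apply Rmult_le_pos; [apply Rdiv_le_0_compat; lra|left; apply exp_pos].
    + assert (Pp : 0 < p) by lra. destruct (sw x p Hx Pp) as [E1 _].
      destruct (Hb x p Hx Pp) as [E2 _].
      destruct (blasius_bounds F F1 F2 K c k c' x p HF ltac:(lra) Pp) as [G3 _].
      split.
      * apply is_derive_Rminus; auto. apply (is_derive_ext_pos (fun x => sim_sol F 1 1 x p)); auto.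
        { intros t Ht. symmetry. apply Hwbs; lra. }
        eapply sim_sol_x_derivative; eauto; lra.
      * apply (weaken_bound _ (Cb + K) _ _ (gauss g x p)); try (unfold B; lra);
          [|split; [left; apply PG|apply Rle_refl]].
        apply Rabs_minus_bound.
        -- apply (weaken_bound _ Cb _ _ (gauss gb x p)); try lra.
           split; [left; apply PG|]. apply gauss_antitone; lra.
        -- apply (weaken_bound _ K _ _ (gauss c x p)); try lra.
           split; [left; apply PG|]. apply gauss_antitone; lra.
Qed.
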